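(* There exist $\epsilon>0$ with $U_\epsilon(1)\subset U_0$ and functions $g_j$ ($j=0,1,2,\dots$), analytic in $U_\epsilon(1)$ (and depending neither on $n$ nor on $\gamma$), such that for every admissible curve $\gamma$ and every $r\in\mathbb N$ $$F_n(z)=P_n(z)+\frac{1}{\sqrt{2\pi n}}\left(\sum_{j=0}^{r-1}\frac{g_j(z)}{n^j}+O\left(\frac1{n^r}\right)\right)\qquad (n\to\infty),$$ where the error term is uniform for $z\in U_\epsilon(1)\setminus(\gamma\cup\Pi)$; that is, there are constants $C,N$ depending only on $\gamma$ and $r$ such that the $O(n^{-r})$ term is bounded in modulus by $Cn^{-r}$ for all $n\ge N$ and all such $z$. The Taylor coefficients of all $g_j$ at $z_0=1$ are explicitly computable; for example, $$g_0(z)=\frac13-\frac1{12}(z-1)+O\left((z-1)^2\right)\qquad (z\to 1).$$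
   Context: Notation: $U_\delta(a)=\{z\in\mathbb C:|z-a|<\delta\}$. Let $\phi(s)=s-1-\ln s$, with $\ln$ the standard branch of the logarithm slit along the negative real axis. Note that $\Re\phi(s)=\Re s-1-\ln|s|$ makes sense for all $s\ne0$ and that $e^{n\phi(s)}=s^{-n}e^{n(s-1)}$ for $n\in\mathbb N$ is analytic on $\mathbb C\setminus\{0\}$. The point $z_0=1$ is the only critical point of $\phi$, and $\phi(1)=0$. Let $S=\{z\in\mathbb C\setminus\{0\}:\Re\phi(z)=0\}$. The path of steepest descent of $\Re\phi$ away from $1$ is $\Pi=\{z\in\mathbb C\setminus(-\infty,0]:\arg z=\Im z,\ \Re\phi(z)\le0\}$, with $\arg z\in(-\pi,\pi)$; equivalently, $\Im\phi(z)=0$ and $\Re\phi(z)\le 0$. A contour $\gamma$ is called admissible if (i) $\gamma$ is a smooth Jordan curve winding counterclockwise around the origin, and (ii) there is an open neighborhood $U$ of $1$ such that $\gamma\cap U=\Pi\cap U$ and $\gamma\setminus U$ has positive distance from $S$. For an admissible $\gamma$, $n\in\mathbb N$ and $z\in\mathbb C\setminus\gamma$ define $$F_n(z)=\frac1{2\pi i}\int_\gamma\frac{e^{n\phi(s)}}{s-z}\,ds.$$ Local change of variables: since $\phi''(1)\ne0$, there are $\delta_0>0$, an open neighborhood $U_0$ of $1$ and a biholomorphic map $\lambda:U_{\delta_0}(0)\to U_0$ with $\phi(\lambda(\xi))=\xi^2$ for $\xi\in U_{\delta_0}(0)$, $\lambda(0)=1$, $\lambda'(0)=\sqrt2$; fix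 these. The map $\lambda$ sends $i\mathbb R\cap U_{\delta_0}(0)$ onto $\Pi\cap U_0$. Define $$h(\zeta)=\frac1{2\pi i}\int_{\mathbb R}\frac{e^{-u^2}}{u-\zeta}\,du,\quad \zeta\in\mathbb C\setminus\mathbb R,\qquad P_n(z)=h\left(-i\sqrt n\,\lambda^{-1}(z)\right),\quad z\in U_0\setminus\Pi.$$ *)

(* Defs.v *)
From Stdlib Require Import Reals QArith Qreals List Lra Lia.
From Coquelicot Require Export Coquelicot.

Open Scope R_scope.
Open Scope C_scope.

Definition Cexp (z : C) : C :=
  ((exp (Re z) * cos (Im z))%R, (exp (Re z) * sin (Im z))%R).

(** Principal argument.  For [z <> 0] it lies in (-PI, PI], and the value [PI]
    is attained exactly on the negative real axis. *)
Definition Carg (z : C) : R :=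
  if Rlt_dec (Im z) 0 then (- acos (Re z / Cmod z))%R
  else acos (Re z / Cmod z).

Definition Clog (z : C) : C := (ln (Cmod z), Carg z).

Definition slit_plane (z : C) : Prop := ~ (Im z = 0%R /\ (Re z <= 0)%R).

Definition disk (a : C) (r : R) (z : C) : Prop := (Cmod (z - a) < r)%R.

Definition holomorphic_on (D : C -> Prop) (f : C -> C) : Prop :=
  forall z, D z -> ex_derive (K := C_AbsRing) (V := C_NormedModule) f z.

Definition biholomorphic (D E : C -> Prop) (f finv : C -> C) : Prop :=
  (forall z, D z -> E (f z) /\ finv (f z) = z) /\
  (forall w, E w -> D (finv w) /\ f (finv w) = w) /\
  holomorphic_on D f /\ holomorphic_on E finv.

Definition taylor_coefficients (f : C -> C) (a : C) (c : nat -> C) : Prop :=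
  exists rho : R, (0 < rho)%R /\
    forall z, disk a rho z ->
      is_pseries (K := C_AbsRing) (V := C_NormedModule) c (z - a) (f z).

Fixpoint Csum (f : nat -> C) (r : nat) : C :=
  match r with
  | O => 0
  | S r' => Csum f r' + f r'
  end.

(** A closed curve is a 1-periodic function on the line, so that smoothness at the
    base point needs no separate clause. *)

Definition on_curve (gam : R -> C) (z : C) : Prop := exists t : R, gam t = z.

Definition velocity (gam : R -> C) (t : R) : C :=
  (Derive (fun u => Re (gam u)) t, Derive (fun u => Im (gam u)) t).

(** Smooth means continuously differentiable with nowhere vanishing
    velocity. *)
Definition smooth_jordan (gam : R -> C) : Prop :=
  (forall t : R, gam (t + 1)%R = gam t) /\
  (forall t : R, ex_derive (K := R_AbsRing) (V := C_R_NormedModule) gam t) /\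
  (forall t : R, continuous (velocity gam) t) /\
  (forall t : R, velocity gam t <> 0) /\
  (forall s t : R, (0 <= s < 1)%R -> (0 <= t < 1)%R -> gam s = gam t -> s = t).

Definition contour_integral (gam : R -> C) (f : C -> C) : C :=
  RInt (V := C_R_CompleteNormedModule)
    (fun t => f (gam t) * velocity gam t) 0 1.

Definition winding_number (gam : R -> C) (a : C) : C :=
  / (2 * PI * Ci) * contour_integral gam (fun s => / (s - a)).

Definition phi (s : C) : C := s - 1 - Clog s.

Definition level_set (z : C) : Prop := z <> 0 /\ Re (phi z) = 0%R.

Definition descent_path (z : C) : Prop :=
  slit_plane z /\ Carg z = Im z /\ (Re (phi z) <= 0)%R.

Definition admissible (gam : R -> C) : Prop :=
  smooth_jordan gam /\
  ~ on_curve gam 0 /\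
  winding_number gam 0 = 1 /\
  exists U : C -> Prop,
    open U /\ U 1 /\
    (forall z, U z -> (on_curve gam z <-> descent_path z)) /\
    exists d : R, (0 < d)%R /\
      forall z s, on_curve gam z -> ~ U z -> level_set s ->
        (d <= Cmod (z - s))%R.

(** [Clog] jumps across the negative real axis, but the integrand does not: by
    [Cexp_phi] below it is s^{-n} e^{n(s-1)} at every [s <> 0]. *)
Definition F (gam : R -> C) (n : nat) (z : C) : C :=
  / (2 * PI * Ci) *
  contour_integral gam (fun s => Cexp (INR n * phi s) / (s - z)).

Lemma Cexp_plus (z w : C) : Cexp (z + w) = Cexp z * Cexp w.
Proof.
destruct z as [a b], w as [c d]; unfold Cexp, Cplus, Cmult, Re, Im; simpl.
rewrite exp_plus, cos_plus, sin_plus; f_equal; ring.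
Qed.

Lemma Cexp_Clog (s : C) : s <> 0 -> Cexp (Clog s) = s.
Proof.
intros Hs; pose proof (proj1 (Cmod_gt_0 s) Hs) as Hm.
destruct s as [x y]; unfold Cexp, Clog, Carg; simpl.
set (m := Cmod (x, y)) in *.
assert (Hmm : (m * m = x * x + y * y)%R).
{ unfold m, Cmod; simpl; rewrite sqrt_sqrt; nra. }
assert (Hu : (-1 <= x / m <= 1)%R).
{ assert (Hxm : (- m <= x <= m)%R) by (split; nra).
  split; apply Rmult_le_reg_r with m; try exact Hm;
    replace (x / m * m)%R with x by (field; lra); lra. }
assert (Hsin : (m * sin (acos (x / m)) = Rabs y)%R).
{ rewrite sin_acos by exact Hu.
  rewrite <- sqrt_Rsqr_abs.
  rewrite <- (sqrt_Rsqr m) at 1 by lra.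
  rewrite <- sqrt_mult_alt by apply Rle_0_sqr.
  f_equal; unfold Rsqr.
  replace (m * m * (1 - x / m * (x / m)))%R with (m * m - x * x)%R
    by (field; lra); lra. }
rewrite exp_ln by exact Hm.
destruct (Rlt_dec y 0) as [Hy | Hy].
- rewrite cos_neg, sin_neg, cos_acos by exact Hu.
  f_equal; [field; lra|].
  rewrite Rabs_left in Hsin by exact Hy; lra.
- rewrite cos_acos by exact Hu.
  f_equal; [field; lra|].
  rewrite Rabs_right in Hsin by lra; lra.
Qed.

Lemma Cexp_phi (n : nat) (s : C) :
  s <> 0 -> Cexp (INR n * phi s) = Cexp (INR n * (s - 1)) / s ^ n.
Proof.
intros Hs.
assert (Hn : forall w, Cexp (INR n * w) = Cexp w ^ n).
{ intros w; induction n as [|n IH].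
  - simpl; unfold Cexp, Cmult, Re, Im; simpl.
    rewrite !Rmult_0_l, Rminus_0_r, Rplus_0_l, exp_0, cos_0, sin_0.
    unfold RtoC; f_equal; ring.
  - rewrite Cpow_S, <- IH, <- Cexp_plus, S_INR, RtoC_plus; f_equal; ring. }
assert (Hp : Cexp (s - 1) = Cexp (phi s) * s).
{ rewrite <- (Cexp_Clog s Hs) at 3.
  rewrite <- Cexp_plus; f_equal; unfold phi; ring. }
rewrite !Hn, Hp, Cpow_mult_l; field.
now apply Cpow_nz.
Qed.

Definition local_coordinate
    (delta0 : R) (U0 : C -> Prop) (lam laminv : C -> C) : Prop :=
  (0 < delta0)%R /\
  open U0 /\ U0 1 /\
  (forall z, U0 z -> slit_plane z) /\
  biholomorphic (disk 0 delta0) U0 lam laminv /\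
  (forall xi, disk 0 delta0 xi -> phi (lam xi) = xi ^ 2) /\
  lam 0 = 1 /\
  is_derive (K := C_AbsRing) (V := C_NormedModule) lam (RtoC 0) (RtoC (sqrt 2)).

Definition h (zeta : C) : C :=
  / (2 * PI * Ci) *
  RInt_gen (V := C_R_CompleteNormedModule)
    (fun u : R => exp (- u ^ 2) / (u - zeta))
    (Rbar_locally m_infty) (Rbar_locally p_infty).

Definition P (laminv : C -> C) (n : nat) (z : C) : C :=
  h (- Ci * sqrt (INR n) * laminv z).

(** Put t = z - 1 and let y = sqrt 2 * laminv z be the root of y^2 = 2 phi z
    with y ~ t.  Expanding the integral defining F around s = 1 gives

      g_0 = 1 / y - 1 / t.

    Both F and P satisfy first order linear differential equations in z (for F,
    integrate by parts), and comparing powers of n in the equation for F - P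
    gives

      t * g_(j+1) = z * g_j' - g_j'(1).

    All Taylor coefficients at 1 are therefore rational, and [gcoef] computes
    them.  The series of t / y is the power -1/2 of that of 2 phi z / t^2,

      2 phi z / t^2 = sum_i 2 (-1)^i / (i + 2) * t^i,

    whence the linear recurrence

      2 k G_k = - sum_(1 <= i <= k) (2 k - i) * 2 (-1)^i / (i + 2) * G_(k-i)

    for its coefficients G_k. *)

Definition Qnat (n : nat) : Q := inject_Z (Z.of_nat n).

Definition phase_coef (i : nat) : Q :=
  ((if Nat.even i then 2 else -2) / Qnat (i + 2))%Q.

(** The list G_k, ..., G_0. *)
Fixpoint root_coefs (k : nat) : list Q :=
  match k with
  | O => (1%Q :: nil)%list
  | S k' =>
      let l := root_coefs k' in
      let next :=
        fold_right
          (fun i acc =>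
             (acc - Qnat (2 * k - i) * phase_coef i * nth (i - 1) l 0)%Q)
          0%Q (seq 1 k) in
      (Qred (next / Qnat (2 * k)) :: l)%list
  end.

Fixpoint gcoef (j k : nat) : Q :=
  match j with
  | O => hd 0%Q (root_coefs (S k))
  | S j' =>
      Qred (Qnat (k + 2) * gcoef j' (k + 2) + Qnat (k + 1) * gcoef j' (k + 1))
  end.

(* Main.v *)
(* Partial fractions and the exponential series give F exactly: with w the winding number of
   gamma about z,

     F_n(z) = w e^{n phi(z)} + F_out n z,   F_out n z = - e^{-n} z^{-n} sum_(k < n) (n z)^k / k!,

   so gamma enters only through w.  As Re phi < 0 on gamma away from 1, w equals 1 to the left
   of the descent path and 0 to its right unless Re phi(z) <= - mu, where w is bounded and
   e^{n phi(z)} is exponentially small.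

   In the coordinate z = lam(xi), phi = xi^2, both F_out and P solve first order equations
   u' = 2 n xi u + (explicit), and gcoef is designed so that the truncated expansion solves
   the same equation as F_out - P up to an error R which is constant (the defect of Stirling's
   series) plus O(n^{-m}).  Dividing by e^{n xi^2} and integrating along horizontal lines
   away from Re xi = 0, where e^{-n Re xi^2} decreases, bounds the remainder by R.  The defect
   is bounded in the same way: integrating from one side to the other, the two half-plane
   solutions have to match at xi = 0, where F and P have the same jump.  In particular
   Stirling's series is a by-product. *)

(* The obstacle is uniformity up to the curve: there the Cauchy kernel is singular in F and in P
   alike, and only the difference is small. The explicit form of F removes the kernel and any
   deformation of contours. What remains on gamma are integrands with explicit primitives and the
   two kernels whose integrals are winding numbers; local constancy and boundedness of the winding
   number stand in for the Jordan curve theorem. The values at Re xi = b and Re xi = - b enter only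
   through crude bounds. These suffice because e^{-n xi^2} is there smaller than at the points in
   question, where |Re xi| <= b/2, by the factor e^{-3 n b^2 / 4}. No asymptotics of n! is assumed,
   so the constant in R has to be estimated too. Its bound comes from a Gaussian of width n^{-1/2},
   and the normalization sqrt(2 pi n) costs another n^{1/2}: one power of n is lost. The expansion
   is therefore carried one order beyond what R = O(n^{-r}) seems to require, and the surplus terms
   are moved into the error. *)
Require Import Defs.
From Stdlib Require Import Reals QArith Qreals Factorial List Lra Lia.
From Coquelicot Require Import Coquelicot.

Open Scope R_scope.
Open Scope C_scope.

(** * Derivatives of complex-valued functions *)

(* Neighbourhoods of [a] pulled back along [i]: with [i] the identity of [C] the predicates
   [cont] and [der] below are complex continuity and differentiability, and with [i = RtoC]
   they are those of curves; the calculus rules are proved once for both. *)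
Definition nb {X : Type} (i : X -> C) (a : C) (Q : X -> Prop) : Prop :=
  exists d : R, (0 < d)%R /\ forall x, (Cmod (i x - a) < d)%R -> Q x.

Lemma nb_and {X} (i : X -> C) a (Q1 Q2 : X -> Prop) :
  nb i a Q1 -> nb i a Q2 -> nb i a (fun x => Q1 x /\ Q2 x).
Proof.
intros (d1 & H1 & K1) (d2 & H2 & K2).
exists (Rmin d1 d2); split; [now apply Rmin_pos|].
intros x Hx; split; [apply K1|apply K2];
  eapply Rlt_le_trans; try exact Hx; [apply Rmin_l|apply Rmin_r].
Qed.

Lemma nb_imp {X} (i : X -> C) a (Q1 Q2 : X -> Prop) :
  (forall x, Q1 x -> Q2 x) -> nb i a Q1 -> nb i a Q2.
Proof. intros H (d & Hd & K); exists d; auto. Qed.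

Lemma nb_all {X} (i : X -> C) a (Q : X -> Prop) : (forall x, Q x) -> nb i a Q.
Proof. intros H; exists 1%R; split; [lra|auto]. Qed.

Lemma nb_near {X} (i : X -> C) a (e : R) :
  (0 < e)%R -> nb i a (fun x => Cmod (i x - a) < e)%R.
Proof. intros; exists e; auto. Qed.

Lemma Cmod_sym (z w : C) : Cmod (z - w) = Cmod (w - z).
Proof. rewrite <- Cmod_opp; f_equal; ring. Qed.

Lemma Cmod_le_sub (z w : C) : (Cmod z - Cmod w <= Cmod (z - w))%R.
Proof.
pose proof (Cmod_triangle (z - w) w) as H.
replace (z - w + w) with z in H by ring; lra.
Qed.

Lemma nb_at {X} (i : X -> C) x (Q : X -> Prop) : nb i (i x) Q -> Q x.
Proof.
intros (d & Hd & K); apply K.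
replace (i x - i x) with (RtoC 0) by ring; now rewrite Cmod_0.
Qed.

Definition cont {X} (i : X -> C) (f : X -> C) (x : X) : Prop :=
  forall e : R, (0 < e)%R -> nb i (i x) (fun y => Cmod (f y - f x) < e)%R.

Definition der {X} (i : X -> C) (f : X -> C) (x : X) (l : C) : Prop :=
  forall e : R, (0 < e)%R ->
    nb i (i x) (fun y => Cmod (f y - f x - (i y - i x) * l)
                         <= e * Cmod (i y - i x))%R.

Notation Cid := (fun z : C => z).

Section Rules.
Context {X : Type} (i : X -> C).

Lemma cont_const c x : cont i (fun _ => c) x.
Proof.
intros e He; apply nb_all; intros _.
replace (c - c) with (RtoC 0) by ring; now rewrite Cmod_0.
Qed.

Lemma cont_ext (f g : X -> C) x : (forall y, f y = g y) -> cont i f x -> cont i g x.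
Proof. intros H K e He; specialize (K e He); revert K; apply nb_imp; intros y; now rewrite !H. Qed.

Lemma cont_plus (f g : X -> C) x : cont i f x -> cont i g x -> cont i (fun y => f y + g y) x.
Proof.
intros Hf Hg e He.
generalize (nb_and _ _ _ _ (Hf (e / 2)%R ltac:(lra)) (Hg (e / 2)%R ltac:(lra))).
apply nb_imp; intros y [H1 H2].
replace (f y + g y - (f x + g x)) with ((f y - f x) + (g y - g x)) by ring.
eapply Rle_lt_trans; [apply Cmod_triangle|lra].
Qed.

Lemma cont_opp (f : X -> C) x : cont i f x -> cont i (fun y => - f y) x.
Proof.
intros Hf e He; generalize (Hf e He); apply nb_imp; intros y H.
replace (- f y - - f x) with (- (f y - f x)) by ring; now rewrite Cmod_opp.
Qed.

Lemma cont_minus (f g : X -> C) x : cont i f x -> cont i g x -> cont i (fun y => f y - g y) x.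
Proof. intros; apply cont_plus; [easy|now apply cont_opp]. Qed.

Lemma cont_mult (f g : X -> C) x : cont i f x -> cont i g x -> cont i (fun y => f y * g y) x.
Proof.
intros Hf Hg e He.
pose proof (Cmod_ge_0 (f x)); pose proof (Cmod_ge_0 (g x)).
set (M := (Cmod (f x) + Cmod (g x) + 1)%R).
assert (HM : (0 < M)%R) by (unfold M; lra).
set (e' := Rmin 1 (e / (2 * M))).
assert (He' : (0 < e')%R).
{ apply Rmin_pos; [lra|]; apply Rdiv_lt_0_compat; lra. }
assert (E1 : (e' <= 1)%R) by apply Rmin_l.
assert (E2 : (e' * (2 * M) <= e)%R).
{ apply Rle_trans with (e / (2 * M) * (2 * M))%R.
  - apply Rmult_le_compat_r; [lra|apply Rmin_r].
  - right; field; lra. }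
assert (EM : (M = Cmod (f x) + Cmod (g x) + 1)%R) by reflexivity.
clearbody e' M.
generalize (nb_and _ _ _ _ (Hf e' He') (Hg e' He')).
apply nb_imp; intros y [H1 H2].
replace (f y * g y - f x * g x)
  with ((f y - f x) * (g y - g x) + (f y - f x) * g x + f x * (g y - g x)) by ring.
eapply Rle_lt_trans; [apply Cmod_triangle|].
eapply Rle_lt_trans; [apply Rplus_le_compat_r, Cmod_triangle|].
rewrite !Cmod_mult.
pose proof (Cmod_ge_0 (f y - f x)); pose proof (Cmod_ge_0 (g y - g x)).
assert (Q1 : (Cmod (f y - f x) * Cmod (g y - g x) <= e' * 1)%R)
  by (apply Rmult_le_compat; lra).
assert (Q2 : (Cmod (f y - f x) * Cmod (g x) <= e' * Cmod (g x))%R)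
  by (apply Rmult_le_compat_r; lra).
assert (Q3 : (Cmod (f x) * Cmod (g y - g x) <= Cmod (f x) * e')%R)
  by (apply Rmult_le_compat_l; lra).
assert (0 < e' * M)%R by now apply Rmult_lt_0_compat.
rewrite EM in E2, H5; lra.
Qed.

Lemma cont_comp (g : C -> C) (f : X -> C) x :
  cont Cid g (f x) -> cont i f x -> cont i (fun y => g (f y)) x.
Proof.
intros Hg Hf e He; destruct (Hg e He) as (d & Hd & K).
generalize (Hf d Hd); apply nb_imp; intros y Hy; now apply K.
Qed.

Lemma cont_id x : cont i i x.
Proof. intros e He; now apply nb_near. Qed.

Lemma cont_inv_id (z : C) : z <> 0 -> cont Cid (fun w => / w) z.
Proof.
intros Hz e He; pose proof (proj1 (Cmod_gt_0 z) Hz) as Hm.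
set (m := Cmod z) in *.
exists (Rmin (m / 2) (e * (m * m / 2))); split.
{ apply Rmin_pos; [lra|]; apply Rmult_lt_0_compat; [easy|]; nra. }
intros w Hw.
assert (H1 : (Cmod (w - z) < m / 2)%R) by (eapply Rlt_le_trans; [exact Hw|apply Rmin_l]).
assert (H2 : (Cmod (w - z) < e * (m * m / 2))%R) by (eapply Rlt_le_trans; [exact Hw|apply Rmin_r]).
pose proof (Cmod_le_sub z w) as H3; rewrite Cmod_sym in H3; fold m in H3.
assert (Hw0 : w <> 0).
{ apply Cmod_gt_0; lra. }
replace (/ w - / z) with (- (w - z) * (/ w * / z)) by (field; auto).
rewrite !Cmod_mult, Cmod_opp, !Cmod_inv by auto; fold m.
apply Rmult_lt_reg_r with (Cmod w * m)%R; [nra|].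
replace (Cmod (w - z) * (/ Cmod w * / m) * (Cmod w * m))%R with (Cmod (w - z))
  by (field; split; lra).
assert (Hk : (m * (m / 2) <= m * Cmod w)%R) by (apply Rmult_le_compat_l; lra).
assert (Hk2 : (e * (m * (m / 2)) <= e * (m * Cmod w))%R) by (apply Rmult_le_compat_l; lra).
lra.
Qed.

Lemma cont_inv (f : X -> C) x : f x <> 0 -> cont i f x -> cont i (fun y => / f y) x.
Proof. intros H K; apply (cont_comp (fun w => / w) f x); [apply cont_inv_id; exact H|exact K]. Qed.

Lemma cont_pow (f : X -> C) n x : cont i f x -> cont i (fun y => f y ^ n) x.
Proof.
intros H; induction n as [|n IH]; [exact (cont_const 1 x)|].
apply (cont_ext (fun y => f y * f y ^ n)); [intros; now rewrite Cpow_S|].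
now apply cont_mult.
Qed.

Lemma cont_Csum (f : nat -> X -> C) N x :
  (forall k, (k < N)%nat -> cont i (f k) x) ->
  cont i (fun y => Csum (fun k => f k y) N) x.
Proof.
induction N as [|N IH]; intros H; simpl; [exact (cont_const 0 x)|].
apply cont_plus; [apply IH; intros; apply H; lia|apply H; lia].
Qed.

Lemma der_cont (f : X -> C) x l : der i f x l -> cont i f x.
Proof.
intros H e He.
destruct (H 1%R ltac:(lra)) as (d & Hd & K).
pose proof (Cmod_ge_0 l) as Hl.
exists (Rmin d (e / (Cmod l + 2))); split.
{ apply Rmin_pos; [easy|]; apply Rdiv_lt_0_compat; lra. }
intros y Hy.
assert (H1 : (Cmod (i y - i x) < d)%R) by (eapply Rlt_le_trans; [exact Hy|apply Rmin_l]).
assert (H2 : (Cmod (i y - i x) < e / (Cmod l + 2))%R) by (eapply Rlt_le_trans; [exact Hy|apply Rmin_r]).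
apply (Rmult_lt_compat_r (Cmod l + 2)) in H2; [|lra].
replace (e / (Cmod l + 2) * (Cmod l + 2))%R with e in H2 by (field; lra).
specialize (K y H1).
replace (f y - f x) with ((f y - f x - (i y - i x) * l) + (i y - i x) * l) by ring.
eapply Rle_lt_trans; [apply Cmod_triangle|].
rewrite Cmod_mult; pose proof (Cmod_ge_0 (i y - i x)); nra.
Qed.

Lemma der_ext_loc (f g : X -> C) x l :
  nb i (i x) (fun y => f y = g y) -> der i f x l -> der i g x l.
Proof.
intros H K e He; pose proof (nb_at _ _ _ H) as Hx; simpl in Hx.
generalize (nb_and _ _ _ _ H (K e He)); apply nb_imp; intros y [E L].
now rewrite <- E, <- Hx.
Qed.

Lemma der_ext (f g : X -> C) x l : (forall y, f y = g y) -> der i f x l -> der i g x l.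
Proof. intros H; apply der_ext_loc; now apply nb_all. Qed.

Lemma der_eq (f : X -> C) x l l' : l = l' -> der i f x l -> der i f x l'.
Proof. now intros ->. Qed.

Lemma der_id x : der i i x 1.
Proof.
intros e He; apply nb_all; intros y.
replace (i y - i x - (i y - i x) * 1) with (RtoC 0) by ring.
rewrite Cmod_0; pose proof (Cmod_ge_0 (i y - i x)); nra.
Qed.

Lemma der_const c x : der i (fun _ => c) x 0.
Proof.
intros e He; apply nb_all; intros y.
replace (c - c - (i y - i x) * 0) with (RtoC 0) by ring.
rewrite Cmod_0; pose proof (Cmod_ge_0 (i y - i x)); nra.
Qed.

Lemma der_plus (f g : X -> C) x l m :
  der i f x l -> der i g x m -> der i (fun y => f y + g y) x (l + m).
Proof.
intros Hf Hg e He.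
generalize (nb_and _ _ _ _ (Hf (e / 2)%R ltac:(lra)) (Hg (e / 2)%R ltac:(lra))).
apply nb_imp; intros y [H1 H2].
replace (f y + g y - (f x + g x) - (i y - i x) * (l + m))
  with ((f y - f x - (i y - i x) * l) + (g y - g x - (i y - i x) * m)) by ring.
eapply Rle_trans; [apply Cmod_triangle|lra].
Qed.

Lemma der_opp (f : X -> C) x l : der i f x l -> der i (fun y => - f y) x (- l).
Proof.
intros Hf e He; generalize (Hf e He); apply nb_imp; intros y H.
replace (- f y - - f x - (i y - i x) * - l)
  with (- (f y - f x - (i y - i x) * l)) by ring; now rewrite Cmod_opp.
Qed.

Lemma der_minus (f g : X -> C) x l m :
  der i f x l -> der i g x m -> der i (fun y => f y - g y) x (l - m).
Proof. intros; apply der_plus; [easy|now apply der_opp]. Qed.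

Lemma der_mult (f g : X -> C) x l m :
  der i f x l -> der i g x m ->
  der i (fun y => f y * g y) x (l * g x + f x * m).
Proof.
intros Hf Hg e He.
pose proof (der_cont _ _ _ Hf) as Cf.
pose proof (Cmod_ge_0 (f x)) as G1; pose proof (Cmod_ge_0 (g x)) as G2;
  pose proof (Cmod_ge_0 m) as G3.
set (M := (Cmod (f x) + Cmod (g x) + Cmod m + 1)%R).
assert (HM : (0 < M)%R) by (unfold M; lra).
set (e' := Rmin 1 (e / (3 * M))).
assert (He' : (0 < e')%R).
{ apply Rmin_pos; [lra|]; apply Rdiv_lt_0_compat; lra. }
assert (E1 : (e' <= 1)%R) by apply Rmin_l.
assert (E2 : (e' * (3 * M) <= e)%R).
{ apply Rle_trans with (e / (3 * M) * (3 * M))%R.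
  - apply Rmult_le_compat_r; [lra|apply Rmin_r].
  - right; field; lra. }
assert (EM : (M = Cmod (f x) + Cmod (g x) + Cmod m + 1)%R) by reflexivity.
clearbody e' M.
generalize (nb_and _ _ _ _ (Cf e' He') (nb_and _ _ _ _ (Hf e' He') (Hg e' He'))).
apply nb_imp; intros y (H1 & H2 & H3).
set (dx := i y - i x) in *.
replace (f y * g y - f x * g x - dx * (l * g x + f x * m))
  with ((f y - f x - dx * l) * g x + f x * (g y - g x - dx * m)
        + ((f y - f x) * (g y - g x - dx * m) + (f y - f x) * dx * m)) by ring.
eapply Rle_trans; [apply Cmod_triangle|].
eapply Rle_trans; [apply Rplus_le_compat; apply Cmod_triangle|].
rewrite !Cmod_mult.
pose proof (Cmod_ge_0 dx) as Hd.
set (D := Cmod dx) in *.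
pose proof (Cmod_ge_0 (f y - f x)); pose proof (Cmod_ge_0 (g y - g x - dx * m)).
assert (Q1 : (Cmod (f y - f x - dx * l) * Cmod (g x) <= e' * D * Cmod (g x))%R)
  by (apply Rmult_le_compat_r; lra).
assert (Q2 : (Cmod (f x) * Cmod (g y - g x - dx * m) <= Cmod (f x) * (e' * D))%R)
  by (apply Rmult_le_compat_l; lra).
assert (Q3 : (Cmod (f y - f x) * Cmod (g y - g x - dx * m) <= 1 * (e' * D))%R)
  by (apply Rmult_le_compat; lra).
assert (Q4 : (Cmod (f y - f x) * D * Cmod m <= e' * D * Cmod m)%R).
{ apply Rmult_le_compat_r; [easy|]; apply Rmult_le_compat_r; lra. }
apply Rle_trans with (e' * M * D)%R.
{ apply Rle_trans with (e' * D * Cmod (g x) + Cmod (f x) * (e' * D)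
    + (1 * (e' * D) + e' * D * Cmod m))%R; [lra|].
  right; rewrite EM; ring. }
apply Rmult_le_compat_r; [easy|nra].
Qed.

Lemma der_scal c (f : X -> C) x l : der i f x l -> der i (fun y => c * f y) x (c * l).
Proof.
intros H; eapply der_eq; [|apply (der_mult (fun _ => c)); [apply der_const|exact H]].
ring.
Qed.

Lemma der_comp (g : C -> C) (f : X -> C) x l m :
  der Cid g (f x) m -> der i f x l -> der i (fun y => g (f y)) x (m * l).
Proof.
intros Hg Hf e He.
pose proof (der_cont _ _ _ Hf) as Cf.
pose proof (Cmod_ge_0 l) as Hl; pose proof (Cmod_ge_0 m) as Hm.
set (e1 := (e / (2 * (Cmod l + 1)))%R).
assert (He1 : (0 < e1)%R) by (apply Rdiv_lt_0_compat; lra).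
set (e2 := Rmin 1 (e / (2 * (Cmod m + 1)))%R).
assert (He2 : (0 < e2)%R) by (apply Rmin_pos; [lra|apply Rdiv_lt_0_compat; lra]).
assert (E1 : (e1 * (Cmod l + 1) = e / 2)%R) by (unfold e1; field; lra).
assert (E2 : (e2 <= 1)%R) by apply Rmin_l.
assert (E3 : (e2 * (Cmod m + 1) <= e / 2)%R).
{ apply Rle_trans with (e / (2 * (Cmod m + 1)) * (Cmod m + 1))%R.
  - apply Rmult_le_compat_r; [lra|apply Rmin_r].
  - right; field; lra. }
destruct (Hg e1 He1) as (d & Hd & K).
generalize (nb_and _ _ _ _ (Cf d Hd) (Hf e2 He2)).
apply nb_imp; intros y [H1 H2].
specialize (K (f y) H1); simpl in K.
set (dx := i y - i x) in *.
replace (g (f y) - g (f x) - dx * (m * l))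
  with ((g (f y) - g (f x) - (f y - f x) * m) + (f y - f x - dx * l) * m) by ring.
eapply Rle_trans; [apply Cmod_triangle|]; rewrite Cmod_mult.
pose proof (Cmod_ge_0 dx) as HD; set (D := Cmod dx) in *.
assert (H3 : (Cmod (f y - f x) <= (Cmod l + 1) * D)%R).
{ replace (f y - f x) with ((f y - f x - dx * l) + dx * l) by ring.
  eapply Rle_trans; [apply Cmod_triangle|]; rewrite Cmod_mult; fold D; nra. }
assert (Q1 : (e1 * Cmod (f y - f x) <= e / 2 * D)%R).
{ rewrite <- E1, Rmult_assoc; apply Rmult_le_compat_l; lra. }
assert (Q2 : (Cmod (f y - f x - dx * l) * Cmod m <= e / 2 * D)%R).
{ apply Rle_trans with (e2 * D * (Cmod m + 1))%R.
  - apply Rmult_le_compat; try lra; apply Cmod_ge_0.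
  - nra. }
lra.
Qed.

Lemma der_inv_id (z : C) : z <> 0 -> der Cid (fun w => / w) z (- / (z * z)).
Proof.
intros Hz e He; pose proof (proj1 (Cmod_gt_0 z) Hz) as Hm.
destruct (cont_inv_id z Hz (e * Cmod z)%R ltac:(nra)) as (d & Hd & K).
exists (Rmin d (Cmod z)); split; [now apply Rmin_pos|].
intros w Hw.
assert (H1 : (Cmod (w - z) < d)%R) by (eapply Rlt_le_trans; [exact Hw|apply Rmin_l]).
assert (H2 : (Cmod (w - z) < Cmod z)%R) by (eapply Rlt_le_trans; [exact Hw|apply Rmin_r]).
pose proof (Cmod_le_sub z w) as H3; rewrite Cmod_sym in H3.
assert (Hw0 : w <> 0) by (apply Cmod_gt_0; lra).
specialize (K w H1); simpl in K.
replace (/ w - / z - (w - z) * - / (z * z)) with ((w - z) * (- (/ w - / z) * / z))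
  by (field; auto).
rewrite !Cmod_mult, Cmod_opp, Cmod_inv by easy.
rewrite (Rmult_comm e); apply Rmult_le_compat_l; [apply Cmod_ge_0|].
apply Rmult_le_reg_r with (Cmod z); [easy|].
rewrite Rmult_assoc, Rinv_l by lra; lra.
Qed.

Lemma der_inv (f : X -> C) x l :
  f x <> 0 -> der i f x l -> der i (fun y => / f y) x (- l / (f x * f x)).
Proof.
intros H K; eapply der_eq; [|apply (der_comp (fun w => / w)); [now apply der_inv_id|exact K]].
field; auto.
Qed.

Lemma der_div (f g : X -> C) x l m :
  g x <> 0 -> der i f x l -> der i g x m ->
  der i (fun y => f y / g y) x ((l * g x - f x * m) / (g x * g x)).
Proof.
intros H K L.
eapply der_eq; [|apply der_mult; [exact K|apply der_inv; [exact H|exact L]]].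
cbv beta; field; auto.
Qed.

Lemma der_pow (f : X -> C) n x l :
  der i f x l -> der i (fun y => f y ^ n) x (INR n * f x ^ (n - 1) * l).
Proof.
intros H; induction n as [|n IH].
- eapply der_eq; [|exact (der_const 1 x)]; simpl; ring.
- apply (der_ext (fun y => f y * f y ^ n)); [intros; now rewrite Cpow_S|].
  eapply der_eq; [|apply der_mult; [exact H|exact IH]].
  rewrite S_INR, RtoC_plus; replace (S n - 1)%nat with n by lia.
  destruct n as [|n]; [simpl; ring|].
  replace (S n - 1)%nat with n by lia; rewrite (Cpow_S (f x) n); ring.
Qed.

Lemma der_Csum (f : nat -> X -> C) (l : nat -> C) N x :
  (forall k, (k < N)%nat -> der i (f k) x (l k)) ->
  der i (fun y => Csum (fun k => f k y) N) x (Csum l N).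
Proof.
induction N as [|N IH]; intros H; simpl; [exact (der_const 0 x)|].
apply der_plus; [apply IH; intros; apply H; lia|apply H; lia].
Qed.

End Rules.

Lemma der_unique (f : C -> C) z l m : der Cid f z l -> der Cid f z m -> l = m.
Proof.
intros Hl Hm.
destruct (Ceq_dec l m) as [|Hne]; [easy|exfalso].
assert (Hp : (0 < Cmod (l - m))%R).
{ apply Cmod_gt_0; intros E; apply Hne.
  replace l with (l - m + m) by ring; rewrite E; ring. }
set (e := (Cmod (l - m) / 4)%R).
destruct (nb_and _ _ _ _ (Hl e ltac:(unfold e; lra)) (Hm e ltac:(unfold e; lra))) as (d & Hd & K).
specialize (K (z + RtoC (d / 2)%R)); simpl in K.
replace (z + RtoC (d / 2)%R - z) with (RtoC (d / 2)%R) in K by ring.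
rewrite Cmod_R, Rabs_pos_eq in K by lra.
destruct K as [K1 K2]; [lra|].
set (u := f (z + RtoC (d / 2)%R) - f z) in *.
pose proof (Cmod_triangle (u - RtoC (d / 2)%R * m) (- (u - RtoC (d / 2)%R * l))) as T.
rewrite Cmod_opp in T.
replace (u - RtoC (d / 2)%R * m + - (u - RtoC (d / 2)%R * l))
  with (RtoC (d / 2)%R * (l - m)) in T by ring.
rewrite Cmod_mult, Cmod_R, Rabs_pos_eq in T by lra.
unfold e in *; nra.
Qed.

(** * Translation to Coquelicot's continuity and differentiability *)

Lemma Cmod_RtoC_sub (s t : R) : Cmod (RtoC s - RtoC t) = Rabs (s - t).
Proof. now rewrite <- RtoC_minus, Cmod_R. Qed.

Lemma Re_le_Cmod (z : C) : (Re z <= Cmod z)%R.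
Proof. eapply Rle_trans; [apply Rle_abs|apply re_le_Cmod]. Qed.

Lemma im_le_Cmod (z : C) : (Rabs (Im z) <= Cmod z)%R.
Proof.
eapply Rle_trans; [|apply Rmax_Cmod]; apply Rmax_r.
Qed.

Lemma cont_of_continuous (f : R -> C) t :
  continuous (U := C_R_NormedModule) f t -> cont RtoC f t.
Proof.
intros H e He.
(* Balls of [C_R_NormedModule] are squares; halving the radius pays for the factor sqrt 2 < 2
   between the two norms. *)
assert (He2 : (0 < e / 2)%R) by lra.
destruct (proj1 (filterlim_locally _ _) H (mkposreal _ He2)) as [d Hd].
exists d; split; [apply cond_pos|]; intros s Hs.
rewrite Cmod_RtoC_sub in Hs.
destruct (Hd s Hs) as [H1 H2].
unfold ball in H1, H2; simpl in H1, H2; unfold AbsRing_ball, abs, minus, plus, opp in H1, H2; simpl in H1, H2.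
eapply Rle_lt_trans; [apply Cmod_2Rmax|].
assert (Hs2 : (sqrt 2 < 2)%R).
{ rewrite <- (sqrt_Rsqr 2) at 2 by lra; apply sqrt_lt_1; unfold Rsqr; lra. }
assert (Hr : (Rmax (Rabs (fst (f s - f t)%C)) (Rabs (snd (f s - f t)%C)) < e / 2)%R).
{ apply Rmax_lub_lt; [exact H1|exact H2]. }
assert (0 <= Rmax (Rabs (fst (f s - f t)%C)) (Rabs (snd (f s - f t)%C)))%R.
{ eapply Rle_trans; [apply Rabs_pos|apply Rmax_l]. }
pose proof (sqrt_pos 2); nra.
Qed.

Lemma continuous_of_cont (f : R -> C) t :
  cont RtoC f t -> continuous (U := C_R_NormedModule) f t.
Proof.
intros H; apply filterlim_locally; intros e.
destruct (H e (cond_pos e)) as (d & Hd & K).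
exists (mkposreal d Hd); intros s Hs.
assert (Hs' : (Cmod (RtoC s - RtoC t) < d)%R) by (rewrite Cmod_RtoC_sub; exact Hs).
specialize (K s Hs').
split; [eapply Rle_lt_trans; [|exact K]; apply (re_le_Cmod (f s - f t))
       |eapply Rle_lt_trans; [|exact K]; apply (im_le_Cmod (f s - f t))].
Qed.

Lemma is_derive_of_der (f : R -> C) t l :
  der RtoC f t l -> is_derive (K := R_AbsRing) (V := C_R_NormedModule) f t l.
Proof.
intros H; split; [apply is_linear_scal_l|].
intros x Hx; apply (is_filter_lim_locally_unique (K := R_AbsRing) (V := R_NormedModule)) in Hx; subst x.
intros e; destruct (H e (cond_pos e)) as (d & Hd & K).
exists (mkposreal d Hd); intros s Hs.
assert (Hs' : (Cmod (RtoC s - RtoC t) < d)%R) by (rewrite Cmod_RtoC_sub; exact Hs).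
specialize (K s Hs'); rewrite Cmod_RtoC_sub in K.
rewrite <- Cmod_norm.
eapply Rle_trans; [right; apply f_equal|exact K].
apply injective_projections; unfold minus, scal, plus, opp, mult; simpl;
  unfold scal, plus, opp, mult; simpl; unfold mult; simpl; ring.
Qed.

Lemma der_of_is_derive (f : R -> C) t l :
  is_derive (K := R_AbsRing) (V := C_R_NormedModule) f t l -> der RtoC f t l.
Proof.
intros [_ H] e He.
destruct (H t (fun P HP => HP) (mkposreal e He)) as [d K].
exists d; split; [apply cond_pos|]; intros s Hs.
rewrite Cmod_RtoC_sub in Hs |- *.
specialize (K s Hs); rewrite <- Cmod_norm in K.
eapply Rle_trans; [right; apply f_equal|exact K].
apply injective_projections; unfold minus, scal, plus, opp, mult; simpl;
  unfold scal, plus, opp, mult; simpl; unfold mult; simpl; ring.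
Qed.

Lemma der_Re_Im (f : R -> C) t l :
  der RtoC f t l ->
  is_derive (fun s => Re (f s)) t (Re l) /\ is_derive (fun s => Im (f s)) t (Im l).
Proof.
intros H.
assert (E : forall s, f s - f t - (RtoC s - RtoC t) * l
  = (Re (f s) - Re (f t) - (s - t) * Re l, Im (f s) - Im (f t) - (s - t) * Im l)%R).
{ intros s; apply injective_projections; simpl; unfold Re, Im; ring. }
split; (split; [apply is_linear_scal_l|]);
 intros x Hx; apply (is_filter_lim_locally_unique (K := R_AbsRing) (V := R_NormedModule)) in Hx; subst x;
 intros e; destruct (H e (cond_pos e)) as (d & Hd & K);
 exists (mkposreal d Hd); intros s Hs;
 (assert (Hs' : (Cmod (RtoC s - RtoC t) < d)%R) by (rewrite Cmod_RtoC_sub; exact Hs));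
 specialize (K s Hs'); rewrite Cmod_RtoC_sub, E in K;
 (eapply Rle_trans; [|exact K]).
- exact (re_le_Cmod (_, _)).
- exact (im_le_Cmod (_, _)).
Qed.

Lemma der_pair (u v : R -> R) t a b :
  is_derive u t a -> is_derive v t b -> der RtoC (fun s => (u s, v s)) t (a, b).
Proof.
intros [_ Hu] [_ Hv] e He.
assert (He2 : (0 < e / 2)%R) by lra.
destruct (Hu t (fun P HP => HP) (mkposreal _ He2)) as [d1 K1].
destruct (Hv t (fun P HP => HP) (mkposreal _ He2)) as [d2 K2].
exists (Rmin d1 d2); split; [apply Rmin_pos; apply cond_pos|].
intros s Hs; rewrite Cmod_RtoC_sub in Hs |- *.
specialize (K1 s (Rlt_le_trans _ _ _ Hs (Rmin_l _ _))).
specialize (K2 s (Rlt_le_trans _ _ _ Hs (Rmin_r _ _))).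
replace ((u s, v s) - (u t, v t) - (RtoC s - RtoC t) * (a, b))
  with (RtoC (u s - u t - (s - t) * a)%R + Ci * RtoC (v s - v t - (s - t) * b)%R)
  by (apply injective_projections; simpl; ring).
eapply Rle_trans; [apply Cmod_triangle|].
rewrite Cmod_mult, Cmod_Ci, !Cmod_R.
unfold norm, minus, scal, plus, opp in K1, K2; simpl in K1, K2.
unfold abs, mult in K1, K2; simpl in K1, K2.
change (Rabs (u s - u t - (s - t) * a) <= e / 2 * Rabs (s - t))%R in K1.
change (Rabs (v s - v t - (s - t) * b) <= e / 2 * Rabs (s - t))%R in K2.
lra.
Qed.

Lemma is_derive_of_Cder (f : C -> C) z l :
  der Cid f z l -> is_derive (K := C_AbsRing) (V := C_NormedModule) f z l.
Proof.
intros H; split; [apply is_linear_scal_l|].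
intros x Hx; apply (is_filter_lim_locally_unique (K := C_AbsRing) (V := AbsRing_NormedModule C_AbsRing)) in Hx; subst x.
intros e; destruct (H e (cond_pos e)) as (d & Hd & K).
exists (mkposreal d Hd); intros w Hw.
exact (K w Hw).
Qed.

Lemma Cder_of_is_derive (f : C -> C) z l :
  is_derive (K := C_AbsRing) (V := C_NormedModule) f z l -> der Cid f z l.
Proof.
intros [_ H] e He.
destruct (H z (fun P HP => HP) (mkposreal e He)) as [d K].
exists d; split; [apply cond_pos|]; intros w Hw.
exact (K w Hw).
Qed.

(** * The complex exponential and its Taylor remainders *)

(** Projecting on the direction of w = f b - f a reduces this to the real mean value theorem: |w| g
    - Re (conj w f) has nonnegative derivative, and Re (conj w (f b - f a)) = |w|^2. *)
Lemma mean_value_le (f f' : R -> C) (g g' : R -> R) (a b : R) :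
  (a <= b)%R ->
  (forall t, (a <= t <= b)%R -> der RtoC f t (f' t)) ->
  (forall t, (a <= t <= b)%R -> is_derive g t (g' t)) ->
  (forall t, (a <= t <= b)%R -> (Cmod (f' t) <= g' t)%R) ->
  (Cmod (f b - f a) <= g b - g a)%R.
Proof.
intros Hab Hf Hg Hle.
set (w := f b - f a).
set (u := fun t => (Cmod w * g t - Re (Cconj w * f t))%R).
set (u' := fun t => (Cmod w * g' t - Re (Cconj w * f' t))%R).
assert (Hu : forall t, (a <= t <= b)%R -> is_derive u t (u' t)).
{ intros t Ht; unfold u, u'.
  apply (is_derive_minus (K := R_AbsRing) (V := R_NormedModule)
           (fun t => Cmod w * g t)%R (fun t => Re (Cconj w * f t))).
  - apply is_derive_scal; auto.
  - apply (der_Re_Im (fun t => Cconj w * f t)).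
    apply (der_scal RtoC (Cconj w)); auto. }
destruct (MVT_gen u a b u') as (c & Hc & E).
{ rewrite Rmin_left, Rmax_right by lra; intros t Ht; apply Hu; lra. }
{ rewrite Rmin_left, Rmax_right by lra; intros t Ht.
  apply continuity_pt_filterlim, (ex_derive_continuous u).
  exists (u' t); now apply Hu. }
rewrite Rmin_left, Rmax_right in Hc by lra.
assert (Hp : (0 <= u' c)%R).
{ unfold u'.
  pose proof (Re_le_Cmod (Cconj w * f' c)) as H1.
  rewrite Cmod_mult, Cmod_conj in H1.
  pose proof (Hle c Hc); pose proof (Cmod_ge_0 w); nra. }
assert (Hub : (0 <= u b - u a)%R) by (rewrite E; apply Rmult_le_pos; lra).
assert (Ew : (Re (Cconj w * f b) - Re (Cconj w * f a) = Cmod w * Cmod w)%R).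
{ replace (Cmod w * Cmod w)%R with ((Cmod w) ^ 2)%R by ring.
  rewrite Cmod2_alt.
  replace (Re (Cconj w * f b) - Re (Cconj w * f a))%R
    with (Re (Cconj w * w)) by (unfold w, Re; simpl; ring).
  unfold Re, Im; simpl; ring. }
unfold u in Hub.
(* Division by |w| is impossible for w = 0; then the claim is only that g does not decrease. *)
destruct (Req_dec (Cmod w) 0) as [E0|N0].
- rewrite E0 in *; pose proof (Cmod_ge_0 w).
  assert (H0 : forall t, (a <= t <= b)%R -> (0 <= g' t)%R).
  { intros t Ht; eapply Rle_trans; [apply Cmod_ge_0|apply Hle, Ht]. }
  destruct (MVT_gen g a b g') as (c2 & Hc2 & E2).
  { rewrite Rmin_left, Rmax_right by lra; intros t Ht; apply Hg; lra. }
  { rewrite Rmin_left, Rmax_right by lra; intros t Ht.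
    apply continuity_pt_filterlim, (ex_derive_continuous g).
    exists (g' t); now apply Hg. }
  rewrite Rmin_left, Rmax_right in Hc2 by lra.
  rewrite E2; apply Rmult_le_pos; [now apply H0|lra].
- pose proof (Cmod_ge_0 w).
  apply Rmult_le_reg_r with (Cmod w); lra.
Qed.

Lemma der_affine (a c : C) t : der RtoC (fun s => a + RtoC s * c) t c.
Proof.
eapply der_eq; [|apply der_plus; [apply (der_const RtoC a)|
  apply (der_mult RtoC RtoC (fun _ => c)); [apply der_id|apply der_const]]].
ring.
Qed.

Lemma mean_value_segment (f : C -> C) (f' : R -> C) (a b : C) (M : R) :
  (forall t, (0 <= t <= 1)%R -> der Cid f (a + RtoC t * (b - a)) (f' t)) ->
  (forall t, (0 <= t <= 1)%R -> (Cmod (f' t) <= M)%R) ->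
  (Cmod (f b - f a) <= M * Cmod (b - a))%R.
Proof.
intros Hf HM.
pose proof (mean_value_le (fun t => f (a + RtoC t * (b - a))) (fun t => f' t * (b - a))
  (fun t => M * Cmod (b - a) * t)%R (fun t => M * Cmod (b - a))%R 0 1) as H.
simpl in H.
replace (a + RtoC 1 * (b - a)) with b in H by ring.
replace (a + RtoC 0 * (b - a)) with a in H by ring.
replace (M * Cmod (b - a) * 1 - M * Cmod (b - a) * 0)%R with (M * Cmod (b - a))%R in H by ring.
apply H.
- lra.
- intros t Ht; apply (der_comp RtoC f); [now apply Hf|apply der_affine].
- intros t Ht; auto_derive; [easy|ring].
- intros t Ht; rewrite Cmod_mult; apply Rmult_le_compat_r; [apply Cmod_ge_0|auto].
Qed.

(** Stated for one segment because the winding number, its main application, is constant only on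
    pieces of the complement of the curve. *)
Lemma zero_derivative_segment (f : C -> C) (a b : C) :
  (forall t, (0 <= t <= 1)%R -> der Cid f (a + RtoC t * (b - a)) 0) -> f b = f a.
Proof.
intros H.
pose proof (mean_value_segment f (fun _ => 0) a b 0 H) as K.
assert (E : f b - f a = 0).
{ apply Cmod_eq_0; apply Rle_antisym; [|apply Cmod_ge_0].
  rewrite Rmult_0_l in K; apply K; intros; rewrite Cmod_0; lra. }
replace (f b) with (f b - f a + f a) by ring; rewrite E; ring.
Qed.

Lemma Cexp_0 : Cexp 0 = 1.
Proof.
unfold Cexp; simpl; rewrite exp_0, cos_0, sin_0; apply injective_projections; simpl; ring.
Qed.

Lemma Cexp_neq_0 (z : C) : Cexp z <> 0.
Proof.
intros H; pose proof (Cexp_plus z (- z)) as E; rewrite H in E.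
replace (z + - z) with (RtoC 0) in E by ring; rewrite Cexp_0 in E.
apply (f_equal Re) in E; simpl in E; lra.
Qed.

Lemma Cexp_opp (z : C) : Cexp (- z) = / Cexp z.
Proof.
pose proof (Cexp_plus z (- z)) as E.
replace (z + - z) with (RtoC 0) in E by ring; rewrite Cexp_0 in E.
pose proof (Cexp_neq_0 z).
replace (/ Cexp z) with (1 / Cexp z) by (field; auto).
rewrite E; field; auto.
Qed.

Lemma Cexp_RtoC (x : R) : Cexp x = RtoC (exp x).
Proof.
unfold Cexp; simpl; rewrite cos_0, sin_0; apply injective_projections; simpl; ring.
Qed.

Lemma Cmod_Cexp (z : C) : Cmod (Cexp z) = exp (Re z).
Proof.
unfold Cexp, Cmod; simpl.
replace (exp (Re z) * cos (Im z) * (exp (Re z) * cos (Im z) * 1) +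
   exp (Re z) * sin (Im z) * (exp (Re z) * sin (Im z) * 1))%R
  with (exp (Re z) * exp (Re z) * (Rsqr (sin (Im z)) + Rsqr (cos (Im z))))%R
  by (unfold Rsqr; ring).
rewrite sin2_cos2, Rmult_1_r; apply sqrt_square; left; apply exp_pos.
Qed.

(** Real calculus gives the derivative along rays. Complex differentiability follows later, from the
    bound on the Taylor remainder that these rays yield. *)
Lemma der_Cexp_ray (z : C) (x : R) :
  der RtoC (fun s => Cexp (RtoC s * z)) x (z * Cexp (RtoC x * z)).
Proof.
destruct z as [p q].
apply (der_ext RtoC (fun s => (exp (s * p) * cos (s * q), exp (s * p) * sin (s * q)))%R).
{ intros s; unfold Cexp; simpl.
  replace (s * p - 0 * q)%R with (s * p)%R by ring.
  replace (s * q + 0 * p)%R with (s * q)%R by ring; easy. }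
eapply der_eq; [|apply der_pair; auto_derive; try easy; reflexivity].
unfold Cexp; simpl.
replace (x * p - 0 * q)%R with (x * p)%R by ring.
replace (x * q + 0 * p)%R with (x * q)%R by ring.
apply injective_projections; simpl; ring.
Qed.

Definition exp_sum (N : nat) (w : C) : C :=
  Csum (fun k => w ^ k / INR (fact k)) N.

Definition exp_rem (N : nat) (w : C) : C := Cexp w - exp_sum N w.

Lemma INR_fact_C_neq_0 k : RtoC (INR (fact k)) <> 0.
Proof. intros H; apply RtoC_inj in H; exact (INR_fact_neq_0 k H). Qed.

Lemma der_exp_sum {X} (i : X -> C) (f : X -> C) (x : X) (l : C) N :
  der i f x l -> der i (fun y => exp_sum (S N) (f y)) x (exp_sum N (f x) * l).
Proof.
intros H; induction N as [|N IH].
- apply (der_ext i (fun _ => 1)).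
  { intros y; unfold exp_sum; simpl; field. }
  eapply der_eq; [|apply der_const]; unfold exp_sum; simpl; ring.
- apply (der_ext i (fun y => exp_sum (S N) (f y) + f y ^ S N * / INR (fact (S N)))); [easy|].
  eapply der_eq; [|apply der_plus; [exact IH|
    apply (der_mult i (fun y => f y ^ S N) (fun _ => / INR (fact (S N))));
      [apply der_pow, H|apply der_const]]].
  replace (S N - 1)%nat with N by lia.
  change (exp_sum (S N) (f x)) with (exp_sum N (f x) + f x ^ N / INR (fact N)).
  rewrite fact_simpl, mult_INR, RtoC_mult.
  assert (RtoC (INR (S N)) <> 0).
  { intros E; apply RtoC_inj in E; revert E; apply not_0_INR; lia. }
  pose proof (INR_fact_C_neq_0 N).
  field; auto.
Qed.

Lemma der_exp_rem_ray N (z : C) (x : R) :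
  der RtoC (fun s => exp_rem (S N) (RtoC s * z)) x (z * exp_rem N (RtoC x * z)).
Proof.
unfold exp_rem.
eapply der_eq; [|apply der_minus; [apply der_Cexp_ray|
  apply der_exp_sum;
  apply (der_mult RtoC RtoC (fun _ => z)); [apply der_id|apply der_const]]].
cbv beta; ring.
Qed.

Lemma exp_sum_S_0 N : exp_sum (S N) 0 = 1.
Proof.
induction N as [|N IH]; [unfold exp_sum; simpl; field|].
change (exp_sum (S (S N)) 0) with (exp_sum (S N) 0 + 0 ^ S N / INR (fact (S N))).
rewrite IH, Cpow_S; unfold Cdiv; ring.
Qed.

Lemma exp_sum_R N (x : R) :
  exp_sum (S N) x = RtoC (sum_f_R0 (fun k => / INR (fact k) * x ^ k)%R N).
Proof.
induction N as [|N IH].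
- unfold exp_sum; simpl; rewrite Rinv_1, !Rmult_1_l; field.
- change (exp_sum (S (S N)) x) with (exp_sum (S N) x + x ^ S N / INR (fact (S N))).
  rewrite IH, tech5, RtoC_plus, RtoC_mult, RtoC_inv, RtoC_pow by apply INR_fact_neq_0.
  unfold Cdiv; ring.
Qed.

(* Induction on [N] by comparing derivatives along the ray through [z]. *)
Lemma exp_rem_bound N (z : C) : (Cmod z <= 1)%R ->
  forall x : R, (0 <= x)%R ->
  (Cmod (exp_rem N (RtoC x * z)) <= Cmod z ^ N * Re (exp_rem N x))%R.
Proof.
intros Hz; induction N as [|N IH]; intros x Hx.
- unfold exp_rem, exp_sum; simpl.
  replace (Cexp (x * z) - 0) with (Cexp (x * z)) by ring.
  rewrite Cmod_Cexp, cos_0.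
  replace (1 * (exp x * 1 + - 0))%R with (exp x) by ring.
  assert (H : (Re (x * z) <= x)%R).
  { replace (Re (x * z)) with (x * Re z)%R by (destruct z; simpl; ring).
    pose proof (Re_le_Cmod z); nra. }
  destruct (Rle_lt_or_eq_dec _ _ H) as [L|E]; [left; now apply exp_increasing|right; now f_equal].
- pose proof (mean_value_le
    (fun s => exp_rem (S N) (RtoC s * z)) (fun s => z * exp_rem N (RtoC s * z))
    (fun s => Cmod z ^ S N * Re (exp_rem (S N) s))%R
    (fun s => Cmod z ^ S N * Re (exp_rem N s))%R 0 x Hx) as H.
  cbv beta in H.
  assert (E0 : forall w, exp_rem (S N) (RtoC 0 * w) = 0).
  { intros w; replace (RtoC 0 * w) with (RtoC 0) by ring.
    unfold exp_rem; rewrite Cexp_0, exp_sum_S_0; ring. }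
  rewrite E0 in H.
  assert (E1 : exp_rem (S N) (RtoC 0) = 0).
  { pose proof (E0 0) as E; now rewrite Cmult_0_r in E. }
  rewrite E1, re_RtoC in H.
  replace (exp_rem (S N) (x * z) - 0) with (exp_rem (S N) (x * z)) in H by ring.
  rewrite Rmult_0_r, Rminus_0_r in H.
  apply H.
  + intros t Ht; apply der_exp_rem_ray.
  + intros t Ht.
    apply (is_derive_scal (fun s => Re (exp_rem (S N) s))).
    apply (der_Re_Im (fun s => exp_rem (S N) (RtoC s)) t (exp_rem N t)).
    apply (der_ext RtoC (fun s => exp_rem (S N) (RtoC s * 1))); [intros; f_equal; ring|].
    eapply der_eq; [|apply der_exp_rem_ray].
    replace (RtoC t * 1) with (RtoC t) by ring; ring.
  + intros t Ht; rewrite Cmod_mult.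
    apply Rle_trans with (Cmod z * (Cmod z ^ N * Re (exp_rem N t)))%R; [|right; simpl pow; ring].
    apply Rmult_le_compat_l; [apply Cmod_ge_0|apply IH; lra].
Qed.

Lemma exp_sum_R_nonneg N (x : R) : (0 <= x)%R -> (0 <= Re (exp_sum N x))%R.
Proof.
intros Hx; destruct N as [|N]; [simpl; lra|].
rewrite exp_sum_R; simpl.
apply cond_pos_sum; intros k; apply Rmult_le_pos; [left; apply Rinv_0_lt_compat, INR_fact_lt_0|].
now apply pow_le.
Qed.

Lemma exp_rem_R_le N (x : R) : (0 <= x)%R -> (Re (exp_rem N x) <= exp x)%R.
Proof.
intros Hx; unfold exp_rem; rewrite Cexp_RtoC.
pose proof (exp_sum_R_nonneg N x Hx) as H; unfold Re in *; simpl; lra.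
Qed.

Lemma exp_rem_R_nonneg N (x : R) : (0 <= x)%R -> (0 <= Re (exp_rem N x))%R.
Proof.
intros Hx; pose proof (exp_rem_bound N 1 ltac:(rewrite Cmod_1; lra) x Hx) as H.
rewrite Cmod_1, pow1, Rmult_1_l in H; eapply Rle_trans; [apply Cmod_ge_0|exact H].
Qed.

Lemma exp_sum_R_le N (x : R) : (0 <= x)%R -> (Re (exp_sum N x) <= exp x)%R.
Proof.
intros Hx; pose proof (exp_rem_R_nonneg N x Hx) as H; unfold exp_rem in H.
rewrite Cexp_RtoC in H; unfold Re in *; simpl in *; lra.
Qed.

Lemma exp_rem_lim (x e : R) : (0 < e)%R ->
  exists N0, forall N, (N0 <= N)%nat -> (Re (exp_rem N x) < e)%R.
Proof.
intros He.
pose proof (proj2_sig (exist_exp x)) as H; unfold exp_in in H.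
destruct (H e He) as [N0 HN].
exists (S N0); intros N HN0; destruct N as [|N]; [lia|].
specialize (HN N ltac:(lia)).
unfold exp_rem; rewrite Cexp_RtoC, exp_sum_R.
unfold R_dist in HN.
change (proj1_sig (exist_exp x)) with (exp x) in HN.
unfold Re; simpl.
pose proof (Rle_abs (- (sum_f_R0 (fun i => / INR (fact i) * x ^ i) N - exp x))%R) as K.
rewrite Rabs_Ropp in K; lra.
Qed.

Lemma exp_rem_unif (M e : R) : (0 <= M)%R -> (0 < e)%R ->
  exists N0, forall N w, (N0 <= N)%nat -> (Cmod w <= M)%R ->
    (Cmod (exp_rem N w) < e)%R.
Proof.
intros HM He; destruct (exp_rem_lim (M + 1) e He) as [N0 H].
exists N0; intros N w HN Hw.
assert (HM1 : RtoC (M + 1) <> 0) by (intros E; apply RtoC_inj in E; lra).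
(* The complex remainder at w is compared with the real one at M + 1; M itself could be 0 and would
   not be a legitimate divisor. *)
replace w with (RtoC (M + 1) * (w / RtoC (M + 1))) by (field; auto).
eapply Rle_lt_trans; [|apply (H N HN)].
assert (Hq : (Cmod (w / RtoC (M + 1)) <= 1)%R).
{ rewrite Cmod_div by auto; rewrite Cmod_R, Rabs_pos_eq by lra.
  apply Rmult_le_reg_r with (M + 1)%R; [lra|].
  unfold Rdiv; rewrite Rmult_assoc, Rinv_l by lra; lra. }
eapply Rle_trans; [apply exp_rem_bound; [exact Hq|lra]|].
rewrite <- (Rmult_1_l (Re (exp_rem N (RtoC (M + 1))))) at 2.
apply Rmult_le_compat_r; [apply exp_rem_R_nonneg; lra|].
apply Rle_trans with (1 ^ N)%R; [|rewrite pow1; lra].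
apply pow_incr; split; [apply Cmod_ge_0|exact Hq].
Qed.

Lemma der_Cexp_0 : der Cid Cexp 0 1.
Proof.
intros e He.
exists (Rmin 1 (e / exp 1)); split.
{ apply Rmin_pos; [lra|apply Rdiv_lt_0_compat; [easy|apply exp_pos]]. }
intros w Hw; replace (w - 0) with w in * by ring.
assert (H1 : (Cmod w < 1)%R) by (eapply Rlt_le_trans; [exact Hw|apply Rmin_l]).
assert (H2 : (Cmod w < e / exp 1)%R) by (eapply Rlt_le_trans; [exact Hw|apply Rmin_r]).
pose proof (exp_rem_bound 2 w ltac:(lra) 1 ltac:(lra)) as H.
pose proof (exp_rem_R_le 2 1 ltac:(lra)) as H3.
replace (RtoC 1 * w) with w in H by ring.
replace (exp_rem 2 w) with (Cexp w - Cexp 0 - w * 1) in H.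
2:{ unfold exp_rem, exp_sum; simpl; rewrite Cexp_0; field. }
eapply Rle_trans; [exact H|].
pose proof (exp_pos 1) as Hp.
assert (H4 : (Cmod w * exp 1 <= e)%R).
{ apply Rle_trans with (e / exp 1 * exp 1)%R; [apply Rmult_le_compat_r; lra|right; field; lra]. }
pose proof (Cmod_ge_0 w).
apply Rle_trans with (Cmod w ^ 2 * exp 1)%R.
- apply Rmult_le_compat_l; [apply pow2_ge_0|easy].
- simpl; nra.
Qed.

(** The functional equation moves the base point to 0, where the derivative is known. *)
Lemma der_Cexp {X} (i : X -> C) (f : X -> C) (x : X) (l : C) :
  der i f x l -> der i (fun y => Cexp (f y)) x (Cexp (f x) * l).
Proof.
intros H.
apply (der_ext i (fun y => Cexp (f x) * Cexp (f y - f x))).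
{ intros y; rewrite <- Cexp_plus; f_equal; ring. }
apply der_scal.
eapply der_eq; [|apply (der_comp i Cexp (fun y => f y - f x) x l 1)].
- ring.
- replace (f x - f x) with (RtoC 0) by ring; apply der_Cexp_0.
- eapply der_eq; [|apply der_minus; [exact H|apply der_const]]; ring.
Qed.

Lemma cont_Cexp {X} (i : X -> C) (f : X -> C) (x : X) :
  cont i f x -> cont i (fun y => Cexp (f y)) x.
Proof.
intros H; apply (cont_comp i Cexp); [|easy].
eapply der_cont, (der_Cexp Cid Cid), der_id.
Qed.

(** * Contour integrals and winding numbers *)

Definition Cint (f : R -> C) (a b : R) : C :=
  RInt (V := C_R_CompleteNormedModule) f a b.

Lemma Cint_is (f : R -> C) a b :
  (a <= b)%R -> (forall t, (a <= t <= b)%R -> cont RtoC f t) ->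
  is_RInt (V := C_R_CompleteNormedModule) f a b (Cint f a b).
Proof.
intros Hab H; apply RInt_correct, ex_RInt_continuous.
rewrite Rmin_left, Rmax_right by easy.
intros t Ht; now apply continuous_of_cont, H.
Qed.

Lemma Cint_unique (f : R -> C) a b l :
  is_RInt (V := C_R_CompleteNormedModule) f a b l -> Cint f a b = l.
Proof. exact (is_RInt_unique (V := C_R_CompleteNormedModule) f a b l). Qed.

(** [C_R_NormedModule] has real scalars only, so a complex factor is handled by components. *)
Lemma is_RInt_Cmult (c : C) (f : R -> C) a b l :
  is_RInt (V := C_R_NormedModule) f a b l ->
  is_RInt (V := C_R_NormedModule) (fun t => c * f t) a b (c * l).
Proof.
intros H.
pose proof (is_RInt_fct_extend_fst f a b l H) as H1.
pose proof (is_RInt_fct_extend_snd f a b l H) as H2.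
apply (is_RInt_fct_extend_pair (fun t => c * f t) a b (fst (c * l)) (snd (c * l))).
- apply (is_RInt_minus (V := R_NormedModule) (fun t => fst c * fst (f t))%R (fun t => snd c * snd (f t))%R);
  now apply (is_RInt_scal (V := R_NormedModule)).
- apply (is_RInt_plus (V := R_NormedModule) (fun t => fst c * snd (f t))%R (fun t => snd c * fst (f t))%R);
  now apply (is_RInt_scal (V := R_NormedModule)).
Qed.

Section Integrals.
Variables (a b : R) (Hab : (a <= b)%R).

Lemma Cint_plus (f g : R -> C) :
  (forall t, (a <= t <= b)%R -> cont RtoC f t) ->
  (forall t, (a <= t <= b)%R -> cont RtoC g t) ->
  Cint (fun t => f t + g t) a b = Cint f a b + Cint g a b.
Proof.
intros Hf Hg; apply Cint_unique.
apply (is_RInt_plus (V := C_R_CompleteNormedModule)); now apply Cint_is.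
Qed.

Lemma Cint_minus (f g : R -> C) :
  (forall t, (a <= t <= b)%R -> cont RtoC f t) ->
  (forall t, (a <= t <= b)%R -> cont RtoC g t) ->
  Cint (fun t => f t - g t) a b = Cint f a b - Cint g a b.
Proof.
intros Hf Hg; apply Cint_unique.
apply (is_RInt_minus (V := C_R_CompleteNormedModule)); now apply Cint_is.
Qed.

Lemma Cint_scal (c : C) (f : R -> C) :
  (forall t, (a <= t <= b)%R -> cont RtoC f t) ->
  Cint (fun t => c * f t) a b = c * Cint f a b.
Proof. intros Hf; apply Cint_unique, is_RInt_Cmult; now apply Cint_is. Qed.

Lemma Cint_ext (f g : R -> C) :
  (forall t, (a <= t <= b)%R -> f t = g t) -> Cint f a b = Cint g a b.
Proof.
intros H; apply (RInt_ext (V := C_R_CompleteNormedModule)); rewrite Rmin_left, Rmax_right by easy.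
intros; apply H; lra.
Qed.

Lemma Cint_bound (f : R -> C) (M : R) :
  (forall t, (a <= t <= b)%R -> cont RtoC f t) ->
  (forall t, (a <= t <= b)%R -> (Cmod (f t) <= M)%R) ->
  (Cmod (Cint f a b) <= (b - a) * M)%R.
Proof.
intros Hc H; rewrite Cmod_norm.
apply (norm_RInt_le_const (V := C_R_NormedModule) f); [easy| |now apply Cint_is].
intros; rewrite <- Cmod_norm; auto.
Qed.

Lemma Cint_derive (f F : R -> C) :
  (forall t, (a <= t <= b)%R -> cont RtoC f t) ->
  (forall t, (a <= t <= b)%R -> der RtoC F t (f t)) ->
  Cint f a b = F b - F a.
Proof.
intros Hc H; apply Cint_unique.
apply (is_RInt_derive (V := C_R_CompleteNormedModule));
 rewrite Rmin_left, Rmax_right by easy; intros t Ht.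
- now apply is_derive_of_der, H.
- now apply continuous_of_cont, Hc.
Qed.

Lemma Cint_der (f : R -> C) :
  (forall t, cont RtoC f t) -> der RtoC (fun x => Cint f a x) b (f b).
Proof.
intros Hc; apply der_of_is_derive.
apply (is_derive_RInt (V := C_R_CompleteNormedModule) f _ a b);
  [|now apply continuous_of_cont].
exists (mkposreal 1 ltac:(lra)); intros x _.
apply RInt_correct, ex_RInt_continuous; intros; now apply continuous_of_cont.
Qed.

End Integrals.

Lemma Cmod_dist (z w : C) : (Rabs (Cmod z - Cmod w) <= Cmod (z - w))%R.
Proof.
apply Rabs_le; split; [|apply Cmod_le_sub].
pose proof (Cmod_le_sub w z); rewrite Cmod_sym in H; lra.
Qed.

Lemma cont_lipschitz_pt (f : R -> C) (p : C -> R) t :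
  (forall z w, (Rabs (p z - p w) <= Cmod (z - w))%R) ->
  cont RtoC f t -> continuity_pt (fun s => p (f s)) t.
Proof.
intros Hp H; apply continuity_pt_filterlim, filterlim_locally; intros e.
destruct (H e (cond_pos e)) as (d & Hd & K).
exists (mkposreal d Hd); intros s Hs.
eapply Rle_lt_trans; [apply Hp|apply K].
rewrite Cmod_RtoC_sub; exact Hs.
Qed.

Lemma cont_Cmod (f : R -> C) t :
  cont RtoC f t -> continuity_pt (fun s => Cmod (f s)) t.
Proof. apply cont_lipschitz_pt, Cmod_dist. Qed.

Lemma cont_Re (f : R -> C) t : cont RtoC f t -> continuity_pt (fun s => Re (f s)) t.
Proof. apply cont_lipschitz_pt; intros z w; apply (re_le_Cmod (z - w)). Qed.

Lemma cont_Im (f : R -> C) t : cont RtoC f t -> continuity_pt (fun s => Im (f s)) t.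
Proof. apply cont_lipschitz_pt; intros z w; apply (im_le_Cmod (z - w)). Qed.

Lemma positive_min (u : R -> R) (a b : R) :
  (a <= b)%R -> (forall t, (a <= t <= b)%R -> continuity_pt u t) ->
  (forall t, (a <= t <= b)%R -> (0 < u t)%R) ->
  exists m, (0 < m)%R /\ forall t, (a <= t <= b)%R -> (m <= u t)%R.
Proof.
intros Hab Hc Hp.
destruct (continuity_ab_min u a b Hab Hc) as (t0 & H1 & H2).
exists (u t0); split; [now apply Hp|easy].
Qed.

Lemma bounded_above (u : R -> R) (a b : R) :
  (a <= b)%R -> (forall t, (a <= t <= b)%R -> continuity_pt u t) ->
  exists M, forall t, (a <= t <= b)%R -> (u t <= M)%R.
Proof.
intros Hab Hc.
destruct (continuity_ab_maj u a b Hab Hc) as (t0 & H1 & H2).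
now exists (u t0).
Qed.

Definition closed_curve (gam : R -> C) : Prop :=
  (forall t, der RtoC gam t (velocity gam t)) /\
  (forall t, cont RtoC (velocity gam) t) /\
  (forall t, gam (t + 1)%R = gam t).

Lemma closed_curve_of_jordan gam : smooth_jordan gam -> closed_curve gam.
Proof.
intros (Hp & Hd & Hc & _); split; [|split; [|exact Hp]].
- intros t; destruct (Hd t) as [l Hl]; apply der_of_is_derive in Hl.
  destruct (der_Re_Im _ _ _ Hl) as [H1 H2].
  replace (velocity gam t) with l; [easy|].
  symmetry; apply injective_projections; [exact (is_derive_unique _ _ _ H1)|exact (is_derive_unique _ _ _ H2)].
- intros t; now apply cont_of_continuous.
Qed.

Section Curve.
Variable (gam : R -> C).
Hypothesis Hgam : closed_curve gam.

Lemma curve_der t : der RtoC gam t (velocity gam t).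
Proof. apply Hgam. Qed.

Lemma curve_cont t : cont RtoC gam t.
Proof. eapply der_cont, curve_der. Qed.

(** Periodicity brings every parameter into a compact interval, on which continuous functions attain
    their extrema. *)
Lemma on_curve_unit z : on_curve gam z -> exists t, (0 <= t <= 1)%R /\ gam t = z.
Proof.
intros [t <-]; destruct (archimed t) as [H1 H2].
assert (Hp : forall n t, gam (t + INR n)%R = gam t).
{ intros n; induction n as [|n IH]; intros s; [simpl; now rewrite Rplus_0_r|].
  rewrite S_INR, <- Rplus_assoc, (proj2 (proj2 Hgam)); apply IH. }
assert (Hz : forall k t, gam (t + IZR k)%R = gam t).
{ intros k s; destruct k as [|p|p].
  - now rewrite Rplus_0_r.
  - unfold IZR; rewrite <- INR_IPR; apply Hp.
  - rewrite <- (Hp (Pos.to_nat p)); f_equal; unfold IZR; rewrite INR_IPR; ring. }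
exists (t + IZR (1 - up t))%R; split; [|apply Hz].
rewrite minus_IZR; lra.
Qed.

Lemma CI_is (f : C -> C) :
  contour_integral gam f = Cint (fun t => f (gam t) * velocity gam t) 0 1.
Proof. reflexivity. Qed.

Lemma integrand_cont (f : C -> C) t :
  cont RtoC (fun t => f (gam t)) t ->
  cont RtoC (fun t => f (gam t) * velocity gam t) t.
Proof. intros H; apply cont_mult; [easy|apply Hgam]. Qed.

Lemma CI_plus (f g : C -> C) :
  (forall t, cont RtoC (fun t => f (gam t)) t) ->
  (forall t, cont RtoC (fun t => g (gam t)) t) ->
  contour_integral gam (fun s => f s + g s) = contour_integral gam f + contour_integral gam g.
Proof.
intros Hf Hg; rewrite !CI_is, <- Cint_plus; try lra; try (intros; now apply integrand_cont).
apply Cint_ext; [lra|]; intros; ring.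
Qed.

Lemma CI_minus (f g : C -> C) :
  (forall t, cont RtoC (fun t => f (gam t)) t) ->
  (forall t, cont RtoC (fun t => g (gam t)) t) ->
  contour_integral gam (fun s => f s - g s) = contour_integral gam f - contour_integral gam g.
Proof.
intros Hf Hg; rewrite !CI_is, <- Cint_minus; try lra; try (intros; now apply integrand_cont).
apply Cint_ext; [lra|]; intros; ring.
Qed.

Lemma CI_scal (c : C) (f : C -> C) :
  (forall t, cont RtoC (fun t => f (gam t)) t) ->
  contour_integral gam (fun s => c * f s) = c * contour_integral gam f.
Proof.
intros Hf; rewrite !CI_is, <- Cint_scal; try lra; try (intros; now apply integrand_cont).
apply Cint_ext; [lra|]; intros; ring.
Qed.

Lemma CI_ext (f g : C -> C) :
  (forall t, f (gam t) = g (gam t)) ->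
  contour_integral gam f = contour_integral gam g.
Proof. intros H; rewrite !CI_is; apply Cint_ext; [lra|]; intros; now rewrite H. Qed.

Lemma CI_Csum (f : nat -> C -> C) N :
  (forall k t, cont RtoC (fun t => f k (gam t)) t) ->
  contour_integral gam (fun s => Csum (fun k => f k s) N)
  = Csum (fun k => contour_integral gam (f k)) N.
Proof.
intros H; induction N as [|N IH]; simpl.
- pose proof (CI_scal 0 (fun _ => 0) (fun t => cont_const RtoC 0 t)) as E.
  rewrite Cmult_0_l in E; etransitivity; [|exact E]; apply CI_ext; intros; ring.
- rewrite CI_plus, IH; [easy| |apply H].
  intros t; apply (cont_Csum RtoC (fun k t => f k (gam t))); intros; apply H.
Qed.

(** The substitute for Cauchy's theorem: every integrand that must integrate to 0 below has an
    explicit primitive. *)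
Lemma CI_primitive (f F : C -> C) :
  (forall t, cont RtoC (fun t => f (gam t)) t) ->
  (forall t, der Cid F (gam t) (f (gam t))) ->
  contour_integral gam f = 0.
Proof.
intros Hc HF; rewrite CI_is, (Cint_derive 0 1 ltac:(lra) _ (fun t => F (gam t))).
- replace 1%R with (0 + 1)%R by ring; rewrite (proj2 (proj2 Hgam)); ring.
- intros; now apply integrand_cont.
- intros; apply (der_comp RtoC F gam); [apply HF|apply curve_der].
Qed.

Lemma speed_bound : exists L, (0 < L)%R /\ forall t, (0 <= t <= 1)%R -> (Cmod (velocity gam t) <= L)%R.
Proof.
destruct (bounded_above (fun t => Cmod (velocity gam t)) 0 1 ltac:(lra)) as [M HM].
{ intros; apply cont_Cmod, Hgam. }
exists (Rabs M + 1)%R; split; [pose proof (Rabs_pos M); lra|].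
intros t Ht; specialize (HM t Ht); pose proof (Rle_abs M); lra.
Qed.

Lemma CI_bound (f : C -> C) (M L : R) :
  (forall t, (0 <= t <= 1)%R -> (Cmod (velocity gam t) <= L)%R) ->
  (forall t, cont RtoC (fun t => f (gam t)) t) ->
  (forall t, (0 <= t <= 1)%R -> (Cmod (f (gam t)) <= M)%R) ->
  (Cmod (contour_integral gam f) <= M * L)%R.
Proof.
intros HL Hc HM; rewrite CI_is.
eapply Rle_trans; [apply (Cint_bound 0 1 ltac:(lra) _ (M * L))|right; ring].
- intros; now apply integrand_cont.
- intros t Ht; rewrite Cmod_mult; apply Rmult_le_compat; try apply Cmod_ge_0; auto.
Qed.

Lemma curve_distance z : ~ on_curve gam z ->
  exists d, (0 < d)%R /\ forall t, (d <= Cmod (gam t - z))%R.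
Proof.
intros Hz.
destruct (positive_min (fun t => Cmod (gam t - z)) 0 1 ltac:(lra)) as (m & Hm & H).
- intros; apply cont_Cmod, cont_minus; [apply curve_cont|apply cont_const].
- intros t _; apply Cmod_gt_0; intros E; apply Hz; exists t.
  replace (gam t) with (gam t - z + z) by ring; rewrite E; ring.
- exists m; split; [easy|]; intros t.
  destruct (on_curve_unit (gam t)) as (s & Hs & <-); [now exists t|auto].
Qed.

Lemma curve_minus_neq z t : ~ on_curve gam z -> gam t - z <> 0.
Proof.
intros Hz E; apply Hz; exists t.
replace (gam t) with (gam t - z + z) by ring; rewrite E; ring.
Qed.

Lemma cauchy_kernel_cont z t : ~ on_curve gam z -> cont RtoC (fun t => / (gam t - z)) t.
Proof.
intros Hz; apply cont_inv; [now apply curve_minus_neq|].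
apply cont_minus; [apply curve_cont|apply cont_const].
Qed.

Lemma CI_double_pole z : ~ on_curve gam z ->
  contour_integral gam (fun s => / (s - z) * / (s - z)) = 0.
Proof.
intros Hz; apply (CI_primitive _ (fun s => - / (s - z))).
- intros; apply cont_mult; now apply cauchy_kernel_cont.
- intros t; pose proof (curve_minus_neq z t Hz).
  eapply der_eq; [|apply der_opp, der_inv; [easy|apply der_minus; [apply der_id|apply der_const]]].
  cbv beta; field; auto.
Qed.

(** By 1/(s - w) - 1/(s - z) = (w - z)/(s - z)^2 + (w - z)^2/((s - w)(s - z)^2), the first order
    term is a double pole, which integrates to 0, and the rest is quadratic in w - z. *)
Lemma winding_zero_derivative z : ~ on_curve gam z -> der Cid (winding_number gam) z 0.
Proof.
intros Hz; unfold winding_number.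
rewrite <- (Cmult_0_r (/ (2 * PI * Ci))); apply der_scal.
destruct (curve_distance z Hz) as (d & Hd & HD).
destruct speed_bound as (L & HL & HV).
intros e He.
set (K := (2 / (d * d * d) * L)%R).
assert (HK : (0 < K)%R).
{ unfold K; apply Rmult_lt_0_compat; [|easy]; apply Rdiv_lt_0_compat; [lra|].
  repeat apply Rmult_lt_0_compat; easy. }
exists (Rmin (d / 2) (e / K)); split.
{ apply Rmin_pos; [lra|now apply Rdiv_lt_0_compat]. }
intros w Hw.
assert (H1 : (Cmod (w - z) < d / 2)%R) by (eapply Rlt_le_trans; [exact Hw|apply Rmin_l]).
assert (H2 : (Cmod (w - z) < e / K)%R) by (eapply Rlt_le_trans; [exact Hw|apply Rmin_r]).
assert (HDw : forall t, (d / 2 <= Cmod (gam t - w))%R).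
{ intros t; specialize (HD t).
  pose proof (Cmod_triangle (gam t - w) (w - z)) as T.
  replace (gam t - w + (w - z)) with (gam t - z) in T by ring; lra. }
assert (Hw' : ~ on_curve gam w).
{ intros [t E]; specialize (HDw t); rewrite E in HDw.
  replace (w - w) with (RtoC 0) in HDw by ring; rewrite Cmod_0 in HDw; lra. }
assert (Cw : forall t, cont RtoC (fun t => / (gam t - w)) t) by (intros; now apply cauchy_kernel_cont).
assert (Cz : forall t, cont RtoC (fun t => / (gam t - z)) t) by (intros; now apply cauchy_kernel_cont).
rewrite <- CI_minus by easy.
rewrite Cmult_0_r.
assert (E : contour_integral gam (fun s => / (s - w) - / (s - z))
  = (w - z) * ((w - z) * contour_integral gam (fun s => / (s - w) * (/ (s - z) * / (s - z))))).
{ rewrite <- 2 CI_scal.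
  (* The vanishing integral of the double pole is inserted as a summand, so that the claim becomes
     an identity of integrands. *)
  - rewrite <- (Cplus_0_r (contour_integral gam (fun s => (w - z) * _))).
    rewrite <- (Cmult_0_r (w - z)), <- (CI_double_pole z Hz), <- CI_scal, <- CI_plus.
    + apply CI_ext; intros t.
      pose proof (curve_minus_neq z t Hz); pose proof (curve_minus_neq w t Hw').
      field; auto.
    + intros; apply cont_mult; [apply cont_const|].
      apply cont_mult; [apply cont_const|].
      apply cont_mult; [apply Cw|apply cont_mult; apply Cz].
    + intros; apply cont_mult; [apply cont_const|]; apply cont_mult; apply Cz.
    + intros; apply cont_mult; apply Cz.
  - intros; apply cont_mult; [apply cont_const|].
      apply cont_mult; [apply Cw|apply cont_mult; apply Cz].
  - intros; apply cont_mult; [apply Cw|apply cont_mult; apply Cz]. }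
rewrite E.
replace ((w - z) * ((w - z) * contour_integral gam (fun s => / (s - w) * (/ (s - z) * / (s - z)))) - 0)
  with ((w - z) * ((w - z) * contour_integral gam (fun s => / (s - w) * (/ (s - z) * / (s - z))))) by ring.
rewrite 2 Cmod_mult, (Rmult_comm e).
apply Rmult_le_compat_l; [apply Cmod_ge_0|].
apply Rle_trans with (e / K * K)%R; [|right; field; lra].
apply Rmult_le_compat; [apply Cmod_ge_0|apply Cmod_ge_0|lra|].
apply CI_bound; [exact HV| |].
- intros; apply cont_mult; [apply Cw|apply cont_mult; apply Cz].
- intros t _.
  pose proof (curve_minus_neq z t Hz); pose proof (curve_minus_neq w t Hw').
  rewrite !Cmod_mult, !Cmod_inv by easy.
  replace (2 / (d * d * d))%R with (/ (d / 2) * (/ d * / d))%R by (field; lra).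
  specialize (HD t); specialize (HDw t).
  apply Rmult_le_compat.
  + left; apply Rinv_0_lt_compat; lra.
  + apply Rmult_le_pos; left; apply Rinv_0_lt_compat; lra.
  + apply Rinv_le_contravar; lra.
  + apply Rmult_le_compat; try (left; apply Rinv_0_lt_compat; lra); apply Rinv_le_contravar; lra.
Qed.

Lemma winding_segment a b :
  (forall t, (0 <= t <= 1)%R -> ~ on_curve gam (a + RtoC t * (b - a))) ->
  winding_number gam b = winding_number gam a.
Proof. intros H; apply zero_derivative_segment; intros; now apply winding_zero_derivative, H. Qed.

End Curve.

(** * Exact evaluation of the contour integral *)

Definition F_out (n : nat) (z : C) : C :=
  - (Cexp (- INR n) * exp_sum n (INR n * z) / z ^ n).

Lemma two_pi_i_neq_0 : 2 * PI * Ci <> 0.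
Proof.
intros E; apply (f_equal Im) in E; simpl in E.
pose proof PI_RGT_0; lra.
Qed.

Lemma INR_C_neq_0 n : (1 <= n)%nat -> RtoC (INR n) <> 0.
Proof. intros H E; apply RtoC_inj in E; revert E; apply not_0_INR; lia. Qed.

Lemma Csum_ext (f g : nat -> C) N :
  (forall k, (k < N)%nat -> f k = g k) -> Csum f N = Csum g N.
Proof.
induction N as [|N IH]; intros H; simpl; [easy|].
rewrite IH by (intros; apply H; lia); now rewrite H by lia.
Qed.

Lemma Csum_scal (c : C) (f : nat -> C) N : Csum (fun k => c * f k) N = c * Csum f N.
Proof. induction N as [|N IH]; simpl; [ring|rewrite IH; ring]. Qed.

Lemma Csum_minus (f g : nat -> C) N : Csum (fun k => f k - g k) N = Csum f N - Csum g N.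
Proof. induction N as [|N IH]; simpl; [ring|rewrite IH; ring]. Qed.

(** Meant for the exponential series: its monomials with k < n are those that leave a pole at 0
    after division by s^n. *)
Lemma Csum_below (f : nat -> C) n m :
  Csum (fun k => if (k <? n)%nat then f k else 0) (n + m) = Csum f n.
Proof.
induction m as [|m IH].
- rewrite Nat.add_0_r; apply Csum_ext; intros k Hk.
  now rewrite (proj2 (Nat.ltb_lt k n) Hk).
- rewrite Nat.add_succ_r; simpl; rewrite IH.
  replace (n + m <? n)%nat with false by (symmetry; apply Nat.ltb_ge; lia); ring.
Qed.

Section Residues.
Variable (gam : R -> C).
Hypothesis Hgam : closed_curve gam.
Hypothesis H0 : ~ on_curve gam 0.
Hypothesis Hw0 : winding_number gam 0 = 1.
Variable (z : C).
Hypothesis Hz : ~ on_curve gam z.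
Hypothesis Hz0 : z <> 0.

Let w := winding_number gam z.

Lemma curve_neq_0 t : gam t <> 0.
Proof. intros E; apply H0; now exists t. Qed.

Lemma curve_pow_cont k t : cont RtoC (fun t => gam t ^ k) t.
Proof. apply cont_pow, curve_cont, Hgam. Qed.

Lemma curve_inv_pow_cont k t : cont RtoC (fun t => / gam t ^ k) t.
Proof. apply cont_inv; [apply Cpow_nz, curve_neq_0|apply curve_pow_cont]. Qed.

Lemma kernel_cont t : cont RtoC (fun t => / (gam t - z)) t.
Proof. now apply cauchy_kernel_cont. Qed.

Lemma CI_pow k : contour_integral gam (fun s => s ^ k) = 0.
Proof.
apply (CI_primitive gam Hgam _ (fun s => / INR (S k) * s ^ S k)).
- intros; apply curve_pow_cont.
- intros t; eapply der_eq; [|apply der_scal, der_pow, der_id].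
  replace (S k - 1)%nat with k by lia; cbv beta.
  pose proof (INR_C_neq_0 (S k) ltac:(lia)); field; auto.
Qed.

Lemma CI_inv_pow k : contour_integral gam (fun s => / s ^ (S (S k))) = 0.
Proof.
apply (CI_primitive gam Hgam _ (fun s => - / INR (S k) * / s ^ S k)).
- intros; apply curve_inv_pow_cont.
- intros t; pose proof (curve_neq_0 t) as Ht; pose proof (Cpow_nz _ k Ht).
  eapply der_eq; [|apply der_scal, der_inv; [now apply Cpow_nz|apply der_pow, der_id]].
  replace (S k - 1)%nat with k by lia; cbv beta.
  pose proof (INR_C_neq_0 (S k) ltac:(lia)).
  rewrite !Cpow_S; field; auto.
Qed.

(** In the residue computation the winding number about 0 enters here. The exponent 1 is kept to
    match the base case of [CI_inv_pow_kernel]. *)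
Lemma CI_inv : contour_integral gam (fun s => / s ^ 1) = 2 * PI * Ci.
Proof.
pose proof two_pi_i_neq_0 as Hp.
transitivity (2 * PI * Ci * winding_number gam 0); [|rewrite Hw0; ring].
unfold winding_number; rewrite Cmult_assoc, Cinv_r, Cmult_1_l by easy.
apply CI_ext; intros t; f_equal; simpl; ring.
Qed.

Lemma CI_kernel : contour_integral gam (fun s => / (s - z)) = 2 * PI * Ci * w.
Proof.
unfold w, winding_number; rewrite Cmult_assoc, Cinv_r, Cmult_1_l by apply two_pi_i_neq_0; easy.
Qed.

(** Induction by s^(k+1)/(s - z) = s^k + z s^k/(s - z). *)
Lemma CI_pow_kernel k :
  contour_integral gam (fun s => s ^ k * / (s - z)) = 2 * PI * Ci * (z ^ k * w).
Proof.
induction k as [|k IH].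
- transitivity (contour_integral gam (fun s => / (s - z))).
  + apply CI_ext; intros; simpl; ring.
  + rewrite CI_kernel; simpl; ring.
- transitivity (contour_integral gam (fun s => s ^ k + z * (s ^ k * / (s - z)))).
  + apply CI_ext; intros t; pose proof (curve_minus_neq gam z t Hz).
    rewrite Cpow_S; field; auto.
  + rewrite CI_plus, CI_scal, CI_pow, IH, Cpow_S; [ring|easy| |easy|apply curve_pow_cont|].
    * intros; apply cont_mult; [apply curve_pow_cont|apply kernel_cont].
    * intros; apply cont_mult; [apply cont_const|].
      apply cont_mult; [apply curve_pow_cont|apply kernel_cont].
Qed.

(** Partial fractions: 1/(s^(m+1) (s - z)) = (1/z) (1/(s^m (s - z)) - 1/s^(m+1)). The subtracted
    pole has nonzero integral only for m = 0, which produces the -1. *)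
Lemma CI_inv_pow_kernel m :
  contour_integral gam (fun s => / s ^ (S m) * / (s - z))
  = 2 * PI * Ci * (/ z ^ (S m) * (w - 1)).
Proof.
assert (Hstep : forall m, contour_integral gam (fun s => / s ^ S m * / (s - z))
  = / z * (contour_integral gam (fun s => / s ^ m * / (s - z))
           - contour_integral gam (fun s => / s ^ S m))).
{ intros k; rewrite <- CI_minus, <- CI_scal; try easy.
  - apply CI_ext; intros t; pose proof (curve_minus_neq gam z t Hz).
    pose proof (curve_neq_0 t); pose proof (Cpow_nz (gam t) k ltac:(easy)).
    rewrite Cpow_S; field; auto.
  - intros; apply cont_minus; [|apply curve_inv_pow_cont].
    apply cont_mult; [apply curve_inv_pow_cont|apply kernel_cont].
  - intros; apply cont_mult; [apply curve_inv_pow_cont|apply kernel_cont].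
  - intros; apply curve_inv_pow_cont. }
induction m as [|m IH]; rewrite Hstep.
- rewrite CI_inv.
  replace (contour_integral gam (fun s => / s ^ 0 * / (s - z)))
    with (contour_integral gam (fun s => / (s - z))).
  + rewrite CI_kernel; simpl; field; auto.
  + apply CI_ext; intros t; pose proof (curve_minus_neq gam z t Hz); simpl; field; auto.
- rewrite IH, CI_inv_pow, (Cpow_S z (S m)).
  pose proof (Cpow_nz z (S m) Hz0); field; auto.
Qed.

(** The residue at z has weight w; the residue at 0 is present exactly when k < n and cancels one
    copy of it. *)
Lemma CI_monomial_kernel n k :
  contour_integral gam (fun s => s ^ k * / s ^ n * / (s - z))
  = 2 * PI * Ci * (z ^ k * / z ^ n * (w - if (k <? n)%nat then 1 else 0)).
Proof.
destruct (k <? n)%nat eqn:E.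
- apply Nat.ltb_lt in E.
  replace n with (k + S (n - k - 1))%nat by lia; set (m := (n - k - 1)%nat).
  transitivity (contour_integral gam (fun s => / s ^ (S m) * / (s - z))).
  + apply CI_ext; intros t; pose proof (curve_minus_neq gam z t Hz).
    pose proof (Cpow_nz (gam t) k (curve_neq_0 t)); pose proof (Cpow_nz (gam t) (S m) (curve_neq_0 t)).
    rewrite Cpow_add_r; field; auto.
  + rewrite CI_inv_pow_kernel, Cpow_add_r.
    pose proof (Cpow_nz z k Hz0); pose proof (Cpow_nz z (S m) Hz0); field; auto.
- apply Nat.ltb_ge in E.
  replace k with (n + (k - n))%nat by lia; set (m := (k - n)%nat).
  transitivity (contour_integral gam (fun s => s ^ m * / (s - z))).
  + apply CI_ext; intros t; pose proof (curve_minus_neq gam z t Hz).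
    pose proof (Cpow_nz (gam t) n (curve_neq_0 t)).
    rewrite Cpow_add_r; field; auto.
  + rewrite CI_pow_kernel, Cpow_add_r.
    pose proof (Cpow_nz z n Hz0); field; auto.
Qed.

(* The exponential series is integrated term by term against s^(-n) / (s - z). *)
Lemma F_residues n :
  F gam n z = w * Cexp (INR n * phi z) + F_out n z.
Proof.
set (c := 2 * PI * Ci); assert (Hc : c <> 0) by apply two_pi_i_neq_0.
set (a := RtoC (INR n)).
assert (Ek : forall s : C, s <> 0 ->
   Cexp (a * phi s) = Cexp (- a) * (Cexp (a * s) * / s ^ n)).
{ intros s Hs; unfold a; rewrite Cexp_phi by easy.
  replace (INR n * (s - 1)) with (- INR n + INR n * s) by ring.
  rewrite Cexp_plus; unfold Cdiv; ring. }
(* [G] carries the truncated exponential series and is integrated exactly; [Q] carries its tail,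
   which is uniformly small on the curve. *)
set (G := fun N s => exp_sum N (a * s) * / s ^ n * / (s - z)).
set (Q := fun N s => exp_rem N (a * s) * / s ^ n * / (s - z)).
assert (Cns : forall t, cont RtoC (fun t => a * gam t) t).
{ intros; apply cont_mult; [apply cont_const|now apply curve_cont]. }
assert (CGk : forall k t, cont RtoC (fun t => gam t ^ k * / gam t ^ n * / (gam t - z)) t).
{ intros; apply cont_mult; [|apply kernel_cont].
  apply cont_mult; [apply curve_pow_cont|apply curve_inv_pow_cont]. }
assert (CG : forall N t, cont RtoC (fun t => G N (gam t)) t).
{ intros; apply cont_mult; [|apply kernel_cont]; apply cont_mult; [|apply curve_inv_pow_cont].
  unfold exp_sum.
  apply (cont_Csum RtoC (fun k t => (a * gam t) ^ k / INR (fact k))); intros.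
  apply cont_mult; [now apply cont_pow|apply cont_const]. }
assert (CQ : forall N t, cont RtoC (fun t => Q N (gam t)) t).
{ intros; apply cont_mult; [|apply kernel_cont]; apply cont_mult; [|apply curve_inv_pow_cont].
  apply cont_minus; [now apply cont_Cexp|].
  apply (cont_Csum RtoC (fun k t => (a * gam t) ^ k / INR (fact k))); intros.
  apply cont_mult; [now apply cont_pow|apply cont_const]. }
assert (IG : forall m, contour_integral gam (G (n + m)%nat)
  = c * (/ z ^ n * (w * exp_sum (n + m) (a * z) - exp_sum n (a * z)))).
{ intros m.
  transitivity (contour_integral gam (fun s => Csum (fun k =>
     a ^ k / INR (fact k) * (s ^ k * / s ^ n * / (s - z))) (n + m))).
  { apply CI_ext; intros t; unfold G.
    transitivity (/ gam t ^ n * / (gam t - z) * exp_sum (n + m) (a * gam t)); [ring|].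
    unfold exp_sum; rewrite <- Csum_scal; apply Csum_ext; intros k _.
    rewrite Cpow_mult_l; unfold Cdiv; ring. }
  rewrite (CI_Csum gam Hgam (fun k s => a ^ k / INR (fact k) * (s ^ k * / s ^ n * / (s - z)))).
  2:{ intros; apply cont_mult; [apply cont_const|apply CGk]. }
  rewrite <- (Csum_below (fun k => (a * z) ^ k / INR (fact k)) n m : _ = exp_sum n (a * z)).
  unfold exp_sum; rewrite <- Csum_scal, <- Csum_minus, <- !Csum_scal.
  apply Csum_ext; intros k _.
  rewrite (CI_scal gam Hgam (a ^ k / INR (fact k)) (fun s => s ^ k * / s ^ n * / (s - z)))
    by apply CGk.
  rewrite CI_monomial_kernel; fold c; rewrite Cpow_mult_l.
  destruct (k <? n)%nat; unfold Cdiv; ring. }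
assert (EF : forall m, F gam n z = / c * (Cexp (- a) *
   (contour_integral gam (G (n + m)%nat) + contour_integral gam (Q (n + m)%nat)))).
{ intros m; unfold F; fold c; f_equal.
  rewrite <- CI_plus, <- CI_scal; try easy.
  - apply CI_ext; intros t; fold a; rewrite (Ek (gam t)) by apply curve_neq_0.
    unfold G, Q, exp_rem, Cdiv; ring.
  - intros; now apply cont_plus. }
destruct (curve_distance gam Hgam z Hz) as (d & Hd & HD).
destruct (curve_distance gam Hgam 0 H0) as (d0 & Hd0 & HD0).
destruct (speed_bound gam Hgam) as (L & HL & HV).
destruct (bounded_above (fun t => Cmod (gam t)) 0 1 ltac:(lra)) as [Mg HMg].
{ intros; now apply cont_Cmod, curve_cont. }
(* The difference D of the two sides does not depend on the truncation. If it were nonzero, a tail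
   smaller than e = |D| / (K + 1) would give |D| <= e K < |D|. *)
apply Ceq_minus, Cmod_eq_0, Rle_antisym; [|apply Cmod_ge_0].
apply Rnot_lt_le; intros Hpos.
set (D := (F gam n z - (w * Cexp (a * phi z) + F_out n z))) in *.
set (K := (Cmod (/ c * Cexp (- a)) * (/ d0 ^ n * / d * L + Cmod (c * / z ^ n * w)))%R).
assert (HK : (0 <= K)%R).
{ unfold K; apply Rmult_le_pos; [apply Cmod_ge_0|]; apply Rplus_le_le_0_compat; [|apply Cmod_ge_0].
  repeat apply Rmult_le_pos; try (left; apply Rinv_0_lt_compat); try lra; now apply pow_lt. }
set (e := (Cmod D / (K + 1))%R).
assert (He : (0 < e)%R) by (apply Rdiv_lt_0_compat; lra).
(* One bound for n s that covers the points s of the curve and s = z at once. *)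
set (Mx := (INR n * (Rabs Mg + Cmod z))%R).
assert (HMx : (0 <= Mx)%R).
{ apply Rmult_le_pos; [apply pos_INR|]; pose proof (Rabs_pos Mg); pose proof (Cmod_ge_0 z); lra. }
destruct (exp_rem_unif Mx e HMx He) as [N0 HN].
assert (Ha : forall s, (Cmod s <= Rabs Mg + Cmod z)%R -> (Cmod (exp_rem (n + N0) (a * s)) < e)%R).
{ intros s Hs; apply HN; [lia|]; unfold a; rewrite Cmod_mult, Cmod_R, Rabs_pos_eq by apply pos_INR.
  apply Rmult_le_compat_l; [apply pos_INR|easy]. }
assert (HQ : (Cmod (contour_integral gam (Q (n + N0)%nat)) <= e * (/ d0 ^ n * / d) * L)%R).
{ apply (CI_bound gam Hgam); [easy|apply CQ|].
  intros t Ht; unfold Q.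
  pose proof (curve_minus_neq gam z t Hz); pose proof (Cpow_nz (gam t) n (curve_neq_0 t)).
  rewrite !Cmod_mult, !Cmod_inv, Cmod_pow, Rmult_assoc by easy.
  specialize (HD t); specialize (HD0 t); replace (gam t - 0) with (gam t) in HD0 by ring.
  assert (Hpw : (0 < d0 ^ n)%R) by now apply pow_lt.
  assert (Hpw2 : (d0 ^ n <= Cmod (gam t) ^ n)%R) by (apply pow_incr; lra).
  apply Rmult_le_compat.
  - apply Cmod_ge_0.
  - apply Rmult_le_pos; left; apply Rinv_0_lt_compat; lra.
  - left; apply Ha; specialize (HMg t Ht); pose proof (Rle_abs Mg); pose proof (Cmod_ge_0 z); lra.
  - apply Rmult_le_compat; try (left; apply Rinv_0_lt_compat; lra); apply Rinv_le_contravar; lra. }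
assert (ED : D = / c * Cexp (- a) * (contour_integral gam (Q (n + N0)%nat)
                 - c * / z ^ n * w * exp_rem (n + N0) (a * z))).
{ unfold D; rewrite (EF N0), IG; fold a; rewrite (Ek z Hz0).
  unfold F_out, exp_rem; fold a.
  pose proof (Cpow_nz z n Hz0); field; auto. }
assert (HB : (Cmod D <= e * K)%R).
{ rewrite ED, Cmod_mult; unfold K.
  apply Rle_trans with (Cmod (/ c * Cexp (- a)) * (e * (/ d0 ^ n * / d) * L + Cmod (c * / z ^ n * w) * e))%R;
    [|right; ring].
  apply Rmult_le_compat_l; [apply Cmod_ge_0|].
  unfold Cminus; eapply Rle_trans; [apply Cmod_triangle|]; rewrite Cmod_opp.
  apply Rplus_le_compat; [easy|].
  rewrite (Cmod_mult (_ * w)); apply Rmult_le_compat_l; [apply Cmod_ge_0|].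
  left; apply Ha; pose proof (Rabs_pos Mg); lra. }
assert (e * (K + 1) = Cmod D)%R by (unfold e; field; lra).
lra.
Qed.

End Residues.

(** Stirling's formula is the statement that this is asymptotic to 1 / sqrt(2 pi n). *)
Definition stirling_ratio (n : nat) : R := (exp (- INR n) * INR n ^ n / INR (fact n))%R.

(* This is z (d/dz) F = n (z - 1) F + n C, the equation an integration by parts gives for F. *)
Lemma der_F_out n (z : C) : (1 <= n)%nat -> z <> 0 ->
  der Cid (F_out n) z
    ((INR n * (z - 1) * F_out n z + INR n * stirling_ratio n) / z).
Proof.
intros Hn Hz; destruct n as [|m]; [lia|]; set (n := S m).
assert (Hzn : z ^ n <> 0) by now apply Cpow_nz.
assert (Hzm : z ^ m <> 0) by now apply Cpow_nz.
eapply der_eq; [|apply der_opp, der_div; [exact Hzn|apply der_scal|apply der_pow, der_id]].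
2:{ apply (der_exp_sum Cid (fun y => INR n * y)); apply der_scal, der_id. }
cbv beta.
replace (n - 1)%nat with m by (unfold n; lia).
unfold F_out, stirling_ratio.
replace (exp_sum n (INR n * z)) with (exp_sum m (INR n * z) + (INR n * z) ^ m / INR (fact m))
  by reflexivity.
assert (Ef : RtoC (exp (- INR n) * INR n ^ n / INR (fact n))%R
  = Cexp (- INR n) * INR n ^ m / INR (fact m)).
{ transitivity (RtoC (exp (- INR n) * (INR n ^ m * / INR (fact m)))%R).
  - f_equal; unfold n; rewrite fact_simpl, mult_INR, <- tech_pow_Rmult; field.
    split; [apply INR_fact_neq_0|apply not_0_INR; lia].
  - rewrite !RtoC_mult, RtoC_inv, RtoC_pow by apply INR_fact_neq_0.
    rewrite <- RtoC_opp, Cexp_RtoC; unfold Cdiv; ring. }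
rewrite Ef, Cpow_mult_l.
pose proof (INR_fact_C_neq_0 m).
unfold n; rewrite !Cpow_S; field; auto.
Qed.

Lemma Cmod_Csum_le (f : nat -> C) (g : nat -> R) N :
  (forall k, (k < N)%nat -> (Cmod (f k) <= g k)%R) ->
  (Cmod (Csum f N) <= Re (Csum (fun k => RtoC (g k)) N))%R.
Proof.
induction N as [|N IH]; intros H; simpl; [rewrite Cmod_0; lra|].
eapply Rle_trans; [apply Cmod_triangle|].
apply Rplus_le_compat; [apply IH; intros; apply H; lia|apply H; lia].
Qed.

(** In the partial sum only powers k < n occur, and |z|^k <= |z|^n; so the sum is at most |z|^n
    e^n. *)
Lemma F_out_bound n (z : C) : (1 <= Cmod z)%R -> (Cmod (F_out n z) <= 1)%R.
Proof.
intros Hz; unfold F_out.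
assert (Hz0 : z <> 0) by (apply Cmod_gt_0; lra).
rewrite Cmod_opp, Cmod_div, Cmod_mult, Cmod_Cexp, Cmod_pow by now apply Cpow_nz.
assert (Hp : (0 < Cmod z ^ n)%R) by (apply pow_lt; lra).
apply Rmult_le_reg_r with (Cmod z ^ n)%R; [easy|].
unfold Rdiv; rewrite Rmult_assoc, Rinv_l, Rmult_1_r, Rmult_1_l by lra.
replace (Re (- INR n)) with (- INR n)%R by (simpl; ring).
apply Rle_trans with (exp (- INR n) * (Cmod z ^ n * exp (INR n)))%R.
- apply Rmult_le_compat_l; [left; apply exp_pos|].
  apply Rle_trans with (Cmod z ^ n * Re (exp_sum n (INR n)))%R.
  + unfold exp_sum at 1.
    eapply Rle_trans; [apply (Cmod_Csum_le _ (fun k => Cmod z ^ n * (INR n ^ k / INR (fact k)))%R)|].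
    * intros k Hk; pose proof (INR_fact_lt_0 k).
      rewrite Cmod_div, Cmod_pow, Cmod_mult by apply INR_fact_C_neq_0.
      rewrite !Cmod_R, !Rabs_pos_eq by (try apply pos_INR; lra).
      rewrite Rpow_mult_distr; unfold Rdiv.
      rewrite (Rmult_comm (INR n ^ k)), !Rmult_assoc.
      apply Rmult_le_compat_r.
      { apply Rmult_le_pos; [apply pow_le, pos_INR|left; now apply Rinv_0_lt_compat]. }
      apply Rle_pow; [easy|lia].
    * right; rewrite <- re_scal_l; unfold exp_sum; rewrite <- Csum_scal.
      f_equal; apply Csum_ext; intros k _.
      rewrite !RtoC_mult, RtoC_div, !RtoC_pow by apply INR_fact_neq_0; easy.
  + apply Rmult_le_compat_l; [lra|apply exp_sum_R_le, pos_INR].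
- right; rewrite exp_Ropp; field; apply Rgt_not_eq, exp_pos.
Qed.

(** Adding e^{n phi} turns the partial sum into the tail of the exponential series, which for |z| <=
    1 is at most |z|^n e^n. *)
Lemma F_in_bound n (z : C) : z <> 0 -> (Cmod z <= 1)%R ->
  (Cmod (Cexp (INR n * phi z) + F_out n z) <= 1)%R.
Proof.
intros Hz0 Hz.
assert (Hzn : z ^ n <> 0) by now apply Cpow_nz.
replace (Cexp (INR n * phi z) + F_out n z)
  with (Cexp (- INR n) * exp_rem n (INR n * z) / z ^ n).
2:{ rewrite Cexp_phi by easy; unfold F_out, exp_rem.
    replace (INR n * (z - 1)) with (- INR n + INR n * z) by ring.
    rewrite Cexp_plus; field; auto. }
rewrite Cmod_div, Cmod_mult, Cmod_Cexp, Cmod_pow by easy.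
assert (Hp : (0 < Cmod z ^ n)%R) by (apply pow_lt; now apply Cmod_gt_0).
apply Rmult_le_reg_r with (Cmod z ^ n)%R; [easy|].
unfold Rdiv; rewrite Rmult_assoc, Rinv_l, Rmult_1_r, Rmult_1_l by lra.
replace (Re (- INR n)) with (- INR n)%R by (simpl; ring).
apply Rle_trans with (exp (- INR n) * (Cmod z ^ n * exp (INR n)))%R.
- apply Rmult_le_compat_l; [left; apply exp_pos|].
  eapply Rle_trans; [apply exp_rem_bound; [easy|apply pos_INR]|].
  apply Rmult_le_compat_l; [lra|apply exp_rem_R_le, pos_INR].
- right; rewrite exp_Ropp; field; apply Rgt_not_eq, exp_pos.
Qed.

(** * Winding numbers of a smooth curve are bounded *)

(** Compactness of [a, b] for an additive relation, by a supremum argument: the supremum of the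
    points reached from a can be passed unless it is b. *)
Lemma interval_chain (Q : R -> R -> Prop) (a b : R) :
  (a <= b)%R ->
  (forall x y z, (x <= y <= z)%R -> Q x y -> Q y z -> Q x z) ->
  (forall t, (a <= t <= b)%R -> exists d, (0 < d)%R /\
     forall x y, (t - d < x)%R -> (x <= y)%R -> (y < t + d)%R -> Q x y) ->
  Q a b.
Proof.
intros Hab Hadd Hloc.
set (S := fun x => (a <= x <= b)%R /\ Q a x).
assert (Sa : S a).
{ split; [lra|]; destruct (Hloc a ltac:(lra)) as (d & Hd & H); apply H; lra. }
destruct (completeness S) as [m [Hm1 Hm2]].
{ exists b; intros x [Hx _]; lra. }
{ now exists a. }
assert (Ham : (a <= m)%R) by now apply Hm1.
assert (Hmb : (m <= b)%R) by (apply Hm2; intros x [Hx _]; lra).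
destruct (Hloc m ltac:(lra)) as (d & Hd & H).
assert (Hx : exists x, S x /\ (m - d < x <= m)%R).
{ destruct (Classical_Prop.classic (exists x, S x /\ (m - d < x <= m)%R)) as [|N]; [easy|exfalso].
  assert (m <= m - d)%R; [|lra].
  apply Hm2; intros x Sx; apply Rnot_lt_le; intros L; apply N.
  exists x; split; [easy|split; [lra|now apply Hm1]]. }
destruct Hx as (x & [Hx Qx] & Hxm).
assert (Hy : S (Rmin b (m + d / 2))).
{ split; [split; [apply Rmin_glb; lra|apply Rmin_l]|].
  assert (m <= Rmin b (m + d / 2))%R by (apply Rmin_glb; lra).
  pose proof (Rmin_r b (m + d / 2)).
  apply Hadd with x; [lra|easy|]; apply H; lra. }
pose proof (Hm1 _ Hy) as Hle; destruct Hy as [_ Qy].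
destruct (Rle_dec b (m + d / 2)) as [L|L].
- now rewrite Rmin_left in Qy.
- rewrite Rmin_right in Hle by lra; lra.
Qed.

Section Winding.
Variable (gam : R -> C).
Hypothesis Hgam : closed_curve gam.
Hypothesis Hv : forall t, velocity gam t <> 0.

Let rate (z : C) (t : R) : C := / (gam t - z) * velocity gam t.

Lemma rate_cont z t : ~ on_curve gam z -> cont RtoC (rate z) t.
Proof. intros Hz; apply cont_mult; [now apply cauchy_kernel_cont|apply Hgam]. Qed.

(** The integral of the logarithmic derivative is a continuous logarithm of gam - z: the quotient of
    the two sides has derivative 0. *)
Lemma log_lift z a t : ~ on_curve gam z ->
  gam t - z = (gam a - z) * Cexp (Cint (rate z) a t).
Proof.
intros Hz.
set (E := fun s => (gam s - z) * Cexp (- Cint (rate z) a s)).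
assert (HE : forall s, der RtoC E s 0).
{ intros s; eapply der_eq; [|apply der_mult; [apply der_minus; [now apply curve_der|apply der_const]|
    apply der_Cexp, der_opp, Cint_der; intros; now apply rate_cont]].
  pose proof (curve_minus_neq gam z s Hz); unfold rate; cbv beta; field; auto. }
assert (H : E t = E a).
{ assert (K : forall u v, (u <= v)%R -> E v = E u).
  { intros u v Huv.
    pose proof (mean_value_le E (fun _ => 0) (fun _ => 0%R) (fun _ => 0%R) u v Huv) as M.
    assert (E v - E u = 0).
    { apply Cmod_eq_0, Rle_antisym; [|apply Cmod_ge_0].
      rewrite Rminus_diag in M; apply M; intros; [apply HE| |rewrite Cmod_0; lra].
      auto_derive; easy. }
    now apply Ceq_minus. }
  destruct (Rle_dec a t); [now apply K|symmetry; apply K; lra]. }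
unfold E in H.
replace (Cint (rate z) a a) with (RtoC 0) in H
  by (symmetry; exact (RInt_point (V := C_R_CompleteNormedModule) a (rate z))).
replace (- 0) with (RtoC 0) in H by ring; rewrite Cexp_0, Cmult_1_r in H.
rewrite <- H, <- Cmult_assoc, <- Cexp_plus.
replace (- Cint (rate z) a t + Cint (rate z) a t) with (RtoC 0) by ring.
rewrite Cexp_0; ring.
Qed.

Lemma Re_mult_Cexp (u v : C) :
  Re (u * Cexp v) = (exp (Re v) * (Re u * cos (Im v) - Im u * sin (Im v)))%R.
Proof. unfold Cexp; destruct u, v; simpl; ring. Qed.

Lemma IVT_value (f : R -> R) a b y :
  (a <= b)%R -> (forall t, continuity_pt f t) ->
  (f a <= y <= f b)%R \/ (f b <= y <= f a)%R -> exists c, (a <= c <= b)%R /\ f c = y.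
Proof.
intros Hab Hc H.
destruct (IVT_gen f a b y Hc) as (c & Hc1 & Hc2).
- destruct H; [rewrite Rmin_left, Rmax_right|rewrite Rmin_right, Rmax_left]; lra.
- exists c; rewrite Rmin_left, Rmax_right in Hc1 by lra; easy.
Qed.

(* While the velocity stays in a half-plane, one linear coordinate of gam - z is
   monotone, so it cannot keep its sign after half a turn and recover it after a full one. *)
Lemma short_arc_turn z d a b : ~ on_curve gam z -> (a <= b)%R ->
  (forall t, (a <= t <= b)%R -> (0 < Re (Cconj d * velocity gam t))%R) ->
  (Rabs (Im (Cint (rate z) a b)) <= 2 * PI)%R.
Proof.
intros Hz Hab Hd.
set (th := fun t => Im (Cint (rate z) a t)).
assert (Cth : forall t, continuity_pt th t).
{ intros t; apply cont_Im; eapply der_cont, Cint_der; intros; now apply rate_cont. }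
assert (Tha : th a = 0%R).
{ unfold th.
  replace (Cint (rate z) a a) with (RtoC 0)
    by (symmetry; exact (RInt_point (V := C_R_CompleteNormedModule) a (rate z))); easy. }
set (x := fun t => Re (Cconj d * (gam t - z))).
assert (Hx : forall t, is_derive x t (Re (Cconj d * velocity gam t))).
{ intros t; apply (der_Re_Im (fun t => Cconj d * (gam t - z))).
  eapply der_eq; [|apply der_scal, der_minus; [now apply curve_der|apply der_const]]; ring. }
assert (Inc : forall s t, (a <= s)%R -> (s < t)%R -> (t <= b)%R -> (x s < x t)%R).
{ intros s t H1 H2 H3.
  destruct (MVT_gen x s t (fun t => Re (Cconj d * velocity gam t))) as (c & Hc & E).
  - intros; apply Hx.
  - intros; apply continuity_pt_filterlim, (ex_derive_continuous x); eexists; apply Hx.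
  - rewrite Rmin_left, Rmax_right in Hc by lra.
    specialize (Hd c ltac:(lra)); nra. }
set (A := Cconj d * (gam a - z)).
assert (Ex : forall t, x t = (exp (Re (Cint (rate z) a t)) * (Re A * cos (th t) - Im A * sin (th t)))%R).
{ intros t; unfold x, th; rewrite (log_lift z a t Hz), Cmult_assoc; apply Re_mult_Cexp. }
assert (Exa : x a = Re A) by reflexivity.
apply Rnot_lt_le; intros Hlt.
pose proof PI_RGT_0 as HPI.
assert (Htheta : exists sg t1 t2, (sg = 1 \/ sg = -1)%R /\ (a < t1 < t2)%R /\ (t2 <= b)%R /\
   th t1 = (sg * PI)%R /\ th t2 = (sg * (2 * PI))%R).
{ change (2 * PI < Rabs (th b))%R in Hlt.
  assert (H : exists sg, (sg = 1 \/ sg = -1)%R /\ (2 * PI < sg * th b)%R).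
  { destruct (Rle_dec 0 (th b)).
    - exists 1%R; rewrite Rabs_pos_eq in Hlt by easy; split; [now left|lra].
    - exists (-1)%R; rewrite Rabs_left in Hlt by lra; split; [now right|lra]. }
  destruct H as (sg & Hs & H); exists sg.
  destruct (IVT_value th a b (sg * (2 * PI)) Hab Cth) as (t2 & H1 & H2).
  { destruct Hs as [-> | ->]; [left|right]; lra. }
  destruct (IVT_value th a t2 (sg * PI) ltac:(lra) Cth) as (t1 & H3 & H4).
  { destruct Hs as [-> | ->]; [left|right]; lra. }
  exists t1, t2; repeat split; try easy; try lra.
  - destruct (Req_dec a t1) as [E|N]; [|lra]; rewrite <- E in H4; destruct Hs as [-> | ->]; lra.
  - destruct (Req_dec t1 t2) as [E|N]; [|lra]; rewrite E in H4; destruct Hs as [-> | ->]; lra. }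
destruct Htheta as (sg & t1 & t2 & Hs & Ht & Ht2 & T1 & T2).
pose proof (Inc a t1 ltac:(lra) ltac:(lra) ltac:(lra)) as I1.
pose proof (Inc t1 t2 ltac:(lra) ltac:(lra) ltac:(lra)) as I2.
rewrite Exa in I1; rewrite (Ex t1), T1 in I1; rewrite (Ex t1), (Ex t2), T1, T2 in I2.
assert (Ec : (cos (sg * PI) = -1 /\ sin (sg * PI) = 0 /\ cos (sg * (2 * PI)) = 1 /\ sin (sg * (2 * PI)) = 0)%R).
{ destruct Hs as [-> | ->].
  - rewrite !Rmult_1_l, cos_PI, sin_PI, cos_2PI, sin_2PI; easy.
  - replace (-1 * PI)%R with (- PI)%R by ring; replace (-1 * (2 * PI))%R with (- (2 * PI))%R by ring.
    rewrite !cos_neg, !sin_neg, cos_PI, sin_PI, cos_2PI, sin_2PI; repeat split; ring. }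
destruct Ec as (E1 & E2 & E3 & E4); rewrite E1, E2 in I1, I2; rewrite E3, E4 in I2.
pose proof (exp_pos (Re (Cint (rate z) a t1))) as P1.
pose proof (exp_pos (Re (Cint (rate z) a t2))) as P2.
(* The increasing coordinate takes the values Re A, - r1 Re A, r2 Re A with r1, r2 > 0, which is
   impossible for either sign of Re A. *)
destruct (Rle_dec 0 (Re A)); nra.
Qed.

(** Continuity of the velocity cuts the curve into arcs whose number does not depend on z, and each
    turns by at most 2 pi as seen from z. A crude bound is enough, since it will multiply an
    exponentially small factor. *)
Lemma winding_bounded :
  exists K, forall z, ~ on_curve gam z -> (Cmod (winding_number gam z) <= K)%R.
Proof.
assert (H : exists K, forall z, ~ on_curve gam z -> (Rabs (Im (Cint (rate z) 0 1)) <= K)%R).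
{ apply (interval_chain (fun a b => exists K, forall z, ~ on_curve gam z ->
     (Rabs (Im (Cint (rate z) a b)) <= K)%R) 0 1); [lra| |].
  - intros a b c Habc [K1 H1] [K2 H2]; exists (K1 + K2)%R; intros z Hz.
    assert (E : Cint (rate z) a c = Cint (rate z) a b + Cint (rate z) b c).
    { symmetry; apply (RInt_Chasles (V := C_R_CompleteNormedModule));
        apply ex_RInt_continuous; intros; now apply continuous_of_cont, rate_cont. }
    rewrite E; replace (Im (Cint (rate z) a b + Cint (rate z) b c))
      with (Im (Cint (rate z) a b) + Im (Cint (rate z) b c))%R by easy.
    eapply Rle_trans; [apply Rabs_triang|]; specialize (H1 z Hz); specialize (H2 z Hz); lra.
  - intros t _.
    set (d := velocity gam t).
    assert (Hp : (0 < Re (Cconj d * d))%R).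
    { replace (Re (Cconj d * d)) with (Cmod d ^ 2)%R
        by (rewrite Cmod2_alt; unfold Re, Im; simpl; ring).
      apply pow_lt, Cmod_gt_0, Hv. }
    assert (Cp : cont RtoC (fun s => Cconj d * velocity gam s) t)
      by (apply cont_mult; [apply cont_const|apply Hgam]).
    (* As long as conj d times the velocity is closer than |d|^2 to its value |d|^2 at t, its real
       part stays positive. *)
    destruct (Cp _ Hp) as (e & He & HE).
    exists e; split; [easy|]; intros x y H1 H2 H3.
    exists (2 * PI)%R; intros z Hz; apply (short_arc_turn z d); try easy.
    intros s Hs; specialize (HE s); cbv beta in HE; fold d in HE.
    rewrite Cmod_RtoC_sub in HE; specialize (HE ltac:(apply Rabs_def1; lra)).
    pose proof (re_le_Cmod (Cconj d * velocity gam s - Cconj d * d)) as R1.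
    replace (Re (Cconj d * velocity gam s - Cconj d * d))
      with (Re (Cconj d * velocity gam s) - Re (Cconj d * d))%R in R1 by easy.
    pose proof (Rle_abs (- (Re (Cconj d * velocity gam s) - Re (Cconj d * d)))%R) as R2.
    rewrite Rabs_Ropp in R2; lra. }
destruct H as [K HK]; exists (Cmod (/ (2 * PI * Ci)) * K)%R; intros z Hz.
unfold winding_number; rewrite Cmod_mult; apply Rmult_le_compat_l; [apply Cmod_ge_0|].
rewrite CI_is.
change (Cmod (Cint (rate z) 0 1) <= K)%R.
pose proof (log_lift z 0 1 Hz) as E.
replace (gam 1%R) with (gam 0%R) in E
  by (rewrite <- (proj2 (proj2 Hgam) 0%R); f_equal; ring).
pose proof (curve_minus_neq gam z 0 Hz) as Hne.
(* The curve closes up, so the integral has real part 0 and the bound on the turning angle bounds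
   all of it. *)
assert (E1 : Cexp (Cint (rate z) 0 1) = 1).
{ replace (Cexp (Cint (rate z) 0 1))
    with (/ (gam 0%R - z) * ((gam 0%R - z) * Cexp (Cint (rate z) 0 1))) by (field; auto).
  rewrite <- E; field; auto. }
assert (E2 : Re (Cint (rate z) 0 1) = 0%R)
  by (apply exp_inv; rewrite <- Cmod_Cexp, E1, Cmod_1, exp_0; easy).
specialize (HK z Hz).
assert (Him : forall c : C, Re c = 0%R -> c = Ci * RtoC (Im c)).
{ intros [p q]; simpl; intros ->; apply injective_projections; simpl; ring. }
rewrite (Him _ E2), Cmod_mult, Cmod_Ci, Cmod_R; lra.
Qed.

End Winding.

(** * Admissible curves and the level set *)

Lemma Re_phi (z : C) : Re (phi z) = (Re z - 1 - ln (Cmod z))%R.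
Proof. unfold phi, Clog; destruct z; simpl; ring. Qed.

Lemma Im_phi (z : C) : Im (phi z) = (Im z - Carg z)%R.
Proof. unfold phi, Clog; destruct z; simpl; ring. Qed.

Lemma slit_plane_neq_0 (z : C) : slit_plane z -> z <> 0.
Proof. intros H ->; apply H; simpl; split; [easy|lra]. Qed.

Lemma Carg_bound (z : C) : (- PI <= Carg z <= PI)%R.
Proof.
pose proof (acos_bound (Re z / Cmod z)); unfold Carg; destruct (Rlt_dec _ _); lra.
Qed.

Lemma x_cos_lt_sin (y : R) : (0 < y <= PI)%R -> (y * cos y < sin y)%R.
Proof.
intros Hy.
destruct (MVT_cor2 (fun y => sin y - y * cos y)%R (fun y => y * sin y)%R 0 y) as (c & E & Hc).
- lra.
- intros; apply is_derive_Reals; auto_derive; [easy|ring].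
- rewrite sin_0 in E; pose proof (sin_gt_0 c ltac:(lra) ltac:(lra)).
  assert (0 < c * sin c * (y - 0))%R by (repeat apply Rmult_lt_0_compat; lra); lra.
Qed.

(** The equation s = e^{s-1} off the real axis. From sin y < y the second equation gives x > 1;
    eliminating the exponential gives x sin y = y cos y < sin y, hence x < 1. *)
Lemma exp_polar_fixed (x y : R) : (0 < y <= PI)%R ->
  x = (exp (x - 1) * cos y)%R -> y = (exp (x - 1) * sin y)%R -> False.
Proof.
intros Hy Hx Hyy.
pose proof (x_cos_lt_sin y Hy) as H1.
pose proof (sin_lt_x y ltac:(lra)) as H2.
assert (Hs : (0 < sin y)%R).
{ destruct (Req_dec y PI) as [->|]; [rewrite sin_PI in Hyy; lra|apply sin_gt_0; lra]. }
assert (He : (1 < exp (x - 1))%R) by nra.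
assert (Hx1 : (0 < x - 1)%R) by (apply exp_lt_inv; rewrite exp_0; exact He).
assert (A : (x * sin y = exp (x - 1) * cos y * sin y)%R) by (f_equal; exact Hx).
assert (B : (y * cos y = exp (x - 1) * sin y * cos y)%R) by (f_equal; exact Hyy).
nra.
Qed.

(** On the path phi is real, so Re phi = 0 means Clog z = z - 1, that is z = e^{z-1}. *)
Lemma descent_path_zero (z : C) : descent_path z -> Re (phi z) = 0%R -> z = 1.
Proof.
intros (Hs & Ha & _) H0; rewrite Re_phi in H0.
pose proof (Cexp_Clog z (slit_plane_neq_0 z Hs)) as E.
replace (Clog z) with (z - 1) in E.
2:{ unfold Clog; rewrite Ha; destruct z as [p q]; simpl in *.
    apply injective_projections; simpl; lra. }
pose proof (Carg_bound z) as Hb; rewrite Ha in Hb; clear Ha Hs H0.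
destruct z as [x y]; unfold Cexp in E; simpl in E, Hb.
replace (x + - (1))%R with (x - 1)%R in E by ring.
replace (y + - 0)%R with y in E by ring.
injection E; intros Ey Ex; clear E.
destruct (Rtotal_order y 0) as [L|[->|G]].
- exfalso; apply (exp_polar_fixed x (- y)); [lra|rewrite cos_neg; lra|rewrite sin_neg; lra].
- rewrite cos_0 in Ex.
  destruct (Req_dec x 1) as [->|N]; [easy|exfalso].
  pose proof (exp_ineq1 (x - 1) ltac:(lra)); lra.
- exfalso; apply (exp_polar_fixed x y); lra.
Qed.

Lemma descent_path_1 : descent_path 1.
Proof.
unfold descent_path, slit_plane; rewrite Re_phi, Cmod_1, ln_1; unfold Carg; simpl.
rewrite Cmod_1; destruct (Rlt_dec 0 0); [lra|].
replace (1 / 1)%R with 1%R by field; rewrite acos_1.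
repeat split; try lra.
Qed.

Lemma open_disk (U : C -> Prop) (z : C) : open U -> U z ->
  exists d, (0 < d)%R /\ forall w, (Cmod (w - z) < d)%R -> U w.
Proof.
intros HU Hz; destruct (HU z Hz) as [d Hd].
exists d; split; [apply cond_pos|]; intros w Hw; apply Hd; split.
- eapply Rle_lt_trans; [apply (re_le_Cmod (w - z))|exact Hw].
- eapply Rle_lt_trans; [apply (im_le_Cmod (w - z))|exact Hw].
Qed.

Section Separation.
Variable (gam : R -> C).
Hypothesis Hadm : admissible gam.

Let f (t : R) : R := Re (phi (gam t)).

Lemma admissible_closed : closed_curve gam.
Proof. apply closed_curve_of_jordan, Hadm. Qed.

Lemma admissible_neq_0 t : gam t <> 0.
Proof. intros E; apply (proj1 (proj2 Hadm)); now exists t. Qed.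

Lemma Re_phi_continuous t : continuity_pt f t.
Proof.
assert (Hc : forall t, cont RtoC gam t) by (intros; apply curve_cont, admissible_closed).
assert (Hf : forall t, f t = (Re (gam t) - 1 - ln (Cmod (gam t)))%R) by (intros; apply Re_phi).
apply continuity_pt_ext with (fun t => Re (gam t) - 1 - ln (Cmod (gam t)))%R.
{ intros; now rewrite Hf. }
apply continuity_pt_minus.
- apply continuity_pt_minus; [now apply cont_Re|apply continuity_pt_const; now intros ? ?].
- apply (continuity_pt_comp (fun t => Cmod (gam t)) ln); [now apply cont_Cmod|].
  apply derivable_continuous_pt; exists (/ Cmod (gam t))%R; apply derivable_pt_lim_ln.
  apply Cmod_gt_0, admissible_neq_0.
Qed.

(** The curve passes through 1, where Re phi = 0, and cannot cross to positive values: a zero of Re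
    phi is a point of S, so it lies in U, where the curve follows the descent path and Re phi <= 0
    on both sides. *)
Lemma admissible_sign :
  (forall t, (f t <= 0)%R /\ (f t = 0%R -> gam t = 1)) /\
  exists rho, (0 < rho)%R /\ forall t, (Cmod (gam t - 1) < rho)%R -> descent_path (gam t).
Proof.
destruct Hadm as (HJ & Hoc & Hw & U & HU & HU1 & HUd & d & Hd & Hdist).
assert (Zero : forall t, f t = 0%R -> U (gam t)).
{ intros t Ht; destruct (Classical_Prop.classic (U (gam t))) as [|N]; [easy|exfalso].
  assert (H : (d <= Cmod (gam t - gam t))%R).
  { apply Hdist; [now exists t|easy|split; [apply admissible_neq_0|easy]]. }
  replace (gam t - gam t) with (RtoC 0) in H by ring; rewrite Cmod_0 in H; lra. }
assert (InU : forall t, U (gam t) -> descent_path (gam t)).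
{ intros t Ht; apply HUd; [easy|now exists t]. }
assert (Near : forall t, U (gam t) -> exists e, (0 < e)%R /\ forall s, (Rabs (s - t) < e)%R -> U (gam s)).
{ intros t Ht; destruct (open_disk U (gam t) HU Ht) as (e & He & K).
  destruct (curve_cont gam admissible_closed t e He) as (e' & He' & K').
  exists e'; split; [easy|]; intros s Hs; apply K, K'; now rewrite Cmod_RtoC_sub. }
split.
- assert (Hle : forall t, (f t <= 0)%R).
  { intros t.
    destruct (proj2 (HUd 1 HU1) descent_path_1) as [t0' Ht0'].
    destruct (on_curve_unit gam admissible_closed 1) as (t0 & Ht0 & E0); [now exists t0'|].
    destruct (on_curve_unit gam admissible_closed (gam t)) as (s & Hs & Es); [now exists t|].
    (* The shift by one period makes the interval run forward from t0. The implication is an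
       additive relation, so a local check, by the sign of f u, suffices. *)
    assert (Q : (f t0 <= 0 -> f (s + 1) <= 0)%R).
    { apply (interval_chain (fun x y => f x <= 0 -> f y <= 0)%R); [lra|tauto|].
      intros u _.
      destruct (Rtotal_order (f u) 0) as [L|[Z|G]].
      - assert (Hp : (0 < - f u)%R) by lra.
        destruct (proj1 (continuity_pt_locally f u) (Re_phi_continuous u) (mkposreal _ Hp)) as [e He].
        exists e; split; [apply cond_pos|]; intros x y H1 H2 H3 _.
        assert (Hy : (Rabs (f y - f u) < - f u)%R) by (apply He; change (Rabs (y - u) < e)%R; apply Rabs_def1; lra).
        apply Rabs_def2 in Hy; lra.
      - destruct (Near u (Zero u Z)) as (e & He & K).
        exists e; split; [easy|]; intros x y H1 H2 H3 _.
        apply (InU y), K, Rabs_def1; lra.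
      - destruct (proj1 (continuity_pt_locally f u) (Re_phi_continuous u) (mkposreal _ G)) as [e He].
        exists e; split; [apply cond_pos|]; intros x y H1 H2 H3 Hx; exfalso.
        assert (Hy : (Rabs (f x - f u) < f u)%R) by (apply He; change (Rabs (x - u) < e)%R; apply Rabs_def1; lra).
        apply Rabs_def2 in Hy; lra. }
    unfold f in Q; rewrite E0 in Q.
    rewrite (proj2 (proj2 admissible_closed)), Es in Q; apply Q.
    rewrite Re_phi, Cmod_1, ln_1; simpl; lra. }
  intros t; split; [apply Hle|].
  intros Z; apply descent_path_zero; [now apply InU, Zero|exact Z].
- destruct (open_disk U 1 HU HU1) as (e & He & K).
  exists e; split; [easy|]; intros t Ht; now apply InU, K.
Qed.

Lemma admissible_gap rho : (0 < rho)%R ->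
  exists m, (0 < m)%R /\ forall t, (rho <= Cmod (gam t - 1))%R -> (f t <= - m)%R.
Proof.
intros Hrho; destruct admissible_sign as [Hs _].
set (k := fun t => Cmod (gam t - 1)).
assert (Ck : forall t, continuity_pt k t).
{ intros; apply cont_Cmod, cont_minus; [apply curve_cont, admissible_closed|apply cont_const]. }
(* Adding twice the positive part of rho - k makes the function positive also at the parameters of 1
   and changes nothing where k >= rho; so the minimum can be taken over the whole interval. *)
destruct (positive_min (fun t => - f t + ((rho - k t) + Rabs (rho - k t)))%R 0 1) as (m & Hm & H).
- lra.
- intros t _.
  assert (Cr : continuity_pt (fun t => rho - k t)%R t).
  { apply continuity_pt_minus; [apply continuity_pt_const; now intros ? ?|apply Ck]. }
  apply continuity_pt_plus; [apply continuity_pt_opp, Re_phi_continuous|].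
  apply continuity_pt_plus; [exact Cr|].
  apply (continuity_pt_comp (fun t => rho - k t)%R Rabs); [exact Cr|apply Rcontinuity_abs].
- intros t _; destruct (Hs t) as [H1 H2].
  pose proof (Rle_abs (- (rho - k t))) as R1; rewrite Rabs_Ropp in R1.
  destruct (Req_dec (f t) 0) as [E|N]; [|lra].
  assert (Ek : k t = 0%R).
  { unfold k; rewrite (H2 E); replace (1 - 1) with (RtoC 0) by ring; apply Cmod_0. }
  rewrite Ek, E, Rminus_0_r, Rabs_pos_eq; lra.
- exists m; split; [easy|]; intros t Ht.
  destruct (on_curve_unit gam admissible_closed (gam t)) as (s & Hs' & Es); [now exists t|].
  specialize (H s Hs'); unfold k in H; unfold f in *; rewrite Es in H.
  rewrite Rabs_left1 in H by lra; lra.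
Qed.

(** The horizontal ray from p to the right avoids the curve: |p + tau| <= |p| + tau <= |p| e^tau, so
    ln |p + tau| grows by at most tau and Re phi stays positive. Far out on the ray the winding
    number is arbitrarily small. *)
Lemma winding_outside (p : C) : (1 < Cmod p)%R -> (0 < Re (phi p))%R ->
  winding_number gam p = 0.
Proof.
intros Hp Hphi; destruct admissible_sign as [Hs _].
assert (Hcl := admissible_closed).
assert (Hray : forall tau : R, (0 <= tau)%R -> ~ on_curve gam (p + tau)).
{ intros tau Ht [t E].
  destruct (Hs t) as [H1 _]; unfold f in H1; rewrite E, Re_phi in H1; rewrite Re_phi in Hphi.
  replace (Re (p + tau)) with (Re p + tau)%R in H1 by (destruct p; simpl; ring).
  pose proof (Cmod_triangle p tau) as T; rewrite Cmod_R, Rabs_pos_eq in T by easy.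
  assert (Hpos : (0 < Cmod (p + tau))%R).
  { rewrite <- E; apply Cmod_gt_0, admissible_neq_0. }
  assert (L : (ln (Cmod (p + tau)) <= ln (Cmod p * exp tau))%R).
  { apply Rcomplements.ln_le; [easy|].
    pose proof (exp_ineq1_le tau); nra. }
  rewrite ln_mult, ln_exp in L by (try apply exp_pos; lra); lra. }
destruct (speed_bound gam Hcl) as (L & HL & HV).
destruct (bounded_above (fun t => Cmod (gam t - p)) 0 1 ltac:(lra)) as [M HM].
{ intros; apply cont_Cmod, cont_minus; [now apply curve_cont|apply cont_const]. }
apply Cmod_eq_0, Rle_antisym; [|apply Cmod_ge_0]; apply Rnot_lt_le; intros Hpos.
set (K := Cmod (/ (2 * PI * Ci))).
assert (HK : (0 <= K)%R) by apply Cmod_ge_0.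
set (W := Cmod (winding_number gam p)) in *.
(* The distance at which the bound K L / D for the winding number drops below its supposed modulus
   W. *)
set (D := ((K * L + 1) / W)%R).
assert (HD : (0 < D)%R) by (apply Rdiv_lt_0_compat; [nra|easy]).
set (tau := (Rabs M + D)%R).
assert (Htau : (0 <= tau)%R) by (unfold tau; pose proof (Rabs_pos M); lra).
assert (E : winding_number gam (p + tau) = winding_number gam p).
{ apply (winding_segment gam Hcl); intros t Ht.
  replace (p + t * (p + tau - p)) with (p + RtoC (t * tau)) by (rewrite RtoC_mult; ring).
  apply Hray; nra. }
assert (B : (W <= K * (/ D * L))%R).
{ unfold W; rewrite <- E; unfold winding_number; rewrite Cmod_mult; fold K.
  apply Rmult_le_compat_l; [easy|].
  apply (CI_bound gam Hcl); [easy| |].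
  - intros; now apply cauchy_kernel_cont, Hray.
  - intros t Ht; rewrite Cmod_inv by now apply curve_minus_neq, Hray.
    apply Rinv_le_contravar; [easy|].
    specialize (HM t Ht).
    pose proof (Cmod_triangle (- (gam t - (p + tau))) (gam t - p)) as T.
    replace (- (gam t - (p + tau)) + (gam t - p)) with (RtoC tau) in T by ring.
    rewrite Cmod_opp, Cmod_R, Rabs_pos_eq in T by easy.
    pose proof (Rle_abs M); unfold tau in *; lra. }
assert (EWD : (W * D = K * L + 1)%R) by (unfold D; field; lra).
apply (Rmult_le_compat_r D) in B; [|lra].
replace (K * (/ D * L) * D)%R with (K * L)%R in B by (field; lra); lra.
Qed.

(** The segment from 0 to p avoids the curve: since ln t <= t - 1 and Re p < 1, Re phi (t p) is at
    least Re phi p > 0 for 0 < t <= 1. *)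
Lemma winding_inside (p : C) : p <> 0 -> (Cmod p < 1)%R -> (0 < Re (phi p))%R ->
  winding_number gam p = 1.
Proof.
intros Hp0 Hp Hphi; destruct admissible_sign as [Hs _].
assert (Hcl := admissible_closed).
rewrite <- (proj1 (proj2 (proj2 Hadm))).
apply (winding_segment gam Hcl); intros t Ht.
replace (0 + t * (p - 0)) with (RtoC t * p) by ring.
intros [u E].
destruct (Req_dec t 0) as [->|N].
{ apply (admissible_neq_0 u); rewrite E; ring. }
destruct (Hs u) as [H1 _]; unfold f in H1; rewrite E, Re_phi in H1; rewrite Re_phi in Hphi.
pose proof (proj1 (Cmod_gt_0 p) Hp0).
rewrite Cmod_mult, Cmod_R, Rabs_pos_eq, ln_mult in H1 by lra.
replace (Re (t * p)) with (t * Re p)%R in H1 by (destruct p; simpl; ring).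
pose proof (Re_le_Cmod p).
assert (L : (ln t <= t - 1)%R).
{ replace t with (1 + (t - 1))%R at 1 by ring.
  rewrite <- (ln_exp (t - 1)) at 2; apply Rcomplements.ln_le; [lra|apply exp_ineq1_le]. }
nra.
Qed.

End Separation.

(** * Integrals over the line and the function h *)

(** The majorant has the primitive M atan, so tails and total integral are controlled without
    improper integrals of real functions. *)
Definition dominated (f : R -> C) (M : R) : Prop :=
  (forall u, cont RtoC f u) /\ (forall u, (Cmod (f u) <= M * / (1 + u * u))%R).

Definition line_integral (f : R -> C) : C :=
  RInt_gen (V := C_R_CompleteNormedModule) f (Rbar_locally m_infty) (Rbar_locally p_infty).

Lemma dominated_nonneg f M : dominated f M -> (0 <= M)%R.
Proof.
intros [_ H]; specialize (H 0%R); pose proof (Cmod_ge_0 (f 0%R)).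
replace (M * / (1 + 0 * 0))%R with M in H by field; lra.
Qed.

Lemma dominated_arc f M a b : dominated f M -> (a <= b)%R ->
  (Cmod (Cint f a b) <= M * (atan b - atan a))%R.
Proof.
intros [Hc Hb] Hab.
pose proof (mean_value_le (fun x => Cint f a x) f (fun x => M * atan x)%R
   (fun x => M * / (1 + x * x))%R a b Hab) as H; cbv beta in H.
replace (Cint f a a) with (RtoC 0) in H
  by (symmetry; exact (RInt_point (V := C_R_CompleteNormedModule) a f)).
replace (Cint f a b - 0) with (Cint f a b) in H by ring.
rewrite Rmult_minus_distr_l; apply H; intros t Ht.
- now apply Cint_der.
- apply is_derive_scal, is_derive_Reals.
  replace (/ (1 + t * t))%R with (/ (1 + t ^ 2))%R by (f_equal; ring).
  apply derivable_pt_lim_atan.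
- apply Hb.
Qed.

Lemma Cint_Chasles f a b c : (forall u, cont RtoC f u) ->
  Cint f a b + Cint f b c = Cint f a c.
Proof.
intros H; apply (RInt_Chasles (V := C_R_CompleteNormedModule));
  apply ex_RInt_continuous; intros; now apply continuous_of_cont.
Qed.

Lemma Cint_swap f a b : (forall u, cont RtoC f u) -> Cint f a b = - Cint f b a.
Proof.
intros H; symmetry; apply (opp_RInt_swap (V := C_R_CompleteNormedModule) f b a).
apply ex_RInt_continuous; intros; now apply continuous_of_cont.
Qed.

Lemma atan_tail (M e : R) : (0 <= M)%R -> (0 < e)%R ->
  exists T, (0 < T)%R /\ (M * (PI / 2 - atan T) < e)%R.
Proof.
intros HM He; pose proof PI_RGT_0.
set (q := Rmin (PI / 4) (e / (2 * (M + 1)))).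
assert (Hq : (0 < q)%R) by (apply Rmin_pos; [lra|apply Rdiv_lt_0_compat; lra]).
assert (Hq1 : (q <= PI / 4)%R) by apply Rmin_l.
assert (Hq2 : (q * (M + 1) <= e / 2)%R).
{ apply Rle_trans with (e / (2 * (M + 1)) * (M + 1))%R.
  - apply Rmult_le_compat_r; [lra|apply Rmin_r].
  - right; field; lra. }
exists (tan (PI / 2 - q)); split; [apply tan_gt_0; lra|].
rewrite atan_tan by lra; nra.
Qed.

Lemma dominated_arc_tail f M T a b : dominated f M ->
  (T <= a)%R -> (T <= b)%R -> (Cmod (Cint f a b) <= M * (PI / 2 - atan T))%R.
Proof.
intros Hf; pose proof (dominated_nonneg f M Hf) as HM.
assert (K : forall a b, (T <= a)%R -> (a <= b)%R -> (Cmod (Cint f a b) <= M * (PI / 2 - atan T))%R).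
{ intros x y H1 H2; eapply Rle_trans; [apply (dominated_arc f M); assumption|].
  apply Rmult_le_compat_l; [easy|].
  pose proof (atan_bound y).
  assert (atan T <= atan x)%R; [|lra].
  destruct (Rle_lt_or_eq_dec _ _ H1) as [L| ->]; [left; now apply atan_increasing|lra]. }
intros Ha Hb; destruct (Rle_dec a b); [now apply K|].
rewrite Cint_swap, Cmod_opp by apply Hf; apply K; lra.
Qed.

Lemma dominated_arc_tail_neg f M T a b : dominated f M ->
  (a <= - T)%R -> (b <= - T)%R -> (Cmod (Cint f a b) <= M * (PI / 2 - atan T))%R.
Proof.
intros Hf; pose proof (dominated_nonneg f M Hf) as HM.
assert (K : forall a b, (b <= - T)%R -> (a <= b)%R -> (Cmod (Cint f a b) <= M * (PI / 2 - atan T))%R).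
{ intros x y H1 H2; eapply Rle_trans; [apply (dominated_arc f M); assumption|].
  apply Rmult_le_compat_l; [easy|].
  pose proof (atan_bound x).
  assert (atan y <= - atan T)%R; [|lra].
  rewrite <- atan_opp.
  destruct (Rle_lt_or_eq_dec _ _ H1) as [L| ->]; [left; now apply atan_increasing|lra]. }
intros Ha Hb; destruct (Rle_dec a b); [now apply K|].
rewrite Cint_swap, Cmod_opp by apply Hf; apply K; lra.
Qed.

Lemma dominated_compare f M T a b a' b' : dominated f M ->
  (a <= - T)%R -> (a' <= - T)%R -> (T <= b)%R -> (T <= b')%R ->
  (Cmod (Cint f a' b' - Cint f a b) <= 2 * (M * (PI / 2 - atan T)))%R.
Proof.
intros Hf H1 H2 H3 H4.
replace (Cint f a' b' - Cint f a b) with (Cint f a' a + Cint f b b').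
2:{ rewrite <- (Cint_Chasles f a' b b' (proj1 Hf)), <- (Cint_Chasles f a' a b (proj1 Hf)); ring. }
eapply Rle_trans; [apply Cmod_triangle|].
pose proof (dominated_arc_tail f M T b b' Hf H3 H4).
pose proof (dominated_arc_tail_neg f M T a' a Hf H2 H1); lra.
Qed.

Lemma Cmod_of_ball (x y : C) (e : posreal) :
  ball (M := C_R_CompleteNormedModule) x e y -> (Cmod (y - x) < 2 * e)%R.
Proof.
intros [H1 H2].
unfold ball in H1, H2; simpl in H1, H2; unfold AbsRing_ball, abs, minus, plus, opp in H1, H2; simpl in H1, H2.
replace (y - x) with (RtoC (fst y + - fst x) + Ci * RtoC (snd y + - snd x))
  by (apply injective_projections; simpl; ring).
eapply Rle_lt_trans; [apply Cmod_triangle|]; rewrite Cmod_mult, Cmod_Ci, !Cmod_R; lra.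
Qed.

Lemma ball_of_Cmod (x y : C) (e : posreal) :
  (Cmod (y - x) < e)%R -> ball (M := C_R_CompleteNormedModule) x e y.
Proof.
intros H; split; eapply Rle_lt_trans; try exact H;
  [apply (re_le_Cmod (y - x))|apply (im_le_Cmod (y - x))].
Qed.

(** The Cauchy criterion shows that [RInt_gen] denotes a genuine limit with both ends independent;
    from here on symmetric intervals suffice. *)
Lemma line_integral_spec f M : dominated f M ->
  forall e, (0 < e)%R -> exists T0, forall T, (T0 <= T)%R ->
    (Cmod (Cint f (- T) T - line_integral f) < e)%R.
Proof.
intros Hf; pose proof (dominated_nonneg f M Hf) as HM.
assert (Hex : forall a b, ex_RInt (V := C_R_CompleteNormedModule) f a b).
{ intros; apply ex_RInt_continuous; intros; apply continuous_of_cont, Hf. }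
assert (Hl : exists l, is_RInt_gen (V := C_R_CompleteNormedModule) f
               (Rbar_locally m_infty) (Rbar_locally p_infty) l).
{ apply (filterlimi_locally_cauchy (U := C_R_CompleteNormedModule)).
  - exists (fun _ => True) (fun _ => True); [now exists 0%R|now exists 0%R|].
    intros x y _ _; split.
    + destruct (Hex x y) as [l Hl]; now exists l.
    + intros y1 y2 E1 E2; simpl in E1, E2.
      apply (Cint_unique f) in E1; apply (Cint_unique f) in E2; congruence.
  - intros e.
    destruct (atan_tail M (e / 4) HM) as (T & HT & Hlt); [pose proof (cond_pos e); lra|].
    exists (fun ab => (fst ab <= - T)%R /\ (T <= snd ab)%R); split.
    + exists (fun a => (a <= - T)%R) (fun b => (T <= b)%R); [| |easy].
      * exists (- T)%R; intros; lra.
      * exists T; intros; lra.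
    + intros [a b] [a' b'] [Ha Hb] [Ha' Hb'] u' v' Hu Hv; simpl in *.
      apply (Cint_unique f) in Hu; apply (Cint_unique f) in Hv; subst u' v'.
      apply ball_of_Cmod.
      pose proof (dominated_compare f M T a b a' b' Hf Ha Ha' Hb Hb'); pose proof (cond_pos e); lra. }
destruct Hl as [l Hl].
assert (E : line_integral f = l).
{ exact (is_RInt_gen_unique (V := C_R_CompleteNormedModule) f l Hl). }
rewrite E; intros e He.
assert (He2 : (0 < e / 2)%R) by lra.
destruct (Hl (fun y => ball (M := C_R_CompleteNormedModule) l (mkposreal _ He2) y)) as [Q1 Q2 [m Hm] [p Hp] H].
{ now exists (mkposreal _ He2). }
exists (Rmax (1 - m) (p + 1)); intros T HT.
destruct (H (- T)%R T) as (y & Hy & By).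
- apply Hm; pose proof (Rmax_l (1 - m) (p + 1)); lra.
- apply Hp; pose proof (Rmax_r (1 - m) (p + 1)); lra.
- simpl in Hy; apply (Cint_unique f) in Hy; subst y.
  apply Cmod_of_ball in By; simpl in By; lra.
Qed.

Lemma line_integral_unique f M l : dominated f M ->
  (forall e, (0 < e)%R -> exists T0, forall T, (T0 <= T)%R -> (Cmod (Cint f (- T) T - l) <= e)%R) ->
  line_integral f = l.
Proof.
intros Hf H; apply Ceq_minus, Cmod_eq_0, Rle_antisym; [|apply Cmod_ge_0].
apply Rnot_lt_le; intros Hp.
set (d := Cmod (line_integral f - l)) in *.
destruct (line_integral_spec f M Hf (d / 3) ltac:(lra)) as [T1 H1].
destruct (H (d / 3)%R ltac:(lra)) as [T2 H2].
specialize (H1 (Rmax T1 T2) (Rmax_l _ _)); specialize (H2 (Rmax T1 T2) (Rmax_r _ _)).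
set (c := Cint f (- Rmax T1 T2) (Rmax T1 T2)) in *.
pose proof (Cmod_triangle (- (c - line_integral f)) (c - l)) as Tr.
replace (- (c - line_integral f) + (c - l)) with (line_integral f - l) in Tr by ring.
rewrite Cmod_opp in Tr; fold d in Tr; lra.
Qed.

(** The 4 stands for pi, the total mass of 1 / (1 + u^2). *)
Lemma line_integral_bound f M : dominated f M -> (Cmod (line_integral f) <= 4 * M)%R.
Proof.
intros Hf; pose proof (dominated_nonneg f M Hf) as HM.
apply Rnot_lt_le; intros Hp.
destruct (line_integral_spec f M Hf (Cmod (line_integral f) - 4 * M) ltac:(lra)) as [T0 H].
set (T := Rmax T0 1) in *.
specialize (H T (Rmax_l _ _)).
assert (HT : (1 <= T)%R) by apply Rmax_r.
pose proof (dominated_arc f M (- T) T Hf ltac:(lra)) as B.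
pose proof (atan_bound T); pose proof (atan_bound (- T)); pose proof PI_4.
pose proof (Cmod_le_sub (line_integral f) (Cint f (- T) T)) as S; rewrite Cmod_sym in S.
assert (M * (atan T - atan (- T)) <= M * 4)%R by (apply Rmult_le_compat_l; lra).
lra.
Qed.

Lemma dominated_scal c f M : dominated f M -> dominated (fun u => c * f u) (Cmod c * M).
Proof.
intros [H1 H2]; split; [intros; apply cont_mult; [apply cont_const|easy]|].
intros u; rewrite Cmod_mult, Rmult_assoc; apply Rmult_le_compat_l; [apply Cmod_ge_0|easy].
Qed.

Lemma dominated_plus f g M N : dominated f M -> dominated g N -> dominated (fun u => f u + g u) (M + N).
Proof.
intros [H1 H2] [H3 H4]; split; [intros; now apply cont_plus|].
intros u; eapply Rle_trans; [apply Cmod_triangle|]; specialize (H2 u); specialize (H4 u); lra.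
Qed.

Lemma line_integral_scal c f M : dominated f M ->
  line_integral (fun u => c * f u) = c * line_integral f.
Proof.
intros Hf; apply (line_integral_unique _ _ _ (dominated_scal c f M Hf)).
intros e He; pose proof (Cmod_ge_0 c).
destruct (line_integral_spec f M Hf (e / (Cmod c + 1))) as [T0 H0].
{ apply Rdiv_lt_0_compat; lra. }
exists (Rmax T0 0); intros T HT.
specialize (H0 T (Rle_trans _ _ _ (Rmax_l _ _) HT)); pose proof (Rle_trans _ _ _ (Rmax_r _ _) HT).
rewrite Cint_scal by (try lra; intros; apply Hf).
replace (c * Cint f (- T) T - c * line_integral f) with (c * (Cint f (- T) T - line_integral f)) by ring.
rewrite Cmod_mult.
apply Rle_trans with ((Cmod c + 1) * (e / (Cmod c + 1)))%R; [|right; field; lra].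
apply Rmult_le_compat; try apply Cmod_ge_0; lra.
Qed.

Lemma line_integral_plus f g M N : dominated f M -> dominated g N ->
  line_integral (fun u => f u + g u) = line_integral f + line_integral g.
Proof.
intros Hf Hg; apply (line_integral_unique _ _ _ (dominated_plus f g M N Hf Hg)).
intros e He.
destruct (line_integral_spec f M Hf (e / 2) ltac:(lra)) as [T1 H1].
destruct (line_integral_spec g N Hg (e / 2) ltac:(lra)) as [T2 H2].
exists (Rmax (Rmax T1 T2) 0); intros T HT.
pose proof (Rle_trans _ _ _ (Rmax_l _ _) HT) as HT12; pose proof (Rle_trans _ _ _ (Rmax_r _ _) HT).
specialize (H1 T (Rle_trans _ _ _ (Rmax_l _ _) HT12)).
specialize (H2 T (Rle_trans _ _ _ (Rmax_r _ _) HT12)).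
rewrite Cint_plus by (try lra; intros; first [apply Hf|apply Hg]).
replace (Cint f (- T) T + Cint g (- T) T - (line_integral f + line_integral g))
  with ((Cint f (- T) T - line_integral f) + (Cint g (- T) T - line_integral g)) by ring.
eapply Rle_trans; [apply Cmod_triangle|lra].
Qed.

Lemma line_integral_derive f F M l : dominated f M -> (forall u, der RtoC F u (f u)) ->
  (forall e, (0 < e)%R -> exists T0, forall T, (T0 <= T)%R -> (Cmod (F T - F (- T)%R - l) <= e)%R) ->
  line_integral f = l.
Proof.
intros Hf HF H; apply (line_integral_unique f M l Hf).
intros e He; destruct (H e He) as [T0 HT0]; exists (Rmax T0 0); intros T HT.
pose proof (Rle_trans _ _ _ (Rmax_r _ _) HT).
rewrite (Cint_derive (- T) T ltac:(lra) f F); [|intros; apply Hf|intros; apply HF].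
apply HT0, (Rle_trans _ _ _ (Rmax_l _ _) HT).
Qed.

(** * The Gaussian and its Cauchy transform *)

Definition gauss (u : R) : C := RtoC (exp (- u ^ 2)).

Lemma gauss_Cexp u : gauss u = Cexp (- (u * u)).
Proof.
unfold gauss; rewrite <- Cexp_RtoC; f_equal.
rewrite RtoC_opp, RtoC_pow; simpl; ring.
Qed.

Lemma der_gauss u : der RtoC gauss u (- (2 * u) * gauss u).
Proof.
apply (der_ext RtoC (fun u => Cexp (- (u * u)))); [intros; now rewrite gauss_Cexp|].
eapply der_eq; [|apply der_Cexp, der_opp, der_mult; apply der_id].
rewrite gauss_Cexp; ring.
Qed.

Lemma gauss_dominated : dominated gauss 1.
Proof.
split; [intros; eapply der_cont, der_gauss|].
intros u; unfold gauss; rewrite Cmod_R, Rabs_pos_eq by (left; apply exp_pos).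
replace (u ^ 2)%R with (u * u)%R by ring.
rewrite exp_Ropp, Rmult_1_l; apply Rinv_le_contravar; [nra|apply exp_ineq1_le].
Qed.

Lemma dominated_times_bounded f g M B : dominated f M ->
  (forall u, cont RtoC g u) -> (forall u, (Cmod (g u) <= B)%R) ->
  dominated (fun u => f u * g u) (B * M).
Proof.
intros [H1 H2] H3 H4; split; [intros; now apply cont_mult|].
intros u; rewrite Cmod_mult, Rmult_comm, Rmult_assoc.
apply Rmult_le_compat; try apply Cmod_ge_0; auto.
Qed.

Lemma pole_distance (zeta : C) (u : R) : (Rabs (Im zeta) <= Cmod (u - zeta))%R.
Proof.
eapply Rle_trans; [|apply im_le_Cmod].
replace (Im (u - zeta)) with (- Im zeta)%R by (destruct zeta; simpl; ring).
rewrite Rabs_Ropp; lra.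
Qed.

Lemma pole_neq (zeta : C) (u : R) : Im zeta <> 0%R -> u - zeta <> 0.
Proof.
intros H E; pose proof (pole_distance zeta u) as K; rewrite E, Cmod_0 in K.
apply Rabs_pos_lt in H; lra.
Qed.

Lemma pole_cont (zeta : C) (u : R) : Im zeta <> 0%R -> cont RtoC (fun u => / (u - zeta)) u.
Proof.
intros H; apply cont_inv; [now apply pole_neq|apply cont_minus; [apply cont_id|apply cont_const]].
Qed.

Lemma pole_bound (zeta : C) (u : R) : Im zeta <> 0%R -> (Cmod (/ (u - zeta)) <= / Rabs (Im zeta))%R.
Proof.
intros H; rewrite Cmod_inv by now apply pole_neq.
apply Rinv_le_contravar; [now apply Rabs_pos_lt|apply pole_distance].
Qed.

Definition gauss_pole (zeta : C) (u : R) : C := gauss u * / (u - zeta).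

Lemma gauss_pole_dominated zeta : Im zeta <> 0%R ->
  dominated (gauss_pole zeta) (/ Rabs (Im zeta) * 1).
Proof.
intros H; apply dominated_times_bounded; [apply gauss_dominated|intros; now apply pole_cont|].
intros; now apply pole_bound.
Qed.

Lemma h_eq zeta : h zeta = / (2 * PI * Ci) * line_integral (gauss_pole zeta).
Proof. reflexivity. Qed.

Lemma Cmod_two_pi_i : (Cmod (/ (2 * PI * Ci)) <= / 4)%R.
Proof.
rewrite Cmod_inv by apply two_pi_i_neq_0.
rewrite !Cmod_mult, Cmod_Ci, !Cmod_R, !Rabs_pos_eq by (try lra; left; apply PI_RGT_0).
pose proof PI2_3_2; apply Rinv_le_contravar; lra.
Qed.

Lemma h_bound zeta : Im zeta <> 0%R -> (Cmod (h zeta) <= / Rabs (Im zeta))%R.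
Proof.
intros H; rewrite h_eq, Cmod_mult.
pose proof (line_integral_bound _ _ (gauss_pole_dominated zeta H)) as B.
replace (/ Rabs (Im zeta))%R with (/ 4 * (4 * (/ Rabs (Im zeta) * 1)))%R by lra.
apply Rmult_le_compat; try apply Cmod_ge_0; [apply Cmod_two_pi_i|easy].
Qed.

Definition gauss_total : C := line_integral gauss.

(** Integrate the derivative of e^{-u^2}/(u - zeta) over the line, with u in the numerator written
    as (u - zeta) + zeta. *)
Lemma gauss_double_pole zeta : Im zeta <> 0%R ->
  dominated (fun u => gauss_pole zeta u * / (u - zeta)) (/ Rabs (Im zeta) * (/ Rabs (Im zeta) * 1)) /\
  line_integral (fun u => gauss_pole zeta u * / (u - zeta))
  = - (2 * gauss_total + 2 * zeta * line_integral (gauss_pole zeta)).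
Proof.
intros H.
assert (D2 : dominated (fun u => gauss_pole zeta u * / (u - zeta)) (/ Rabs (Im zeta) * (/ Rabs (Im zeta) * 1))).
{ apply dominated_times_bounded; [now apply gauss_pole_dominated|intros; now apply pole_cont|].
  intros; now apply pole_bound. }
split; [easy|].
pose proof (gauss_pole_dominated zeta H) as D1.
pose proof gauss_dominated as D0.
pose proof (dominated_scal 2 _ _ D0) as D0'.
pose proof (dominated_scal (2 * zeta) _ _ D1) as D1'.
pose proof (dominated_plus _ _ _ _ D0' D1') as D01.
pose proof (dominated_plus _ _ _ _ D01 D2) as D.
assert (E : line_integral (fun u => 2 * gauss u + 2 * zeta * gauss_pole zeta u
     + gauss_pole zeta u * / (u - zeta)) = 0).
{ apply (line_integral_derive _ (fun u => - gauss_pole zeta u) _ _ D).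
  - intros u; pose proof (pole_neq zeta u H).
    eapply der_eq; [|apply der_opp, der_mult; [apply der_gauss|apply der_inv; [easy|
      apply der_minus; [apply der_id|apply der_const]]]].
    unfold gauss_pole; cbv beta; field; auto.
  - intros e He.
    assert (He' : (0 < / Rabs (Im zeta))%R) by now apply Rinv_0_lt_compat, Rabs_pos_lt.
    set (c := (/ Rabs (Im zeta))%R) in *.
    exists (1 + 2 * c / e)%R; intros T HT.
    assert (Hc : (0 <= 2 * c / e)%R) by (apply Rmult_le_pos; [lra|left; now apply Rinv_0_lt_compat]).
    assert (HTe : (2 * c <= T * e)%R).
    { apply Rle_trans with ((1 + 2 * c / e) * e)%R; [|apply Rmult_le_compat_r; lra].
      replace ((1 + 2 * c / e) * e)%R with (e + 2 * c)%R by (field; lra); lra. }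
    replace (- gauss_pole zeta T - - gauss_pole zeta (- T)%R - 0)
      with (gauss_pole zeta (- T)%R + - gauss_pole zeta T) by ring.
    eapply Rle_trans; [apply Cmod_triangle|]; rewrite Cmod_opp.
    pose proof (proj2 D1 T) as B1; pose proof (proj2 D1 (- T)%R) as B2; fold c in B1, B2.
    replace (- T * - T)%R with (T * T)%R in B2 by ring.
    apply Rle_trans with (2 * c * / (1 + T * T))%R; [lra|].
    apply Rmult_le_reg_r with (1 + T * T)%R; [nra|].
    rewrite Rmult_assoc, Rinv_l by nra; nra. }
rewrite (line_integral_plus _ _ _ _ D01 D2), (line_integral_plus _ _ _ _ D0' D1') in E.
rewrite (line_integral_scal 2 _ _ D0), (line_integral_scal (2 * zeta) _ _ D1) in E.
fold gauss_total in E.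
apply Ceq_minus; rewrite <- E; ring.
Qed.

(** The Gaussian integral is left as the unknown [gauss_total]; its value is deduced from this very
    equation. *)
Lemma der_h_aux zeta : Im zeta <> 0%R ->
  der Cid h zeta (- (2 * zeta) * h zeta - 2 * gauss_total / (2 * PI * Ci)).
Proof.
intros H; destruct (gauss_double_pole zeta H) as [D2 E2].
pose proof (gauss_pole_dominated zeta H) as D1.
set (c := / (2 * PI * Ci)).
apply (der_eq Cid h zeta (c * line_integral (fun u => gauss_pole zeta u * / (u - zeta)))).
{ rewrite E2, h_eq; unfold c, Cdiv; ring. }
set (eta := Rabs (Im zeta)) in *.
assert (Heta : (0 < eta)%R) by now apply Rabs_pos_lt.
intros e He.
set (K := (4 * (/ (eta / 2) * (/ eta * (/ eta * 1))))%R).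
assert (HK : (0 < K)%R).
{ unfold K; repeat apply Rmult_lt_0_compat; try apply Rinv_0_lt_compat; lra. }
exists (Rmin (eta / 2) (e / K)); split.
{ apply Rmin_pos; [lra|now apply Rdiv_lt_0_compat]. }
intros w Hw.
assert (H1 : (Cmod (w - zeta) < eta / 2)%R) by (eapply Rlt_le_trans; [exact Hw|apply Rmin_l]).
assert (H2 : (Cmod (w - zeta) < e / K)%R) by (eapply Rlt_le_trans; [exact Hw|apply Rmin_r]).
assert (Hw2 : (eta / 2 <= Rabs (Im w))%R).
{ pose proof (im_le_Cmod (w - zeta)) as I.
  replace (Im (w - zeta)) with (Im w - Im zeta)%R in I by (destruct w, zeta; simpl; ring).
  pose proof (Rabs_triang_inv (Im zeta) (Im w)) as T; rewrite Rabs_minus_sym in T.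
  unfold eta in *; lra. }
assert (Hw0 : Im w <> 0%R) by (intros Z; rewrite Z, Rabs_R0 in Hw2; lra).
pose proof (gauss_pole_dominated w Hw0) as Dw.
assert (D3 : dominated (fun u => gauss_pole zeta u * / (u - zeta) * / (u - w))
    (/ (eta / 2) * (/ eta * (/ eta * 1)))).
{ apply dominated_times_bounded; [easy|intros; now apply pole_cont|].
  intros u; eapply Rle_trans; [now apply pole_bound|apply Rinv_le_contravar; lra]. }
set (I3 := line_integral (fun u => gauss_pole zeta u * / (u - zeta) * / (u - w))).
set (I2 := line_integral (fun u => gauss_pole zeta u * / (u - zeta))).
(* Second order expansion of the kernel, as for the winding number; I3 is bounded uniformly for w
   near zeta. *)
assert (E : line_integral (gauss_pole w)
  = line_integral (gauss_pole zeta) + (w - zeta) * I2 + (w - zeta) * (w - zeta) * I3).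
{ unfold I2, I3.
  rewrite <- (line_integral_scal (w - zeta) _ _ D2), <- (line_integral_scal ((w - zeta) * (w - zeta)) _ _ D3).
  rewrite <- (line_integral_plus _ _ _ _ D1 (dominated_scal _ _ _ D2)).
  rewrite <- (line_integral_plus _ _ _ _ (dominated_plus _ _ _ _ D1 (dominated_scal _ _ _ D2))
     (dominated_scal _ _ _ D3)).
  f_equal; apply FunctionalExtensionality.functional_extensionality; intros u.
  pose proof (pole_neq zeta u H); pose proof (pole_neq w u Hw0).
  unfold gauss_pole; field; auto. }
rewrite !h_eq, E; fold c.
replace (c * (line_integral (gauss_pole zeta) + (w - zeta) * I2 + (w - zeta) * (w - zeta) * I3) -
  c * line_integral (gauss_pole zeta) - (w - zeta) * (c * I2))
  with ((w - zeta) * ((w - zeta) * (c * I3))) by ring.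
rewrite 2 Cmod_mult, (Rmult_comm e).
apply Rmult_le_compat_l; [apply Cmod_ge_0|].
apply Rle_trans with (e / K * K)%R; [|right; field; lra].
apply Rmult_le_compat; try apply Cmod_ge_0; [lra|].
rewrite Cmod_mult; apply Rle_trans with (1 * K)%R; [|lra].
apply Rmult_le_compat; try apply Cmod_ge_0.
- pose proof Cmod_two_pi_i; fold c in H0; lra.
- apply line_integral_bound, D3.
Qed.

(** * The jump of h and the value of the Gaussian integral *)

Definition poisson_kernel (x u : R) : R := (x * / (u * u + x * x))%R.

Lemma poisson_kernel_split (x u : R) : (0 < x)%R ->
  2 * Ci * poisson_kernel x u = / (u - Ci * x) - / (u - - Ci * x).
Proof.
intros Hx; unfold poisson_kernel.
assert (Hq : (0 < u * u + x * x)%R) by nra.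
assert (Hq' : RtoC (u * u + x * x) <> 0) by (intros E; apply RtoC_inj in E; lra).
assert (H1 : u - Ci * x <> 0) by (intros E; apply (f_equal Im) in E; simpl in E; lra).
assert (H2 : u - - Ci * x <> 0) by (intros E; apply (f_equal Im) in E; simpl in E; lra).
rewrite RtoC_mult, RtoC_inv by lra.
assert (E : RtoC (u * u + x * x) = (u - Ci * x) * (u - - Ci * x)).
{ rewrite RtoC_plus, !RtoC_mult.
  apply injective_projections; simpl; ring. }
rewrite E; field; auto.
Qed.

Lemma poisson_dominated x : (0 < x)%R ->
  dominated (fun u => RtoC (poisson_kernel x u)) (x + / x).
Proof.
intros Hx; split.
- intros u.
  apply (cont_ext RtoC (fun u => / (2 * Ci) * (/ (u - Ci * x) - / (u - - Ci * x)))).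
  { intros s; rewrite <- poisson_kernel_split by easy; field.
    intros E; apply (f_equal Im) in E; simpl in E; lra. }
  apply cont_mult; [apply cont_const|].
  apply cont_minus; apply pole_cont; simpl; lra.
- intros u; unfold poisson_kernel.
  assert (Hq : (0 < u * u + x * x)%R) by nra.
  rewrite Cmod_R, Rabs_pos_eq by (apply Rmult_le_pos; [lra|left; now apply Rinv_0_lt_compat]).
  apply Rmult_le_reg_r with ((u * u + x * x) * (1 + u * u))%R; [apply Rmult_lt_0_compat; nra|].
  replace (x * / (u * u + x * x) * ((u * u + x * x) * (1 + u * u)))%R with (x * (1 + u * u))%R
    by (field; nra).
  replace ((x + / x) * / (1 + u * u) * ((u * u + x * x) * (1 + u * u)))%R
    with (x * (u * u) + x * (x * x) + u * u * / x + x)%R by (field; nra).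
  pose proof (Rinv_0_lt_compat x Hx).
  assert (0 <= u * u * / x)%R by (apply Rmult_le_pos; nra).
  assert (0 <= x * (x * x))%R by (repeat apply Rmult_le_pos; lra). lra.
Qed.

Lemma der_RtoC (v : R -> R) t a : is_derive v t a -> der RtoC (fun s => RtoC (v s)) t (RtoC a).
Proof. intros H; apply der_pair; [exact H|auto_derive; easy]. Qed.

Lemma poisson_integral x : (0 < x)%R ->
  line_integral (fun u => RtoC (poisson_kernel x u)) = PI.
Proof.
intros Hx.
apply (line_integral_derive _ (fun u => RtoC (atan (u / x))) _ _ (poisson_dominated x Hx)).
- intros u; apply der_RtoC; unfold poisson_kernel.
  auto_derive; [easy|]; field; split; nra.
- intros e He.
  destruct (atan_tail 2 e ltac:(lra) He) as (T & HT & Hlt).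
  exists (T * x)%R; intros S HS.
  replace (- S / x)%R with (- (S / x))%R by (field; lra).
  rewrite atan_opp, <- !RtoC_minus, Cmod_R.
  assert (HSx : (T <= S / x)%R).
  { apply Rmult_le_reg_r with x; [easy|]; unfold Rdiv; rewrite Rmult_assoc, Rinv_l by lra; lra. }
  assert (atan T <= atan (S / x))%R.
  { destruct (Rle_lt_or_eq_dec _ _ HSx) as [L| E]; [left; now apply atan_increasing|rewrite E; lra]. }
  pose proof (atan_bound (S / x)).
  rewrite Rabs_left1; lra.
Qed.

(** The difference is the Poisson integral of the Gaussian at height x. Since the kernel has mass
    pi, subtracting 1 leaves the integral of the kernel against e^{-u^2} - 1, which vanishes to
    second order at 0. *)
Lemma h_jump x : (0 < x)%R -> (Cmod (h (Ci * x) - h (- Ci * x) - 1) <= 8 * x)%R.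
Proof.
intros Hx.
assert (I1 : Im (Ci * x) <> 0%R) by (simpl; lra).
assert (I2 : Im (- Ci * x) <> 0%R) by (simpl; lra).
assert (Cpi : RtoC PI <> 0) by (intros E; apply RtoC_inj in E; pose proof PI_RGT_0; lra).
assert (Ck : forall u, cont RtoC (fun u => RtoC (poisson_kernel x u)) u) by apply (poisson_dominated x Hx).
set (f := fun u => RtoC (poisson_kernel x u) * (gauss u - 1)).
assert (Df : dominated f (2 * x)).
{ split.
  - intros u; apply cont_mult; [apply Ck|apply cont_minus; [apply gauss_dominated|apply cont_const]].
  - intros u; unfold f, gauss, poisson_kernel.
    assert (Hq : (0 < u * u + x * x)%R) by nra.
    rewrite <- RtoC_minus, <- RtoC_mult, Cmod_R, Rabs_mult.
    rewrite (Rabs_pos_eq (x * _)) by (apply Rmult_le_pos; [lra|left; now apply Rinv_0_lt_compat]).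
    replace (u ^ 2)%R with (u * u)%R by ring.
    (* Both 1 - e^{-u^2} <= 1 and 1 - e^{-u^2} <= u^2 are used: multiplied by 1 + u^2 the difference
       is at most 2 u^2. *)
    assert (H1 : (Rabs (exp (- (u * u)) - 1) <= 1 - exp (- (u * u)))%R).
    { rewrite Rabs_left1; [lra|].
      assert (exp (- (u * u)) <= exp 0)%R; [|rewrite exp_0 in *; lra].
      destruct (Req_dec u 0) as [->|]; [right; f_equal; ring|left; apply exp_increasing; nra]. }
    pose proof (exp_ineq1_le (- (u * u))) as H2; pose proof (exp_pos (- (u * u))) as H3.
    rewrite Rmult_assoc, (Rmult_comm 2), Rmult_assoc; apply Rmult_le_compat_l; [lra|].
    apply Rmult_le_reg_r with ((u * u + x * x) * (1 + u * u))%R; [apply Rmult_lt_0_compat; nra|].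
    replace (/ (u * u + x * x) * Rabs (exp (- (u * u)) - 1) * ((u * u + x * x) * (1 + u * u)))%R
      with (Rabs (exp (- (u * u)) - 1) * (1 + u * u))%R by (field; nra).
    replace (2 * / (1 + u * u) * ((u * u + x * x) * (1 + u * u)))%R with (2 * (u * u) + 2 * (x * x))%R
      by (field; nra).
    pose proof (Rabs_pos (exp (- (u * u)) - 1)); nra. }
assert (E : h (Ci * x) - h (- Ci * x) = / PI * (line_integral f + PI)).
{ rewrite <- (poisson_integral x Hx) at 2.
  rewrite <- (line_integral_plus _ _ _ _ Df (poisson_dominated x Hx)).
  pose proof (gauss_pole_dominated _ I1) as D1.
  pose proof (gauss_pole_dominated _ I2) as D2.
  pose proof (dominated_scal (-1) _ _ D2) as D2'.
  rewrite !h_eq.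
  transitivity (/ (2 * PI * Ci) * (line_integral (gauss_pole (Ci * x))
       + line_integral (fun u => -1 * gauss_pole (- Ci * x) u))).
  { rewrite (line_integral_scal (-1) _ _ D2); ring. }
  rewrite <- (line_integral_plus _ _ _ _ D1 D2').
  assert (D3 : dominated (fun u => f u + poisson_kernel x u) (2 * x + (x + / x)))
    by (apply dominated_plus; [easy|now apply poisson_dominated]).
  transitivity (/ (2 * PI * Ci) * line_integral (fun u => 2 * Ci * (f u + poisson_kernel x u))).
  - f_equal; f_equal; apply FunctionalExtensionality.functional_extensionality; intros u.
    unfold f, gauss_pole.
    transitivity (gauss u * (2 * Ci * poisson_kernel x u)); [|ring].
    rewrite poisson_kernel_split by easy; ring.
  - rewrite (line_integral_scal (2 * Ci) _ _ D3).
    cbv beta; pose proof Ci_nz; field; auto. }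
rewrite E.
replace (/ PI * (line_integral f + PI) - 1) with (/ PI * line_integral f) by (field; auto).
rewrite Cmod_mult, Cmod_inv, Cmod_R, Rabs_pos_eq by (try easy; left; apply PI_RGT_0).
pose proof (line_integral_bound f _ Df) as B.
replace (8 * x)%R with (1 * (4 * (2 * x)))%R by ring.
pose proof PI2_3_2.
apply Rmult_le_compat; [left; apply Rinv_0_lt_compat; lra|apply Cmod_ge_0| |easy].
rewrite <- Rinv_1; apply Rinv_le_contravar; lra.
Qed.

(* [h (i x) - h (- i x)] falls from 1 at [x = 0+] to 0 at infinity, and its derivative is a
   multiple of [gauss_total]: this is where the value of the Gaussian integral comes from. *)
Lemma gauss_total_eq : gauss_total = RtoC (sqrt PI).
Proof.
assert (Cpi : RtoC PI <> 0) by (intros E; apply RtoC_inj in E; pose proof PI_RGT_0; lra).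
pose proof Ci_nz as HCi.
set (G := gauss_total).
assert (Cg : forall u, cont RtoC gauss u) by apply gauss_dominated.
set (e := fun x => Cint gauss 0 x).
set (k := fun x : R => h (Ci * x) - h (- Ci * x)).
(* A first integral of the equation for the jump k. Letting x tend to 0 gives V = 1; letting x tend
   to infinity, where k vanishes and e tends to G / 2, gives G^2 = pi. *)
set (V := fun x : R => k x * gauss x + 2 * G / PI * e x).
assert (HV : forall x, (0 < x)%R -> der RtoC V x 0).
{ intros x Hx.
  assert (I1 : Im (Ci * x) <> 0%R) by (simpl; lra).
  assert (I2 : Im (- Ci * x) <> 0%R) by (simpl; lra).
  assert (Hk : der RtoC k x ((- (2 * (Ci * x)) * h (Ci * x) - 2 * G / (2 * PI * Ci)) * Ci
     - (- (2 * (- Ci * x)) * h (- Ci * x) - 2 * G / (2 * PI * Ci)) * - Ci)).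
  { apply der_minus.
    - apply (der_comp RtoC h (fun x : R => Ci * x)); [now apply der_h_aux|].
      eapply der_eq; [|apply der_scal, der_id]; ring.
    - apply (der_comp RtoC h (fun x : R => - Ci * x)); [now apply der_h_aux|].
      eapply der_eq; [|apply der_scal, der_id]; ring. }
  eapply der_eq; [|apply der_plus; [apply der_mult; [exact Hk|apply der_gauss]|
     apply der_scal, Cint_der, Cg]].
  unfold k.
  assert (Hi2 : Ci * Ci = -1) by (apply injective_projections; simpl; ring).
  transitivity (2 * (Ci * Ci + 1) * x * gauss x * (- h (Ci * x) + h (- Ci * x))).
  - field; auto.
  - rewrite Hi2; ring. }
assert (Vconst : forall x y, (0 < x)%R -> (x <= y)%R -> V y = V x).
{ intros x y Hx Hxy.
  pose proof (mean_value_le V (fun _ => 0) (fun _ => 0%R) (fun _ => 0%R) x y Hxy) as M.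
  apply Ceq_minus, Cmod_eq_0, Rle_antisym; [|apply Cmod_ge_0].
  rewrite Rminus_diag in M; apply M; intros; [apply HV; lra| |rewrite Cmod_0; lra].
  auto_derive; easy. }
assert (He : forall x, (0 <= x)%R -> (Cmod (e x) <= x)%R).
{ intros x Hx; unfold e; eapply Rle_trans; [apply (Cint_bound 0 x Hx gauss 1)|lra].
  - intros; apply Cg.
  - intros t _; eapply Rle_trans; [apply gauss_dominated|].
    rewrite Rmult_1_l, <- Rinv_1; apply Rinv_le_contravar; nra. }
set (B := Cmod (2 * G / PI)).
assert (HB : (0 <= B)%R) by apply Cmod_ge_0.
assert (Vone : forall x, (0 < x)%R -> V x = 1).
{ intros x Hx.
  apply Ceq_minus, Cmod_eq_0, Rle_antisym; [|apply Cmod_ge_0]; apply Rnot_lt_le; intros Hp.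
  set (d := Cmod (V x - 1)) in *.
  set (y := Rmin (Rmin x 1) (d / (2 * (17 + B)))).
  assert (Hy : (0 < y)%R).
  { repeat apply Rmin_pos; try lra; apply Rdiv_lt_0_compat; lra. }
  assert (Hy1 : (y <= Rmin x 1)%R) by apply Rmin_l.
  pose proof (Rmin_l x 1); pose proof (Rmin_r x 1).
  assert (Hy2 : (y * (17 + B) <= d / 2)%R).
  { apply Rle_trans with (d / (2 * (17 + B)) * (17 + B))%R.
    - apply Rmult_le_compat_r; [lra|apply Rmin_r].
    - right; field; lra. }
  assert (E : V x - 1 = (k y - 1) * gauss y + (gauss y - 1) + 2 * G / PI * e y).
  { rewrite (Vconst y x Hy ltac:(lra)); unfold V; ring. }
  assert (Hd : (d <= 8 * y * 1 + y + B * y)%R).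
  { unfold d; rewrite E.
    eapply Rle_trans; [apply Cmod_triangle|]; apply Rplus_le_compat.
    - eapply Rle_trans; [apply Cmod_triangle|]; apply Rplus_le_compat.
      + rewrite Cmod_mult; apply Rmult_le_compat; try apply Cmod_ge_0; [exact (h_jump y Hy)|].
        eapply Rle_trans; [apply gauss_dominated|].
        rewrite Rmult_1_l, <- Rinv_1; apply Rinv_le_contravar; nra.
      + unfold gauss; rewrite <- RtoC_minus, Cmod_R.
        replace (y ^ 2)%R with (y * y)%R by ring.
        pose proof (exp_ineq1_le (- (y * y))).
        assert (exp (- (y * y)) < exp 0)%R by (apply exp_increasing; nra).
        rewrite exp_0 in *; rewrite Rabs_left1; nra.
    - rewrite Cmod_mult; apply Rmult_le_compat_l; [easy|apply He; lra]. }
  lra. }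
assert (Half : forall T, (0 <= T)%R -> Cint gauss (- T) T = 2 * e T).
{ intros T HT.
  assert (Eneg : Cint gauss (- T) 0 = e T).
  { rewrite (Cint_derive (- T) 0 ltac:(lra) gauss (fun x => - e (- x)%R)).
    - replace (- - T)%R with T by ring; replace (- 0)%R with 0%R by ring.
      replace (e 0%R) with (RtoC 0)
        by (symmetry; exact (RInt_point (V := C_R_CompleteNormedModule) 0 gauss)); ring.
    - intros; apply Cg.
    - intros t _.
      eapply der_eq; [|apply der_opp].
      2:{ apply der_of_is_derive.
          apply (is_derive_comp (K := R_AbsRing) (V := C_R_NormedModule) e (fun x => - x)%R t (gauss (- t)%R) (-1)).
          - apply is_derive_of_der, Cint_der, Cg.
          - auto_derive; [easy|ring]. }
      unfold gauss; replace ((- t) ^ 2)%R with (t ^ 2)%R by ring.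
      rewrite scal_R_Cmult; ring. }
  rewrite <- (Cint_Chasles gauss (- T) 0 T Cg), Eneg; unfold e; ring. }
assert (Gsq : G * G = PI).
{ apply Ceq_minus, Cmod_eq_0, Rle_antisym; [|apply Cmod_ge_0]; apply Rnot_lt_le; intros Hp.
  set (d := Cmod (G * G - PI)) in *.
  set (c := (2 * PI + Cmod G + 1)%R).
  pose proof PI_RGT_0; pose proof (Cmod_ge_0 G).
  assert (Hc : (0 < c)%R) by (unfold c; lra).
  destruct (line_integral_spec gauss 1 gauss_dominated (d / (2 * c))) as [T0 HT0].
  { apply Rdiv_lt_0_compat; lra. }
  set (T := (Rmax T0 (2 * c / d + 1))%R).
  pose proof (Rmax_l T0 (2 * c / d + 1)); pose proof (Rmax_r T0 (2 * c / d + 1)).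
  fold T in H1, H2.
  assert (Hcd : (0 < 2 * c / d)%R) by (apply Rdiv_lt_0_compat; lra).
  assert (HT : (0 < T)%R) by lra.
  specialize (HT0 T H1); fold gauss_total G in HT0; rewrite Half in HT0 by lra.
  pose proof (Vone T HT) as E1; unfold V in E1.
  assert (E : G * G - PI = - (PI * (k T * gauss T)) - G * (2 * e T - G)).
  { replace (RtoC PI) with (RtoC PI * 1) at 1 by ring; rewrite <- E1; field; auto. }
  assert (Hk : (Cmod (k T) <= 2 * / T)%R).
  { unfold k, Cminus; eapply Rle_trans; [apply Cmod_triangle|]; rewrite Cmod_opp.
    assert (I1 : Im (Ci * T) = T) by (simpl; ring).
    assert (I2 : Im (- Ci * T) = (- T)%R) by (simpl; ring).
    pose proof (h_bound (Ci * T) ltac:(rewrite I1; lra)) as B1.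
    pose proof (h_bound (- Ci * T) ltac:(rewrite I2; lra)) as B2.
    rewrite I1, Rabs_pos_eq in B1 by lra; rewrite I2, Rabs_Ropp, Rabs_pos_eq in B2 by lra; lra. }
  assert (Hg : (Cmod (gauss T) <= 1)%R).
  { eapply Rle_trans; [apply gauss_dominated|].
    rewrite Rmult_1_l, <- Rinv_1; apply Rinv_le_contravar; nra. }
  assert (HiT : (/ T <= d / (2 * c))%R).
  { replace (d / (2 * c))%R with (/ (2 * c / d))%R by (field; lra); apply Rinv_le_contravar; lra. }
  assert (Hd : (d <= PI * (2 * (d / (2 * c)) * 1) + Cmod G * (d / (2 * c)))%R).
  { unfold d at 1; rewrite E; unfold Cminus; eapply Rle_trans; [apply Cmod_triangle|].
    fold (Cminus (2 * e T) G).
    rewrite !Cmod_opp, !Cmod_mult, Cmod_R, Rabs_pos_eq by lra.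
    apply Rplus_le_compat; apply Rmult_le_compat_l; try lra.
    apply Rmult_le_compat; try apply Cmod_ge_0; lra. }
  assert (Ed : (d = 2 * c * (d / (2 * c)))%R) by (field; lra).
  assert (0 < d / (2 * c))%R by (apply Rdiv_lt_0_compat; lra).
  unfold c in *; nra. }
(* Selects the root of G^2 = pi. *)
assert (Gre : (0 <= Re G)%R).
{ apply Rnot_lt_le; intros L.
  destruct (line_integral_spec gauss 1 gauss_dominated (- Re G)) as [T0 HT0]; [lra|].
  pose proof (HT0 (Rmax T0 1) (Rmax_l _ _)) as H; fold gauss_total G in H.
  set (T := Rmax T0 1) in *; assert (HT : (1 <= T)%R) by apply Rmax_r.
  rewrite Half in H by lra.
  assert (P : (0 <= Re (e T))%R).
  { destruct (MVT_gen (fun x => Re (e x)) 0 T (fun x => Re (gauss x))) as (c & Hc & E).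
    - intros; apply (der_Re_Im e), Cint_der, Cg.
    - intros; apply cont_Re; eapply der_cont, Cint_der, Cg.
    - replace (e 0%R) with (RtoC 0) in E
        by (symmetry; exact (RInt_point (V := C_R_CompleteNormedModule) 0 gauss)).
      unfold gauss in E; rewrite !re_RtoC in E; pose proof (exp_pos (- c ^ 2)); nra. }
  pose proof (Re_le_Cmod (2 * e T - G)) as Q.
  replace (Re (2 * e T - G)) with (2 * Re (e T) - Re G)%R in Q by (unfold Re; simpl; ring).
  lra. }
assert (Hfac : (G - sqrt PI) * (G + sqrt PI) = 0).
{ transitivity (G * G - sqrt PI * sqrt PI); [ring|].
  rewrite Gsq, <- RtoC_mult, sqrt_sqrt by (left; apply PI_RGT_0); ring. }
destruct (Ceq_dec (G - sqrt PI) 0) as [E|N]; [now apply Ceq_minus|].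
exfalso.
assert (E : G + sqrt PI = 0).
{ replace (G + sqrt PI) with (/ (G - sqrt PI) * ((G - sqrt PI) * (G + sqrt PI))) by (field; auto).
  rewrite Hfac; ring. }
assert (E' : (Re G + sqrt PI = 0)%R) by (change (Re (G + RtoC (sqrt PI)) = 0%R); now rewrite E).
pose proof (sqrt_lt_R0 PI PI_RGT_0); lra.
Qed.

Lemma der_h zeta : Im zeta <> 0%R ->
  der Cid h zeta (- (2 * zeta) * h zeta + Ci / sqrt PI).
Proof.
intros H; eapply der_eq; [|now apply der_h_aux].
assert (Hs : RtoC (sqrt PI) <> 0).
{ intros E; apply RtoC_inj in E; pose proof (sqrt_lt_R0 PI PI_RGT_0); lra. }
pose proof Ci_nz as HCi.
assert (Hp : RtoC PI = sqrt PI * sqrt PI) by (rewrite <- RtoC_mult, sqrt_sqrt by (left; apply PI_RGT_0); easy).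
rewrite gauss_total_eq, Hp.
assert (Hi2 : Ci * Ci = -1) by (apply injective_projections; simpl; ring).
transitivity (- (2 * zeta) * h zeta + (-1) / (Ci * sqrt PI)); [field; auto|].
rewrite <- Hi2; field; auto.
Qed.

(** * Complex power series with real coefficients *)

Definition seq_lim (u : nat -> C) (l : C) : Prop :=
  forall e, (0 < e)%R -> exists N0, forall N, (N0 <= N)%nat -> (Cmod (u N - l) < e)%R.

Lemma seq_lim_bound u l B : seq_lim u l -> (forall N, (Cmod (u N) <= B)%R) -> (Cmod l <= B)%R.
Proof.
intros H HB; apply Rnot_lt_le; intros L.
destruct (H (Cmod l - B)%R ltac:(lra)) as [N0 HN]; specialize (HN N0 (Nat.le_refl _)).
specialize (HB N0); rewrite Cmod_sym in HN; pose proof (Cmod_le_sub l (u N0)); lra.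
Qed.

Lemma seq_lim_ext u v l : (forall n, u n = v n) -> seq_lim u l -> seq_lim v l.
Proof. intros E H e He; destruct (H e He) as [N0 HN]; exists N0; intros; rewrite <- E; auto. Qed.

Lemma seq_lim_plus u v l m : seq_lim u l -> seq_lim v m -> seq_lim (fun n => u n + v n) (l + m).
Proof.
intros Hu Hv e He.
destruct (Hu (e / 2)%R ltac:(lra)) as [N1 H1]; destruct (Hv (e / 2)%R ltac:(lra)) as [N2 H2].
exists (max N1 N2); intros N HN.
replace (u N + v N - (l + m)) with ((u N - l) + (v N - m)) by ring.
eapply Rle_lt_trans; [apply Cmod_triangle|].
specialize (H1 N ltac:(lia)); specialize (H2 N ltac:(lia)); lra.
Qed.

Lemma seq_lim_scal c u l : seq_lim u l -> seq_lim (fun n => c * u n) (c * l).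
Proof.
intros Hu e He; pose proof (Cmod_ge_0 c).
destruct (Hu (e / (Cmod c + 1))%R) as [N0 HN]; [apply Rdiv_lt_0_compat; lra|].
exists N0; intros N H1; specialize (HN N H1).
replace (c * u N - c * l) with (c * (u N - l)) by ring; rewrite Cmod_mult.
assert (E : ((Cmod c + 1) * (e / (Cmod c + 1)) = e)%R) by (field; lra).
pose proof (Cmod_ge_0 (u N - l)); nra.
Qed.

Lemma seq_lim_opp u l : seq_lim u l -> seq_lim (fun n => - u n) (- l).
Proof.
intros H; replace (- l) with (-1 * l) by ring.
apply seq_lim_ext with (fun n => -1 * u n); [intros; ring|now apply seq_lim_scal].
Qed.

Lemma seq_lim_shift u l : seq_lim u l -> seq_lim (fun n => u (S n)) l.
Proof. intros H e He; destruct (H e He) as [N0 HN]; exists N0; intros; apply HN; lia. Qed.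

Lemma seq_lim_unshift u l : seq_lim (fun n => u (S n)) l -> seq_lim u l.
Proof.
intros H e He; destruct (H e He) as [N0 HN]; exists (S N0); intros [|N] HN'; [lia|apply HN; lia].
Qed.

Lemma seq_lim_0_unique u v l m :
  seq_lim u l -> seq_lim v m -> seq_lim (fun n => u n - v n) 0 -> l = m.
Proof.
intros Hu Hv H.
assert (K : seq_lim (fun n => (u n - v n) + - (u n + - v n)) (0 + - (l + - m))).
{ apply seq_lim_plus; [easy|apply seq_lim_opp, seq_lim_plus; [easy|now apply seq_lim_opp]]. }
apply Ceq_minus, Cmod_eq_0, Rle_antisym; [|apply Cmod_ge_0].
replace (l - m) with (- (0 + - (l + - m))) by ring; rewrite Cmod_opp.
apply (seq_lim_bound _ _ 0 K); intros N.
replace (u N - v N + - (u N + - v N)) with (RtoC 0) by ring; rewrite Cmod_0; lra.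
Qed.

Lemma seq_lim_R (u : nat -> R) (l : R) :
  is_lim_seq u l -> seq_lim (fun n => RtoC (u n)) (RtoC l).
Proof.
intros H e He.
destruct (proj2 (is_lim_seq_spec u l) H (mkposreal e He)) as [N0 HN].
exists N0; intros N HN'; rewrite Cmod_RtoC_sub; apply HN; easy.
Qed.

Lemma seq_lim_pair (u v : nat -> R) (l m : R) :
  is_lim_seq u l -> is_lim_seq v m -> seq_lim (fun n => (u n, v n)) (l, m).
Proof.
intros Hu Hv; apply seq_lim_ext with (fun n => RtoC (u n) + Ci * RtoC (v n)).
{ intros; apply injective_projections; simpl; ring. }
replace (l, m) with (RtoC l + Ci * RtoC m) by (apply injective_projections; simpl; ring).
apply seq_lim_plus; [now apply seq_lim_R|now apply seq_lim_scal, seq_lim_R].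
Qed.

Definition psum (a : nat -> R) (N : nat) (t : C) : C := Csum (fun k => RtoC (a k) * t ^ k) N.

(** Two real [Series] make this a total function of t; its meaning as a limit is [CPSeries_lim]. *)
Definition CPSeries (a : nat -> R) (t : C) : C :=
  (Series (fun k => Re (RtoC (a k) * t ^ k)), Series (fun k => Im (RtoC (a k) * t ^ k))).

Lemma Csum_sum_n (f : nat -> C) N :
  Csum f (S N) = (sum_n (fun k => Re (f k)) N, sum_n (fun k => Im (f k)) N).
Proof.
induction N as [|N IH].
- simpl; rewrite !sum_O; destruct (f 0%nat); apply injective_projections; simpl; ring.
- change (Csum f (S (S N))) with (Csum f (S N) + f (S N)).
  rewrite IH, !sum_Sn; easy.
Qed.

Section Convergence.
Variables (a : nat -> R) (r : R).
Hypothesis Hr : Rbar_lt r (CV_radius a).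
Hypothesis Hr0 : (0 <= r)%R.

Lemma abs_summable : ex_series (fun k => Rabs (a k) * r ^ k)%R.
Proof.
apply ex_series_ext with (fun k => Rabs (a k * r ^ k)).
{ intros; rewrite Rabs_mult, (Rabs_pos_eq (r ^ n)) by (now apply pow_le); easy. }
apply CV_disk_inside; now rewrite Rabs_pos_eq.
Qed.

Lemma term_bound k t : (Cmod t <= r)%R -> (Cmod (RtoC (a k) * t ^ k) <= Rabs (a k) * r ^ k)%R.
Proof.
intros Ht; rewrite Cmod_mult, Cmod_R, Cmod_pow; apply Rmult_le_compat_l; [apply Rabs_pos|].
apply pow_incr; split; [apply Cmod_ge_0|easy].
Qed.

Lemma CPSeries_lim t : (Cmod t <= r)%R -> seq_lim (fun N => psum a N t) (CPSeries a t).
Proof.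
intros Ht; apply seq_lim_unshift.
apply seq_lim_ext with (fun N => (sum_n (fun k => Re (RtoC (a k) * t ^ k)) N,
   sum_n (fun k => Im (RtoC (a k) * t ^ k)) N)).
{ intros; symmetry; apply (Csum_sum_n (fun k => RtoC (a k) * t ^ k)). }
apply seq_lim_pair.
- apply (Series_correct (fun k => Re (RtoC (a k) * t ^ k))).
  apply (ex_series_le (V := R_CompleteNormedModule) _ (fun k => Rabs (a k) * r ^ k)%R); [|apply abs_summable].
  intros k; eapply Rle_trans; [apply re_le_Cmod|now apply term_bound].
- apply (Series_correct (fun k => Im (RtoC (a k) * t ^ k))).
  apply (ex_series_le (V := R_CompleteNormedModule) _ (fun k => Rabs (a k) * r ^ k)%R); [|apply abs_summable].
  intros k; eapply Rle_trans; [apply im_le_Cmod|now apply term_bound].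
Qed.

Lemma psum_bound N t : (Cmod t <= r)%R ->
  (Cmod (psum a N t) <= Series (fun k => Rabs (a k) * r ^ k))%R.
Proof.
intros Ht.
set (g := fun k => (Rabs (a k) * r ^ k)%R).
assert (Hg : forall k, (0 <= g k)%R).
{ intros; apply Rmult_le_pos; [apply Rabs_pos|now apply pow_le]. }
eapply Rle_trans; [apply (Cmod_Csum_le _ g); intros; now apply term_bound|].
assert (Hs : is_lim_seq (sum_n g) (Series g)) by (apply (Series_correct g), abs_summable).
assert (Hi : forall n, (sum_n g n <= Series g)%R).
{ intros n; apply (is_lim_seq_incr_compare (sum_n g) (Series g) Hs).
  intros k; rewrite sum_Sn; unfold plus; simpl; specialize (Hg (S k)); lra. }
destruct N as [|N].
- simpl; eapply Rle_trans; [|apply (Hi 0%nat)]; rewrite sum_O; apply Hg.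
- rewrite Csum_sum_n; apply Hi.
Qed.

Lemma CPSeries_bound t : (Cmod t <= r)%R ->
  (Cmod (CPSeries a t) <= Series (fun k => Rabs (a k) * r ^ k))%R.
Proof.
intros Ht; apply (seq_lim_bound _ _ _ (CPSeries_lim t Ht)); intros; now apply psum_bound.
Qed.

End Convergence.

Lemma der_psum a N t : der Cid (psum a (S N)) t (psum (PS_derive a) N t).
Proof.
induction N as [|N IH].
- apply (der_ext Cid (fun _ => RtoC (a 0%nat))); [intros; unfold psum; simpl; ring|].
  apply der_const.
- apply (der_ext Cid (fun y => psum a (S N) y + RtoC (a (S N)) * y ^ S N)); [easy|].
  eapply der_eq; [|apply der_plus; [exact IH|apply der_scal, der_pow, der_id]].
  replace (S N - 1)%nat with N by lia; unfold psum; simpl Csum; unfold PS_derive.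
  rewrite RtoC_mult; ring.
Qed.

Lemma segment_in_disk (x y : C) (r s : R) : (Cmod x <= r)%R -> (Cmod y <= r)%R -> (0 <= s <= 1)%R ->
  (Cmod (x + RtoC s * (y - x)) <= r)%R.
Proof.
intros Hx Hy Hs.
replace (x + RtoC s * (y - x)) with (RtoC (1 - s) * x + RtoC s * y) by (rewrite RtoC_minus; ring).
eapply Rle_trans; [apply Cmod_triangle|]; rewrite !Cmod_mult, !Cmod_R, !Rabs_pos_eq by lra.
apply Rle_trans with ((1 - s) * r + s * r)%R; [|lra].
apply Rplus_le_compat; apply Rmult_le_compat_l; lra.
Qed.

(** The second order Taylor error of every partial sum is at most M |w - t|^2, with M the sum of the
    absolute second derivative series at r. The bound survives the limit, so limit and derivative
    need not be interchanged. *)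
Lemma der_CPSeries a (r : R) t : Rbar_lt r (CV_radius a) -> (Cmod t < r)%R ->
  der Cid (CPSeries a) t (CPSeries (PS_derive a) t).
Proof.
intros Hr Ht; pose proof (Cmod_ge_0 t) as Ht0.
assert (Hr1 : Rbar_lt r (CV_radius (PS_derive a))) by now rewrite CV_radius_derive.
assert (Hr2 : Rbar_lt r (CV_radius (PS_derive (PS_derive a)))) by now rewrite CV_radius_derive.
set (M := Series (fun k => Rabs (PS_derive (PS_derive a) k) * r ^ k)%R).
assert (HB : forall N s, (Cmod s <= r)%R -> (Cmod (psum (PS_derive (PS_derive a)) N s) <= M)%R).
{ intros; apply psum_bound; try easy; lra. }
assert (HM : (0 <= M)%R) by (eapply Rle_trans; [apply Cmod_ge_0|apply (HB 0%nat t); lra]).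
assert (H1 : forall N x y, (Cmod x <= r)%R -> (Cmod y <= r)%R ->
   (Cmod (psum (PS_derive a) (S N) y - psum (PS_derive a) (S N) x) <= M * Cmod (y - x))%R).
{ intros N x y Hx Hy.
  apply (mean_value_segment _ (fun s => psum (PS_derive (PS_derive a)) N (x + RtoC s * (y - x)))).
  - intros; apply der_psum.
  - intros; now apply HB, segment_in_disk. }
assert (H2 : forall N w, (Cmod w <= r)%R ->
  (Cmod (psum a (S (S N)) w - psum a (S (S N)) t - (w - t) * psum (PS_derive a) (S N) t)
    <= M * Cmod (w - t) * Cmod (w - t))%R).
{ intros N w Hw.
  set (c := psum (PS_derive a) (S N) t).
  (* After subtraction of the linear part, [H1] bounds the derivative on the segment by M |w -
     t|. *)
  pose proof (mean_value_segment (fun s => psum a (S (S N)) s - s * c)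
    (fun s => psum (PS_derive a) (S N) (t + RtoC s * (w - t)) - c) t w (M * Cmod (w - t))) as K.
  cbv beta in K.
  replace (psum a (S (S N)) w - psum a (S (S N)) t - (w - t) * c)
    with (psum a (S (S N)) w - w * c - (psum a (S (S N)) t - t * c)) by ring.
  apply K.
  - intros s Hs; eapply der_eq; [|apply der_minus; [apply der_psum|
      apply der_mult; [apply der_id|apply der_const]]]; cbv beta; ring.
  - intros s Hs; eapply Rle_trans; [apply H1; [lra|apply segment_in_disk; lra]|].
    apply Rmult_le_compat_l; [easy|].
    replace (t + RtoC s * (w - t) - t) with (RtoC s * (w - t)) by ring.
    rewrite Cmod_mult, Cmod_R, Rabs_pos_eq by lra; pose proof (Cmod_ge_0 (w - t)); nra. }
assert (H3 : forall w, (Cmod w <= r)%R ->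
  (Cmod (CPSeries a w - CPSeries a t - (w - t) * CPSeries (PS_derive a) t)
    <= M * Cmod (w - t) * Cmod (w - t))%R).
{ intros w Hw.
  apply (seq_lim_bound (fun N => psum a (S (S N)) w - psum a (S (S N)) t - (w - t) * psum (PS_derive a) (S N) t));
    [|intros; now apply H2].
  apply seq_lim_plus; [apply seq_lim_plus|]; [|apply seq_lim_opp|apply seq_lim_opp, seq_lim_scal].
  - apply (seq_lim_shift (fun N => psum a (S N) w)), (seq_lim_shift (fun N => psum a N w)).
    apply (CPSeries_lim a r); try easy; lra.
  - apply (seq_lim_shift (fun N => psum a (S N) t)), (seq_lim_shift (fun N => psum a N t)).
    apply (CPSeries_lim a r); try easy; lra.
  - apply (seq_lim_shift (fun N => psum (PS_derive a) N t)).
    apply (CPSeries_lim (PS_derive a) r); try easy; lra. }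
intros e He; exists (Rmin (r - Cmod t) (e / (M + 1))); split.
{ apply Rmin_pos; [lra|apply Rdiv_lt_0_compat; lra]. }
intros w Hw.
assert (K1 : (Cmod (w - t) < r - Cmod t)%R) by (eapply Rlt_le_trans; [exact Hw|apply Rmin_l]).
assert (K2 : (Cmod (w - t) < e / (M + 1))%R) by (eapply Rlt_le_trans; [exact Hw|apply Rmin_r]).
pose proof (Cmod_le_sub w t).
eapply Rle_trans; [apply H3; lra|].
apply Rmult_le_compat_r; [apply Cmod_ge_0|].
assert (E : ((M + 1) * (e / (M + 1)) = e)%R) by (field; lra).
pose proof (Cmod_ge_0 (w - t)); nra.
Qed.

Lemma is_pseries_CPSeries a (r : R) t : Rbar_lt r (CV_radius a) -> (Cmod t <= r)%R ->
  is_pseries (K := C_AbsRing) (V := C_NormedModule) (fun k => RtoC (a k)) t (CPSeries a t).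
Proof.
intros Hr Ht; pose proof (Cmod_ge_0 t).
pose proof (CPSeries_lim a r Hr ltac:(lra) t Ht) as H1.
apply (filterlim_locally (U := C_UniformSpace)); intros e.
destruct (H1 e (cond_pos e)) as [N0 HN].
exists N0; intros N HN'.
assert (E : sum_n (fun k => scal (pow_n t k) (RtoC (a k) : C_NormedModule)) N = psum a (S N) t).
{ clear; induction N as [|N IH].
  - rewrite sum_O; unfold psum; simpl; unfold scal; simpl; unfold mult; simpl.
    match goal with |- ?x = ?y => change (@eq C (1 * RtoC (a 0%nat)) (0 + RtoC (a 0%nat) * 1)) end; ring.
  - rewrite sum_Sn, IH.
    change (psum a (S (S N)) t) with (psum a (S N) t + RtoC (a (S N)) * t ^ S N).
    assert (Ep : forall n, pow_n (K := C_Ring) t n = t ^ n).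
    { induction n as [|n IHn]; [easy|]; rewrite Cpow_S, <- IHn; easy. }
    rewrite Ep.
    change (psum a (S N) t + t ^ S N * RtoC (a (S N)) = psum a (S N) t + RtoC (a (S N)) * t ^ S N); ring. }
match goal with |- ball _ _ ?s => replace s with (psum a (S N) t) by (symmetry; exact E) end.
specialize (HN (S N) ltac:(lia)).
split; eapply Rle_lt_trans; try exact HN;
  [apply (re_le_Cmod (psum a (S N) t - CPSeries a t))|apply (im_le_Cmod (psum a (S N) t - CPSeries a t))].
Qed.

(** Both sides sum x_i y_j over the triangle i + j < N. *)
Lemma Csum_cauchy (x y : nat -> C) N :
  Csum (fun n => Csum (fun k => x k * y (n - k)%nat) (S n)) N
  = Csum (fun i => x i * Csum y (N - i)) N.
Proof.
induction N as [|N IH]; [easy|].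
change (Csum (fun n => Csum (fun k => x k * y (n - k)%nat) (S n)) N
   + Csum (fun k => x k * y (N - k)%nat) (S N) = Csum (fun i => x i * Csum y (S N - i)) (S N)).
rewrite IH.
transitivity (Csum (fun i => x i * Csum y (N - i) + x i * y (N - i)%nat) (S N)).
- simpl; rewrite Nat.sub_diag; simpl.
  assert (Hp : forall f g M, Csum (fun i => f i + g i) M = Csum f M + Csum g M).
  { clear; intros f g M; induction M as [|M IH]; simpl; [ring|rewrite IH; ring]. }
  rewrite Hp; ring.
- apply Csum_ext; intros k Hk.
  replace (S N - k)%nat with (S (N - k)) by lia; simpl; ring.
Qed.

Lemma Cmod_Csum_tail (y : nat -> C) (Y : nat -> R) m n :
  (forall k, (Cmod (y k) <= Y k)%R) -> (m <= n)%nat ->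
  (Cmod (Csum y n - Csum y m) <= Re (Csum (fun k => RtoC (Y k)) n) - Re (Csum (fun k => RtoC (Y k)) m))%R.
Proof.
intros H Hmn; replace n with (m + (n - m))%nat by lia; generalize (n - m)%nat as d; clear n Hmn.
induction d as [|d IH].
- rewrite Nat.add_0_r, Rminus_diag; replace (Csum y m - Csum y m) with (RtoC 0) by ring; rewrite Cmod_0; lra.
- rewrite Nat.add_succ_r.
  replace (Re (Csum (fun k => RtoC (Y k)) (S (m + d))))
    with (Re (Csum (fun k => RtoC (Y k)) (m + d)) + Y (m + d)%nat)%R by reflexivity.
  change (Csum y (S (m + d))) with (Csum y (m + d) + y (m + d)%nat).
  replace (Csum y (m + d) + y (m + d)%nat - Csum y m) with (Csum y (m + d) - Csum y m + y (m + d)%nat) by ring.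
  eapply Rle_trans; [apply Cmod_triangle|]; specialize (H (m + d)%nat); lra.
Qed.

Lemma Csum_RtoC (g : nat -> R) N : Csum (fun k => RtoC (g k)) N = RtoC (Re (Csum (fun k => RtoC (g k)) N)).
Proof.
induction N as [|N IH]; [easy|]; simpl; rewrite IH at 1; now rewrite <- RtoC_plus.
Qed.

(** The product of the partial sums runs over a square, the partial sum of the product over a
    triangle. The gap is dominated by the same gap for the absolute values, which tends to 0 by the
    real Cauchy product. *)
Lemma CPSeries_mult a b (r : R) t : Rbar_lt r (CV_radius a) -> Rbar_lt r (CV_radius b) ->
  Rbar_lt r (CV_radius (PS_mult a b)) -> (Cmod t <= r)%R ->
  CPSeries (PS_mult a b) t = CPSeries a t * CPSeries b t.
Proof.
intros Ha Hb Hab Ht; pose proof (Cmod_ge_0 t) as Ht0.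
assert (Hr0 : (0 <= r)%R) by lra.
pose proof (CPSeries_lim a r Ha Hr0 t Ht) as La.
pose proof (CPSeries_lim b r Hb Hr0 t Ht) as Lb.
pose proof (CPSeries_lim _ r Hab Hr0 t Ht) as Lab.
set (x := fun k => RtoC (a k) * t ^ k); set (y := fun k => RtoC (b k) * t ^ k).
set (X := fun k => (Rabs (a k) * r ^ k)%R); set (Y := fun k => (Rabs (b k) * r ^ k)%R).
assert (Hx : forall k, (Cmod (x k) <= X k)%R) by (intros; now apply term_bound).
assert (Hy : forall k, (Cmod (y k) <= Y k)%R) by (intros; now apply term_bound).
assert (EP : forall N, psum (PS_mult a b) N t = Csum (fun i => x i * Csum y (N - i)) N).
{ intros N; rewrite <- Csum_cauchy; unfold psum; apply Csum_ext; intros n _.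
  unfold PS_mult.
  assert (E : forall m, (m <= n)%nat ->
    RtoC (sum_f_R0 (fun k => a k * b (n - k)%nat) m)%R * t ^ n = Csum (fun k => x k * y (n - k)%nat) (S m)).
  { induction m as [|m IH]; intros Hm.
    - unfold x, y; simpl; rewrite Nat.sub_0_r, RtoC_mult; ring.
    - rewrite tech5, RtoC_plus, Cmult_plus_distr_r, IH by lia.
      change (Csum (fun k => x k * y (n - k)%nat) (S m) + RtoC (a (S m) * b (n - S m)%nat)%R * t ^ n
        = Csum (fun k => x k * y (n - k)%nat) (S m) + x (S m) * y (n - S m)%nat).
      f_equal; unfold x, y.
      replace (t ^ n) with (t ^ S m * t ^ (n - S m)) by (rewrite <- Cpow_add_r; f_equal; lia).
      rewrite RtoC_mult; ring. }
  apply (E n); lia. }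
assert (ED : forall N, psum a N t * psum b N t - psum (PS_mult a b) N t
   = Csum (fun i => x i * (Csum y N - Csum y (N - i))) N).
{ intros N; rewrite EP; change (Csum x N * Csum y N - Csum (fun i => x i * Csum y (N - i)) N
    = Csum (fun i => x i * (Csum y N - Csum y (N - i))) N).
  rewrite (Csum_ext (fun i => x i * (Csum y N - Csum y (N - i)))
    (fun i => x i * Csum y N - x i * Csum y (N - i))) by (intros; ring).
  rewrite Csum_minus; f_equal.
  rewrite (Cmult_comm (Csum x N)), <- Csum_scal; apply Csum_ext; intros; apply Cmult_comm. }
set (SX := fun N => Re (Csum (fun k => RtoC (X k)) N)); set (SY := fun N => Re (Csum (fun k => RtoC (Y k)) N)).
set (SP := fun N => Re (Csum (fun n => Csum (fun k => RtoC (X k) * RtoC (Y (n - k)%nat)) (S n)) N)).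
assert (HD : forall N, (Cmod (psum a N t * psum b N t - psum (PS_mult a b) N t) <= SX N * SY N - SP N)%R).
{ intros N; rewrite ED.
  eapply Rle_trans; [apply (Cmod_Csum_le _ (fun i => X i * (SY N - SY (N - i)%nat))%R)|].
  - intros k Hk; rewrite Cmod_mult; apply Rmult_le_compat; try apply Cmod_ge_0; [apply Hx|].
    apply Cmod_Csum_tail; [easy|lia].
  - right; unfold SP; rewrite (Csum_cauchy (fun k => RtoC (X k)) (fun k => RtoC (Y k))).
    set (CX := Csum (fun k => RtoC (X k)) N); set (CY := Csum (fun k => RtoC (Y k)) N).
    set (CZ := Csum (fun i => RtoC (X i) * Csum (fun k => RtoC (Y k)) (N - i)) N).
    replace (SX N * SY N)%R with (Re (CX * CY)).
    2:{ unfold CX, CY; rewrite (Csum_RtoC X), (Csum_RtoC Y), <- RtoC_mult; easy. }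
    replace (Re (CX * CY) - Re CZ)%R with (Re (CX * CY - CZ)) by easy.
    f_equal; rewrite (Cmult_comm CX); unfold CX, CZ; rewrite <- Csum_scal, <- Csum_minus.
    apply Csum_ext; intros k _; unfold CY.
    rewrite RtoC_mult, RtoC_minus; unfold SY; rewrite <- !Csum_RtoC; ring. }
assert (HL : is_lim_seq (fun N => SX (S N) * SY (S N) - SP (S N))%R 0%R).
{ assert (EX : forall N, SX (S N) = sum_n X N) by (intros; unfold SX; now rewrite Csum_sum_n).
  assert (EY : forall N, SY (S N) = sum_n Y N) by (intros; unfold SY; now rewrite Csum_sum_n).
  set (Z := fun n => sum_f_R0 (fun k => X k * Y (n - k)%nat)%R n).
  assert (EZ : forall N, SP (S N) = sum_n Z N).
  { intros N; unfold SP; rewrite Csum_sum_n; cbn [Re fst]; apply sum_n_ext; intros n.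
    rewrite Csum_sum_n; unfold Z; rewrite <- sum_n_Reals; cbn [Re fst]; apply sum_n_ext; intros k.
    rewrite <- RtoC_mult; easy. }
  apply is_lim_seq_ext with (fun N => sum_n X N * sum_n Y N - sum_n Z N)%R.
  { intros; now rewrite EX, EY, EZ. }
  assert (SXl : is_series X (Series X)) by (apply Series_correct, abs_summable; easy).
  assert (SYl : is_series Y (Series Y)) by (apply Series_correct, abs_summable; easy).
  assert (SZl : is_series Z (Series X * Series Y)%R).
  { apply is_series_mult; try easy.
    - exists (Series X); apply is_series_ext with X; [intros; symmetry; apply Rabs_pos_eq|easy].
      apply Rmult_le_pos; [apply Rabs_pos|now apply pow_le].
    - exists (Series Y); apply is_series_ext with Y; [intros; symmetry; apply Rabs_pos_eq|easy].
      apply Rmult_le_pos; [apply Rabs_pos|now apply pow_le]. }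
  replace (Finite 0) with (Finite (Series X * Series Y - Series X * Series Y)) by (f_equal; ring).
  apply is_lim_seq_minus'; [apply is_lim_seq_mult'|]; easy. }
assert (Lprod : seq_lim (fun N => psum a N t * psum b N t) (CPSeries a t * CPSeries b t)).
{ intros e He.
  pose proof (psum_bound a r Ha Hr0) as Ba.
  set (Ma := Series (fun k => Rabs (a k) * r ^ k)%R) in *.
  assert (HMa : (0 <= Ma)%R) by (eapply Rle_trans; [apply Cmod_ge_0|apply (Ba 0%nat t Ht)]).
  set (mb := Cmod (CPSeries b t)); assert (Hmb : (0 <= mb)%R) by apply Cmod_ge_0.
  destruct (La (e / (2 * (mb + 1)))%R) as [N1 H1]; [apply Rdiv_lt_0_compat; lra|].
  destruct (Lb (e / (2 * (Ma + 1)))%R) as [N2 H2]; [apply Rdiv_lt_0_compat; lra|].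
  exists (max N1 N2); intros N HN; specialize (H1 N ltac:(lia)); specialize (H2 N ltac:(lia)).
  replace (psum a N t * psum b N t - CPSeries a t * CPSeries b t)
    with (psum a N t * (psum b N t - CPSeries b t) + (psum a N t - CPSeries a t) * CPSeries b t) by ring.
  eapply Rle_lt_trans; [apply Cmod_triangle|]; rewrite !Cmod_mult; fold mb.
  specialize (Ba N t Ht).
  assert (E1 : (e / (2 * (mb + 1)) * (mb + 1) = e / 2)%R) by (field; lra).
  assert (E2 : (e / (2 * (Ma + 1)) * (Ma + 1) = e / 2)%R) by (field; lra).
  assert (P1 : (0 < e / (2 * (mb + 1)))%R) by (apply Rdiv_lt_0_compat; lra).
  assert (P2 : (0 < e / (2 * (Ma + 1)))%R) by (apply Rdiv_lt_0_compat; lra).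
  pose proof (Cmod_ge_0 (psum b N t - CPSeries b t)); pose proof (Cmod_ge_0 (psum a N t - CPSeries a t)).
  assert (Q1 : (Cmod (psum a N t) * Cmod (psum b N t - CPSeries b t) <= Ma * (e / (2 * (Ma + 1))))%R)
    by (apply Rmult_le_compat; try apply Cmod_ge_0; lra).
  assert (Q2 : (Cmod (psum a N t - CPSeries a t) * mb <= e / (2 * (mb + 1)) * mb)%R)
    by (apply Rmult_le_compat_r; lra).
  lra. }
symmetry; apply (seq_lim_0_unique _ _ _ _ Lprod Lab).
apply seq_lim_unshift; intros e He.
destruct (proj2 (is_lim_seq_spec _ _) HL (mkposreal e He)) as [N0 HN].
exists N0; intros N HN'; specialize (HN N HN'); simpl in HN.
replace (psum a (S N) t * psum b (S N) t - psum (PS_mult a b) (S N) t - 0)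
  with (psum a (S N) t * psum b (S N) t - psum (PS_mult a b) (S N) t) by ring.
eapply Rle_lt_trans; [apply HD|].
rewrite Rminus_0_r in HN; eapply Rle_lt_trans; [apply Rle_abs|exact HN].
Qed.

Lemma CPSeries_plus a b (r : R) t : Rbar_lt r (CV_radius a) -> Rbar_lt r (CV_radius b) -> (Cmod t <= r)%R ->
  CPSeries (PS_plus a b) t = CPSeries a t + CPSeries b t.
Proof.
intros Ha Hb Ht; pose proof (Cmod_ge_0 t).
assert (Hab : Rbar_lt r (CV_radius (PS_plus a b))).
{ eapply Rbar_lt_le_trans; [|apply CV_radius_plus]; now apply Rbar_min_case. }
apply (seq_lim_0_unique _ _ _ _ (CPSeries_lim _ r Hab ltac:(lra) t Ht)
  (seq_lim_plus _ _ _ _ (CPSeries_lim a r Ha ltac:(lra) t Ht) (CPSeries_lim b r Hb ltac:(lra) t Ht))).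
assert (E : forall N, psum (PS_plus a b) N t - (psum a N t + psum b N t) = 0).
{ induction N as [|N IH]; unfold psum in *; simpl; [ring|].
  unfold PS_plus at 2, plus; simpl; rewrite RtoC_plus, <- IH; ring. }
intros e He; exists 0%nat; intros N _; rewrite E.
replace (0 - 0) with (RtoC 0) by ring; rewrite Cmod_0; easy.
Qed.

Lemma CPSeries_decr a (r : R) t : Rbar_lt r (CV_radius a) -> (Cmod t <= r)%R ->
  CPSeries a t = RtoC (a 0%nat) + t * CPSeries (PS_decr_1 a) t.
Proof.
intros Ha Ht; pose proof (Cmod_ge_0 t).
assert (Hd : Rbar_lt r (CV_radius (PS_decr_1 a))) by now rewrite CV_radius_decr_1.
assert (Lc : seq_lim (fun _ : nat => RtoC (a 0%nat)) (RtoC (a 0%nat))).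
{ intros e He; exists 0%nat; intros; replace (RtoC (a 0%nat) - RtoC (a 0%nat)) with (RtoC 0) by ring.
  now rewrite Cmod_0. }
apply (seq_lim_0_unique _ _ _ _ (seq_lim_shift _ _ (CPSeries_lim a r Ha ltac:(lra) t Ht))
  (seq_lim_plus _ _ _ _ Lc (seq_lim_scal t _ _ (CPSeries_lim _ r Hd ltac:(lra) t Ht)))).
assert (E : forall N, psum a (S N) t - (RtoC (a 0%nat) + t * psum (PS_decr_1 a) N t) = 0).
{ induction N as [|N IH]; [unfold psum; simpl; ring|].
  change (psum a (S (S N)) t) with (psum a (S N) t + RtoC (a (S N)) * t ^ S N).
  change (psum (PS_decr_1 a) (S N) t) with (psum (PS_decr_1 a) N t + RtoC (a (S N)) * t ^ N).
  rewrite <- IH, Cpow_S; ring. }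
intros e He; exists 0%nat; intros N _; rewrite E.
replace (0 - 0) with (RtoC 0) by ring; rewrite Cmod_0; easy.
Qed.

Lemma CPSeries_ext a b t : (forall n, a n = b n) -> CPSeries a t = CPSeries b t.
Proof. intros H; unfold CPSeries; f_equal; apply Series_ext; intros; now rewrite H. Qed.

(** * The coefficients of the expansion *)

Lemma Q2R_Qred q : Q2R (Qred q) = Q2R q.
Proof. apply Qeq_eqR, Qred_correct. Qed.

Lemma Q2R_Qnat n : Q2R (Qnat n) = INR n.
Proof. unfold Qnat, inject_Z, Q2R; simpl; rewrite <- INR_IZR_INZ; field. Qed.

Lemma Qnat_neq_0 n : (1 <= n)%nat -> ~ (Qnat n == 0)%Q.
Proof.
intros H E; apply Qeq_eqR in E; rewrite Q2R_Qnat in E.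
unfold Q2R in E; simpl in E; rewrite Rmult_0_l in E; revert E; apply not_0_INR; lia.
Qed.

Definition root_coef (k : nat) : R := Q2R (hd 0%Q (root_coefs k)).

Definition phase_coefR (i : nat) : R := (2 * (-1) ^ i / INR (i + 2))%R.

Lemma Q2R_phase_coef i : Q2R (phase_coef i) = phase_coefR i.
Proof.
unfold phase_coef, phase_coefR; rewrite Q2R_div, Q2R_Qnat by (apply Qnat_neq_0; lia).
f_equal; destruct (Nat.even i) eqn:E.
- apply Nat.even_spec in E; destruct E as [m ->]; rewrite pow_1_even; unfold Q2R; simpl; field.
- assert (O : Nat.odd i = true) by (unfold Nat.odd; now rewrite E).
  apply Nat.odd_spec in O; destruct O as [m ->]; rewrite Nat.add_1_r, pow_1_odd.
  unfold Q2R; simpl; field.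
Qed.

Lemma root_coefs_S k : root_coefs (S k) = hd 0%Q (root_coefs (S k)) :: root_coefs k.
Proof. reflexivity. Qed.

Lemma nth_root_coefs i : forall k, (i <= k)%nat ->
  Q2R (nth i (root_coefs k) 0%Q) = root_coef (k - i).
Proof.
induction i as [|i IH]; intros k Hk.
- rewrite Nat.sub_0_r; unfold root_coef; destruct k; [easy|]; now rewrite root_coefs_S.
- destruct k as [|k]; [lia|]; rewrite root_coefs_S; apply IH; lia.
Qed.

Lemma Q2R_fold_sub (f : nat -> Q) (m k : nat) :
  Q2R (fold_right (fun i acc => (acc - f i)%Q) 0%Q (seq m (S k)))
  = (- sum_f_R0 (fun i => Q2R (f (m + i)%nat)) k)%R.
Proof.
revert m; induction k as [|k IH]; intros m.
- simpl; rewrite Q2R_minus, Nat.add_0_r; unfold Q2R at 1; simpl; ring.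
- change (seq m (S (S k))) with (m :: seq (S m) (S k)).
  cbn [fold_right]; rewrite Q2R_minus, IH.
  rewrite (decomp_sum (fun i => Q2R (f (m + i)%nat)) (S k)) by lia; simpl pred.
  rewrite Nat.add_0_r.
  replace (sum_f_R0 (fun i => Q2R (f (m + S i)%nat)) k) with (sum_f_R0 (fun i => Q2R (f (S m + i)%nat)) k)
    by (apply sum_eq; intros; do 2 f_equal; lia).
  ring.
Qed.

Lemma root_coef_rec k :
  (2 * INR (S k) * root_coef (S k))%R
  = (- sum_f_R0 (fun i => (2 * INR (S k) - INR (S i)) * phase_coefR (S i) * root_coef (k - i)) k)%R.
Proof.
unfold root_coef at 1.
set (f := fun i => (Qnat (2 * S k - i) * phase_coef i * nth (i - 1) (root_coefs k) 0)%Q).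
change (hd 0%Q (root_coefs (S k)))
  with (Qred (fold_right (fun i acc => (acc - f i)%Q) 0%Q (seq 1 (S k)) / Qnat (2 * S k))%Q).
rewrite Q2R_Qred, Q2R_div, Q2R_Qnat, Q2R_fold_sub by (apply Qnat_neq_0; lia).
assert (HS : INR (2 * S k) = (2 * INR (S k))%R) by (rewrite mult_INR; easy).
assert (HS0 : INR (S k) <> 0%R) by (apply not_0_INR; lia).
rewrite HS.
transitivity (- sum_f_R0 (fun i => Q2R (f (1 + i)%nat)) k)%R; [field; lra|].
f_equal; apply sum_eq; intros i Hi.
unfold f; rewrite !Q2R_mult, Q2R_Qnat, Q2R_phase_coef.
replace (1 + i - 1)%nat with i by lia; rewrite nth_root_coefs by lia.
rewrite minus_INR, HS by lia; easy.
Qed.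

Lemma root_coef_0 : root_coef 0 = 1%R.
Proof. unfold root_coef, Q2R; simpl; field. Qed.

Lemma phase_coefR_bound i : (Rabs (phase_coefR i) <= 1)%R.
Proof.
unfold phase_coefR, Rdiv.
assert (H : (2 <= INR (i + 2))%R) by (rewrite plus_INR; simpl; pose proof (pos_INR i); lra).
rewrite !Rabs_mult, pow_1_abs, Rabs_inv, !Rabs_pos_eq by lra.
apply Rmult_le_reg_r with (INR (i + 2)); [lra|]; rewrite Rmult_assoc, Rinv_l by lra; lra.
Qed.

Lemma sum_pow2 k : (sum_f_R0 (fun i => 2 ^ i) k = 2 ^ S k - 1)%R.
Proof. induction k as [|k IH]; [simpl; ring|]; rewrite tech5, IH; simpl; ring. Qed.

Lemma sum_f_rev (f : nat -> R) k : sum_f_R0 (fun i => f (k - i)%nat) k = sum_f_R0 f k.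
Proof.
revert f; induction k as [|k IH]; intros f; [easy|].
rewrite (decomp_sum (fun i => f (S k - i)%nat)) by lia; simpl pred.
rewrite tech5, <- (IH f), Nat.sub_0_r, Rplus_comm; f_equal.
Qed.

(** In the recurrence the weights are at most 2 (k + 1) and the phase coefficients at most 1, so the
    powers of 2 sum to less than 2^(k+1). *)
Lemma root_coef_bound : forall k, (Rabs (root_coef k) <= 2 ^ k)%R.
Proof.
intros k; induction k as [k IH] using Wf_nat.lt_wf_ind; destruct k as [|k]; [rewrite root_coef_0, Rabs_R1; simpl; lra|].
pose proof (root_coef_rec k) as E; apply (f_equal Rabs) in E.
rewrite Rabs_Ropp, !Rabs_mult, !Rabs_pos_eq in E by (try apply pos_INR; lra).
assert (HS : (1 <= INR (S k))%R) by (rewrite S_INR; pose proof (pos_INR k); lra).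
apply Rmult_le_reg_l with (2 * INR (S k))%R; [lra|]; rewrite E.
eapply Rle_trans; [apply Rsum_abs|].
apply Rle_trans with (sum_f_R0 (fun i => 2 * INR (S k) * 2 ^ (k - i)) k)%R.
- apply sum_Rle; intros i Hi.
  rewrite !Rabs_mult.
  assert (Hi' : (INR (S i) <= INR (S k))%R) by (apply le_INR; lia).
  pose proof (pos_INR (S i)).
  rewrite (Rabs_pos_eq (2 * INR (S k) - INR (S i))) by lra.
  apply Rmult_le_compat; [|apply Rabs_pos| |apply IH; lia].
  + apply Rmult_le_pos; [lra|apply Rabs_pos].
  + rewrite <- (Rmult_1_r (2 * INR (S k))); apply Rmult_le_compat; [lra|apply Rabs_pos|lra|apply phase_coefR_bound].
- 
  rewrite <- (sum_eq (fun i => 2 ^ (k - i) * (2 * INR (S k)))%R) by (intros; ring).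
  rewrite <- scal_sum, (sum_f_rev (fun i => 2 ^ i)%R), sum_pow2.
  apply Rmult_le_compat_l; lra.
Qed.

Lemma CV_radius_ge a (r M : R) : (0 <= r)%R -> (forall n, (Rabs (a n) * r ^ n <= M)%R) ->
  Rbar_le r (CV_radius a).
Proof.
intros Hr H; apply (proj1 (CV_radius_bounded a)); exists M; intros n.
rewrite Rabs_mult, (Rabs_pos_eq (r ^ n)) by (now apply pow_le); easy.
Qed.

Lemma root_coef_radius : Rbar_le (1 / 2)%R (CV_radius root_coef).
Proof.
apply (CV_radius_ge _ _ 1); [lra|]; intros n.
replace 1%R with (2 ^ n * (1 / 2) ^ n)%R at 2.
- apply Rmult_le_compat_r; [apply pow_le; lra|apply root_coef_bound].
- rewrite <- Rpow_mult_distr; replace (2 * (1 / 2))%R with 1%R by field; apply pow1.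
Qed.

Lemma phase_coef_radius : Rbar_le 1%R (CV_radius phase_coefR).
Proof.
apply (CV_radius_ge _ _ 1); [lra|]; intros n; rewrite pow1, Rmult_1_r; apply phase_coefR_bound.
Qed.

Definition gcoefR (j k : nat) : R := Q2R (gcoef j k).

Lemma gcoefR_0 k : gcoefR 0 k = PS_decr_1 root_coef k.
Proof. reflexivity. Qed.

Lemma gcoefR_S j k :
  gcoefR (S j) k = PS_plus (PS_decr_1 (PS_derive (gcoefR j))) (PS_derive (gcoefR j)) k.
Proof.
unfold gcoefR at 1.
change (gcoef (S j) k) with (Qred (Qnat (k + 2) * gcoef j (k + 2) + Qnat (k + 1) * gcoef j (k + 1)))%Q.
rewrite Q2R_Qred, Q2R_plus, !Q2R_mult, !Q2R_Qnat.
unfold PS_plus, PS_decr_1, PS_derive, plus, gcoefR; cbn [AbelianMonoid.plus].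
replace (k + 2)%nat with (S (S k)) by lia; replace (k + 1)%nat with (S k) by lia; easy.
Qed.

(** All g_j keep the radius of g_0, because differentiation, shift and sum do not shrink it; hence
    one disc serves for every j. *)
Lemma gcoef_radius j : Rbar_le (1 / 2)%R (CV_radius (gcoefR j)).
Proof.
induction j as [|j IH].
- rewrite (CV_radius_ext _ _ gcoefR_0), CV_radius_decr_1; apply root_coef_radius.
- rewrite (CV_radius_ext _ _ (gcoefR_S j)).
  eapply Rbar_le_trans; [|apply CV_radius_plus].
  rewrite CV_radius_decr_1, CV_radius_derive; now apply Rbar_min_case.
Qed.

Lemma gcoef_radius_lt j (r : R) : (r < 1 / 2)%R -> Rbar_lt r (CV_radius (gcoefR j)).
Proof. intros H; eapply Rbar_lt_le_trans; [|apply gcoef_radius]; exact H. Qed.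

Lemma root_radius_lt (r : R) : (r < 1 / 2)%R -> Rbar_lt r (CV_radius root_coef).
Proof. intros H; eapply Rbar_lt_le_trans; [|apply root_coef_radius]; exact H. Qed.

Lemma phase_radius_lt (r : R) : (r < 1)%R -> Rbar_lt r (CV_radius phase_coefR).
Proof. intros H; eapply Rbar_lt_le_trans; [|apply phase_coef_radius]; exact H. Qed.

Definition gfun (j : nat) (z : C) : C := CPSeries (gcoefR j) (z - 1).
Definition gfun' (j : nat) (z : C) : C := CPSeries (PS_derive (gcoefR j)) (z - 1).

Lemma der_gfun j (z : C) : (Cmod (z - 1) < 1 / 2)%R -> der Cid (gfun j) z (gfun' j z).
Proof.
intros Hz; set (r := ((Cmod (z - 1) + 1 / 2) / 2)%R).
eapply der_eq; [|apply (der_comp Cid (CPSeries (gcoefR j)) (fun z => z - 1))].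
- apply Cmult_1_r.
- apply (der_CPSeries _ r); [apply gcoef_radius_lt; unfold r; lra|unfold r; lra].
- eapply der_eq; [|apply der_minus; [apply der_id|apply der_const]]; ring.
Qed.

Lemma gfun_bound j : exists M, (0 <= M)%R /\ forall z, (Cmod (z - 1) <= 1 / 4)%R ->
  (Cmod (gfun j z) <= M)%R /\ (Cmod (gfun' j z) <= M)%R.
Proof.
set (M1 := Series (fun k => Rabs (gcoefR j k) * (1 / 4) ^ k)%R).
set (M2 := Series (fun k => Rabs (PS_derive (gcoefR j) k) * (1 / 4) ^ k)%R).
exists (Rmax 0 (Rmax M1 M2)); split; [apply Rmax_l|]; intros z Hz; split.
- eapply Rle_trans; [apply (CPSeries_bound _ (1 / 4)); [apply gcoef_radius_lt|..|exact Hz]; lra|].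
  eapply Rle_trans; [apply Rmax_l|apply Rmax_r].
- eapply Rle_trans; [apply (CPSeries_bound _ (1 / 4)); [rewrite CV_radius_derive; apply gcoef_radius_lt|..|exact Hz]; lra|].
  eapply Rle_trans; [apply Rmax_r|apply Rmax_r].
Qed.

Lemma gfun_rec j (z : C) : (Cmod (z - 1) < 1 / 2)%R ->
  (z - 1) * gfun (S j) z = z * gfun' j z - gcoefR j 1.
Proof.
intros Hz; unfold gfun, gfun'; set (t := z - 1) in *.
assert (Hr : Rbar_lt (Cmod t) (CV_radius (PS_derive (gcoefR j))))
  by (rewrite CV_radius_derive; now apply gcoef_radius_lt).
assert (Hr1 : Rbar_lt (Cmod t) (CV_radius (PS_decr_1 (PS_derive (gcoefR j)))))
  by now rewrite CV_radius_decr_1.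
rewrite (CPSeries_ext _ _ t (gcoefR_S j)), (CPSeries_plus _ _ (Cmod t) t Hr1 Hr) by lra.
pose proof (CPSeries_decr _ (Cmod t) t Hr ltac:(lra)) as E.
replace (PS_derive (gcoefR j) 0) with (gcoefR j 1) in E by (unfold PS_derive; simpl; ring).
replace z with (1 + t) at 1 by (unfold t; ring).
transitivity (t * CPSeries (PS_decr_1 (PS_derive (gcoefR j))) t + t * CPSeries (PS_derive (gcoefR j)) t); [ring|].
transitivity (CPSeries (PS_derive (gcoefR j)) t + t * CPSeries (PS_derive (gcoefR j)) t - gcoefR j 1); [|ring].
rewrite E at 2; ring.
Qed.

Lemma taylor_gfun j : taylor_coefficients (gfun j) 1 (fun k => RtoC (Q2R (gcoef j k))).
Proof.
exists (1 / 4)%R; split; [lra|]; intros z Hz; unfold disk in Hz.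
apply (is_pseries_CPSeries (gcoefR j) (1 / 4)); [apply gcoef_radius_lt; lra|lra].
Qed.

Lemma gfun_0_bound : exists M rho, (0 < rho)%R /\
  forall z, disk 1 rho z ->
    (Cmod (gfun 0 z - (1 / 3 - 1 / 12 * (z - 1))) <= M * Cmod (z - 1) ^ 2)%R.
Proof.
set (a := gcoefR 0); set (b := PS_decr_1 (PS_decr_1 a)).
exists (Series (fun k => Rabs (b k) * (1 / 4) ^ k)%R), (1 / 4)%R; split; [lra|]; intros z Hz.
unfold disk in Hz; unfold gfun; fold a; set (t := z - 1) in *.
assert (Ha : Rbar_lt (1 / 4)%R (CV_radius a)) by (apply gcoef_radius_lt; lra).
assert (Ha1 : Rbar_lt (1 / 4)%R (CV_radius (PS_decr_1 a))) by now rewrite CV_radius_decr_1.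
assert (Ha2 : Rbar_lt (1 / 4)%R (CV_radius b)) by (unfold b; now rewrite CV_radius_decr_1).
rewrite (CPSeries_decr a (1 / 4) t Ha), (CPSeries_decr _ (1 / 4) t Ha1) by lra; fold b.
assert (E0 : a 0%nat = (1 / 3)%R) by (unfold a, gcoefR, Q2R; vm_compute gcoef; simpl; field).
assert (E1 : PS_decr_1 a 0%nat = (- 1 / 12)%R)
  by (unfold PS_decr_1, a, gcoefR, Q2R; vm_compute gcoef; simpl; field).
rewrite E0, E1.
replace (RtoC (1 / 3)%R) with (1 / 3) by (rewrite RtoC_div; [easy|lra]).
replace (RtoC (- 1 / 12)%R) with (- (1) / 12) by (rewrite RtoC_div by lra; f_equal; apply injective_projections; simpl; ring).
replace (1 / 3 + t * (- (1) / 12 + t * CPSeries b t) - (1 / 3 - 1 / 12 * t)) with (t ^ 2 * CPSeries b t)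
  by (simpl; field).
rewrite Cmod_mult, Cmod_pow, Rmult_comm; apply Rmult_le_compat_r; [apply pow2_ge_0|].
apply CPSeries_bound; [easy|lra|lra].
Qed.

(** * The local coordinate *)

(** Convergence of the product series at r' yields only that its radius is at least r', hence the
    strictly smaller r. *)
Lemma CV_radius_mult a b (r r' : R) : (0 <= r < r')%R ->
  Rbar_lt r' (CV_radius a) -> Rbar_lt r' (CV_radius b) -> Rbar_lt r (CV_radius (PS_mult a b)).
Proof.
intros Hr Ha Hb.
assert (Hex : ex_pseries (PS_mult a b) r') by (apply ex_pseries_mult; rewrite Rabs_pos_eq by lra; easy).
apply Rbar_lt_le_trans with r'; [simpl; lra|].
apply Rbar_not_lt_le; intros L.
apply (CV_disk_outside (PS_mult a b) r'); [rewrite Rabs_pos_eq by lra; easy|].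
apply (ex_series_lim_0 (fun n => PS_mult a b n * r' ^ n)%R).
destruct Hex as [l Hl]; exists l; now apply is_pseries_R.
Qed.

Lemma CPSeries_0 a : Rbar_lt 0 (CV_radius a) -> CPSeries a 0 = RtoC (a 0%nat).
Proof. intros H; rewrite (CPSeries_decr a 0 0 H) by (rewrite Cmod_0; lra); ring. Qed.

Lemma CPSeries_zero t : CPSeries (fun _ => 0%R) t = 0.
Proof.
unfold CPSeries; apply injective_projections; simpl; apply is_series_unique, is_series_Reals;
  intros e He; exists 0%nat; intros n _; unfold Rdist;
  (rewrite (sum_eq _ (fun _ => 0%R)) by (intros; ring)); rewrite sum_eq_R0 by easy;
  rewrite Rminus_0_r, Rabs_R0; exact He.
Qed.

(** The recurrence read as 2 S G' + S' G = 0, the differential equation of G = S^{-1/2}, coefficient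
    by coefficient. *)
Lemma phase_root_coefs n :
  PS_plus (PS_plus (PS_mult phase_coefR (PS_derive root_coef)) (PS_mult phase_coefR (PS_derive root_coef)))
    (PS_mult (PS_derive phase_coefR) root_coef) n = 0%R.
Proof.
unfold PS_plus, PS_mult, PS_derive, plus; simpl.
pose proof (root_coef_rec n) as E.
assert (P0 : phase_coefR 0 = 1%R) by (unfold phase_coefR; simpl; field).
set (A := sum_f_R0 (fun k => phase_coefR k * (INR (S (n - k)) * root_coef (S (n - k))))%R n).
set (B := sum_f_R0 (fun k => INR (S k) * phase_coefR (S k) * root_coef (n - k))%R n).
change (A + A + B = 0)%R.
(* The term k = 0 is split off, because phase_coefR 0 = 1 makes it the unknown of the recurrence;
   the summand appended at i = n is 0. *)
assert (EA : (A = INR (S n) * root_coef (S n)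
   + sum_f_R0 (fun i => (INR (S n) - INR (S i)) * phase_coefR (S i) * root_coef (n - i)) n)%R).
{ unfold A; destruct n as [|n].
  - simpl; rewrite P0; ring.
  - rewrite decomp_sum, Nat.sub_0_r, P0, Rmult_1_l by lia; f_equal; simpl pred.
    rewrite (tech5 (fun i => (INR (S (S n)) - INR (S i)) * phase_coefR (S i) * root_coef (S n - i))%R).
    rewrite Rminus_diag, !Rmult_0_l, Rplus_0_r.
    apply sum_eq; intros i Hi.
    replace (S (S n - S i)) with (S n - i)%nat by lia.
    rewrite (minus_INR (S n) i), (S_INR (S n)), (S_INR i) by lia; ring. }
rewrite EA.
replace (INR (S n) * root_coef (S n))%R with
  (/ 2 * - sum_f_R0 (fun i => (2 * INR (S n) - INR (S i)) * phase_coefR (S i) * root_coef (n - i)) n)%R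
  by (rewrite <- E; field).
set (U := sum_f_R0 (fun i => (2 * INR (S n) - INR (S i)) * phase_coefR (S i) * root_coef (n - i))%R n).
set (V := sum_f_R0 (fun i => (INR (S n) - INR (S i)) * phase_coefR (S i) * root_coef (n - i))%R n).
assert (EU : (U = V * 2 + B)%R).
{ unfold U, V, B; rewrite (Rmult_comm _ 2), scal_sum, <- sum_plus; apply sum_eq; intros; ring. }
rewrite EU; field.
Qed.

(** With t = z - 1 and y as in the definition of the coefficients, [Groot] is t / y and [Sphase] is
    2 phi z / t^2. *)
Notation Groot t := (CPSeries root_coef t).
Notation Sphase t := (CPSeries phase_coefR t).

Lemma root_ode (t : C) : (Cmod t < 1 / 2)%R ->
  2 * (Sphase t * CPSeries (PS_derive root_coef) t) + CPSeries (PS_derive phase_coefR) t * Groot t = 0.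
Proof.
intros Ht; pose proof (Cmod_ge_0 t) as Ht0.
set (r := Cmod t) in *; set (r' := ((r + 1 / 2) / 2)%R).
assert (Hr : (0 <= r < r')%R) by (unfold r'; lra).
assert (Hr' : (r' < 1 / 2)%R) by (unfold r'; lra).
assert (R1 : Rbar_lt r' (CV_radius root_coef)) by now apply root_radius_lt.
assert (R2 : Rbar_lt r' (CV_radius (PS_derive root_coef))) by now rewrite CV_radius_derive.
assert (R3 : Rbar_lt r' (CV_radius phase_coefR)) by (apply phase_radius_lt; lra).
assert (R4 : Rbar_lt r' (CV_radius (PS_derive phase_coefR))) by now rewrite CV_radius_derive.
assert (W : forall x, Rbar_lt r' x -> Rbar_lt r x).
{ intros x Hx; eapply Rbar_le_lt_trans; [|exact Hx]; simpl; lra. }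
pose proof (CV_radius_mult _ _ r r' Hr R3 R2) as M1.
pose proof (CV_radius_mult _ _ r r' Hr R4 R1) as M2.
assert (M3 : Rbar_lt r (CV_radius (PS_plus (PS_mult phase_coefR (PS_derive root_coef))
   (PS_mult phase_coefR (PS_derive root_coef))))).
{ eapply Rbar_lt_le_trans; [|apply CV_radius_plus]; now apply Rbar_min_case. }
pose proof (CPSeries_ext _ _ t phase_root_coefs) as E.
rewrite CPSeries_zero, (CPSeries_plus _ _ r), (CPSeries_plus _ _ r), !(CPSeries_mult _ _ r) in E;
  try apply Rle_refl; auto.
rewrite <- E; ring.
Qed.

Lemma root_squared (t : C) : (Cmod t < 1 / 2)%R -> Sphase t * (Groot t * Groot t) = 1.
Proof.
intros Ht.
set (W := fun t => Sphase t * (Groot t * Groot t)).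
assert (E : W t = W 0).
{ apply zero_derivative_segment; intros s Hs.
  replace (0 + s * (t - 0)) with (s * t) by ring.
  assert (Hst : (Cmod (s * t) < 1 / 2)%R).
  { rewrite Cmod_mult, Cmod_R, Rabs_pos_eq by lra; pose proof (Cmod_ge_0 t); nra. }
  set (r := ((Cmod (s * t) + 1 / 2) / 2)%R).
  assert (D1 : der Cid (CPSeries root_coef) (s * t) (CPSeries (PS_derive root_coef) (s * t)))
    by (apply (der_CPSeries _ r); [apply root_radius_lt; unfold r; lra|unfold r; lra]).
  assert (D2 : der Cid (CPSeries phase_coefR) (s * t) (CPSeries (PS_derive phase_coefR) (s * t)))
    by (apply (der_CPSeries _ r); [apply phase_radius_lt; unfold r; lra|unfold r; lra]).
  eapply der_eq; [|apply der_mult; [exact D2|apply der_mult; exact D1]].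
  cbv beta.
  transitivity (Groot (s * t) * (2 * (Sphase (s * t) * CPSeries (PS_derive root_coef) (s * t))
     + CPSeries (PS_derive phase_coefR) (s * t) * Groot (s * t))); [ring|].
  rewrite root_ode by easy; ring. }
fold (W t); rewrite E; unfold W.
rewrite !CPSeries_0 by (first [apply root_radius_lt|apply phase_radius_lt]; lra).
rewrite root_coef_0; unfold phase_coefR; simpl.
replace (2 * 1 / (1 + 1))%R with 1%R by field; ring.
Qed.

(** This is the derivative 2 t / (1 + t) of t^2 S(t) = 2 phi(1 + t), divided by t. The factor i + 2
    cancels the denominators and leaves the geometric series of 2 (-1)^n. *)
Lemma phase_derivative (t : C) : (Cmod t < 1)%R ->
  (1 + t) * (2 * Sphase t + t * CPSeries (PS_derive phase_coefR) t) = 2.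
Proof.
intros Ht; set (r := Cmod t) in *.
assert (R3 : Rbar_lt r (CV_radius phase_coefR)) by (now apply phase_radius_lt).
set (q := PS_incr_1 (PS_derive phase_coefR)).
assert (Rq : Rbar_lt r (CV_radius q)) by (unfold q; now rewrite CV_radius_incr_1, CV_radius_derive).
set (e := PS_plus (PS_plus phase_coefR phase_coefR) q).
assert (R6 : Rbar_lt r (CV_radius (PS_plus phase_coefR phase_coefR))).
{ eapply Rbar_lt_le_trans; [|apply CV_radius_plus]; now apply Rbar_min_case. }
assert (Re : Rbar_lt r (CV_radius e)).
{ eapply Rbar_lt_le_trans; [|apply CV_radius_plus]; now apply Rbar_min_case. }
assert (En : forall n, e n = (2 * (-1) ^ n)%R).
{ intros [|n]; unfold e, q, PS_plus, PS_incr_1, PS_derive, plus, zero; simpl.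
  - unfold phase_coefR; simpl; field.
  - unfold phase_coefR.
    assert (INR (S n + 2) <> 0%R) by (apply not_0_INR; lia).
    change (match n with 0%nat => 1%R | S _ => (INR n + 1)%R end) with (INR (S n)).
    assert (E : INR (S n) = (INR (S n + 2) - 2)%R) by (rewrite plus_INR; simpl INR at 3; ring).
    rewrite E; simpl pow; field; easy. }
pose proof (CPSeries_decr e r t Re (Rle_refl _)) as E1.
assert (E2 : CPSeries (PS_decr_1 e) t = - CPSeries e t).
{ assert (Rd : Rbar_lt r (CV_radius (PS_decr_1 e))) by now rewrite CV_radius_decr_1.
  pose proof (CPSeries_plus _ _ r t Rd Re (Rle_refl _)) as E.
  rewrite (CPSeries_ext _ (fun _ => 0%R)), CPSeries_zero in E.
  - apply Ceq_minus; rewrite E; ring.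
  - intros n; unfold PS_plus, PS_decr_1, plus; simpl; rewrite !En; simpl; ring. }
assert (E3 : CPSeries e t = 2 * Sphase t + t * CPSeries (PS_derive phase_coefR) t).
{ unfold e; rewrite (CPSeries_plus _ _ r), (CPSeries_plus _ _ r) by (try apply Rle_refl; auto).
  rewrite (CPSeries_decr q r t Rq (Rle_refl _)).
  replace (q 0%nat) with 0%R by easy.
  rewrite (CPSeries_ext (PS_decr_1 q) (PS_derive phase_coefR)) by easy; ring. }
rewrite <- E3.
rewrite E2, En in E1; simpl in E1; rewrite Rmult_1_r in E1.
transitivity (CPSeries e t + t * CPSeries e t); [ring|]; rewrite E1 at 1; ring.
Qed.

Lemma sqrt2_sq : RtoC (sqrt 2) * RtoC (sqrt 2) = 2.
Proof. rewrite <- RtoC_mult, sqrt_sqrt by lra; easy. Qed.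

Lemma sqrt2_bounds : (14 / 10 < sqrt 2 < 15 / 10)%R.
Proof.
pose proof (sqrt_pos 2); pose proof (sqrt_sqrt 2 ltac:(lra)); split; nra.
Qed.

Section Local.
Variables (delta0 : R) (U0 : C -> Prop) (lam laminv : C -> C).
Hypothesis hlam : local_coordinate delta0 U0 lam laminv.

(** On U_0, phi is the square of [laminv], hence differentiable; the value of the derivative follows
    from e^{w - 1 - phi w} = w. So [Carg] need not be differentiated. *)
Lemma der_phi z : U0 z -> der Cid phi z (1 - / z).
Proof.
destruct hlam as (_ & HU & _ & Hslit & (B1 & B2 & B3 & B4) & Hphi & _).
intros Hz.
assert (Hz0 : z <> 0) by now apply slit_plane_neq_0, Hslit.
destruct (open_disk U0 z HU Hz) as (d & Hd & HdU).
destruct (B4 z Hz) as [m Hm]; apply Cder_of_is_derive in Hm.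
assert (Hp : der Cid phi z (m * laminv z + laminv z * m)).
{ apply (der_ext_loc Cid (fun w => laminv w * laminv w)); [|now apply der_mult].
  exists d; split; [easy|]; intros w Hw; specialize (HdU w Hw).
  destruct (B2 w HdU) as [H1 H2]; rewrite <- H2 at 3; rewrite Hphi by easy; simpl; ring. }
revert Hp; generalize (m * laminv z + laminv z * m) as L; intros L Hp.
assert (Hz1 : der Cid (fun w => Cexp (w - 1 - phi w)) z (z * (1 - 0 - L))).
{ eapply der_eq; [|apply der_Cexp, der_minus; [apply der_minus; [apply der_id|apply der_const]|exact Hp]].
  cbv beta; replace (z - 1 - phi z) with (Clog z) by (unfold phi; ring); now rewrite Cexp_Clog. }
assert (Hz2 : der Cid (fun w => Cexp (w - 1 - phi w)) z 1).
{ apply (der_ext_loc Cid (fun w => w)); [|apply der_id].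
  exists d; split; [easy|]; intros w Hw; specialize (HdU w Hw).
  replace (w - 1 - phi w) with (Clog w) by (unfold phi; ring).
  symmetry; apply Cexp_Clog, slit_plane_neq_0, Hslit, HdU. }
pose proof (der_unique _ _ _ _ Hz1 Hz2) as E.
apply (der_eq Cid phi z L); [|exact Hp].
replace L with (/ z * (z - z * (1 - 0 - L))) by (field; auto).
rewrite E; field; auto.
Qed.

Lemma two_phi z rho : (rho <= 1 / 2)%R -> (forall w, (Cmod (w - 1) < rho)%R -> U0 w) ->
  (Cmod (z - 1) < rho)%R -> 2 * phi z = (z - 1) * (z - 1) * Sphase (z - 1).
Proof.
intros Hrho HU Hz.
assert (Hslit : forall z, U0 z -> slit_plane z) by apply hlam.
set (W := fun w => 2 * phi w - (w - 1) * (w - 1) * Sphase (w - 1)).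
assert (E : W z = W 1).
{ apply zero_derivative_segment; intros s Hs.
  set (w := 1 + s * (z - 1)).
  assert (Hw : (Cmod (w - 1) < rho)%R).
  { unfold w; replace (1 + s * (z - 1) - 1) with (s * (z - 1)) by ring.
    rewrite Cmod_mult, Cmod_R, Rabs_pos_eq by lra; pose proof (Cmod_ge_0 (z - 1)); nra. }
  pose proof (HU w Hw) as HUw; pose proof (slit_plane_neq_0 w (Hslit w HUw)) as Hw0.
  assert (Dt : der Cid (fun w => w - 1) w 1).
  { eapply der_eq; [|apply der_minus; [apply der_id|apply der_const]]; ring. }
  set (r := ((Cmod (w - 1) + 1) / 2)%R).
  assert (D2 : der Cid (fun w => Sphase (w - 1)) w (CPSeries (PS_derive phase_coefR) (w - 1) * 1)).
  { apply (der_comp Cid (CPSeries phase_coefR)); [|exact Dt].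
    apply (der_CPSeries _ r); [apply phase_radius_lt; unfold r; lra|unfold r; lra]. }
  eapply der_eq; [|apply der_minus; [apply der_scal, der_phi, HUw|
    apply der_mult; [apply der_mult; exact Dt|exact D2]]].
  cbv beta.
  pose proof (phase_derivative (w - 1) ltac:(lra)) as P.
  replace (1 + (w - 1)) with w in P by ring.
  transitivity ((w - 1) * / w * (2 - w * (2 * Sphase (w - 1) + (w - 1) * CPSeries (PS_derive phase_coefR) (w - 1))));
    [field; auto|rewrite P; ring]. }
assert (W1 : W 1 = 0).
{ unfold W; replace (phi 1) with (RtoC 0); [ring|].
  symmetry; apply injective_projections.
  - pose proof (Re_phi 1) as H; rewrite Cmod_1, ln_1 in H; unfold Re in H; rewrite H; simpl; ring.
  - pose proof (Im_phi 1) as H; destruct descent_path_1 as (_ & Ha & _); rewrite Ha in H.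
    unfold Im in H; rewrite H; simpl; ring. }
rewrite W1 in E; apply Ceq_minus; exact E.
Qed.

Lemma local_facts : exists b : R, (0 < b <= 1 / 2)%R /\
  forall xi, (Cmod xi <= 2 * b)%R ->
    (Cmod xi < delta0)%R /\
    (Cmod (lam xi - 1) < 1 / 4)%R /\
    (Cmod (lam xi - 1 - RtoC (sqrt 2) * xi) <= Cmod xi / 10)%R /\
    (Cmod (Groot (lam xi - 1) - 1) <= 1 / 10)%R /\
    RtoC (sqrt 2) * xi * Groot (lam xi - 1) = lam xi - 1 /\
    der Cid lam xi (lam xi * (RtoC (sqrt 2) / Groot (lam xi - 1))).
Proof.
destruct hlam as (Hd0 & HU & HU1 & Hslit & (B1 & B2 & B3 & B4) & Hphi & Hl0 & Hl').
apply Cder_of_is_derive in Hl'.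
destruct (open_disk U0 1 HU HU1) as (rho0 & Hrho0 & HrhoU).
set (rho := Rmin rho0 (1 / 4)).
assert (Hrho : (0 < rho)%R) by (apply Rmin_pos; lra).
assert (Hrho1 : (rho <= rho0)%R) by apply Rmin_l.
assert (Hrho2 : (rho <= 1 / 4)%R) by apply Rmin_r.
assert (G0 : Groot 0 = 1) by (rewrite CPSeries_0, root_coef_0 by (apply root_radius_lt; lra); easy).
assert (CG : cont Cid (fun xi => Groot (lam xi - 1)) 0).
{ apply (cont_comp Cid (CPSeries root_coef)).
  - rewrite Hl0; replace (1 - 1) with (RtoC 0) by ring.
    eapply der_cont, (der_CPSeries _ (1 / 4)); [apply root_radius_lt; lra|rewrite Cmod_0; lra].
  - apply cont_minus; [eapply der_cont, Hl'|apply cont_const]. }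
destruct (nb_and _ _ _ _ (Hl' (1 / 10)%R ltac:(lra))
  (nb_and _ _ _ _ (CG (1 / 10)%R ltac:(lra)) (der_cont _ _ _ _ Hl' rho Hrho))) as (d & Hd & H).
(* With this b the condition |xi| <= 2 b stays inside both discs; it covers the box |Re xi| <= b,
   |Im xi| <= b / 2 used later. *)
set (b := Rmin (1 / 2) (Rmin d delta0 / 4)).
assert (Hb : (0 < b)%R) by (apply Rmin_pos; [lra|]; pose proof (Rmin_pos _ _ Hd Hd0); lra).
exists b; split; [split; [easy|apply Rmin_l]|].
intros xi Hxi.
assert (Hxi2 : (Cmod xi < d /\ Cmod xi < delta0)%R).
{ pose proof (Rmin_r (1 / 2) (Rmin d delta0 / 4)); fold b in H0.
  pose proof (Rmin_l d delta0); pose proof (Rmin_r d delta0).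
  pose proof (Rmin_pos _ _ Hd Hd0); lra. }
destruct Hxi2 as [Hxd Hxd0].
destruct (H xi) as (H1 & H2 & H3); [replace (xi - 0) with xi by ring; easy|].
rewrite Hl0 in H1, H2, H3.
replace (1 - 1) with (RtoC 0) in H2 by ring; rewrite G0 in H2.
replace (xi - 0) with xi in H1 by ring.
set (z := lam xi) in *; set (t := z - 1) in *.
replace (t - xi * sqrt 2) with (t - sqrt 2 * xi) in H1 by ring.
pose proof sqrt2_bounds as S2; pose proof (Cmod_ge_0 xi) as Hx0.
assert (Hdisk : disk 0 delta0 xi) by (unfold disk; replace (xi - 0) with xi by ring; easy).
assert (Ephi : phi z = xi * xi) by (unfold z; rewrite Hphi by easy; simpl; ring).
assert (Ht12 : (Cmod t < 1 / 2)%R) by lra.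
(* Both sides have the same square by [two_phi] and [root_squared]. The opposite sign would bound 2
   sqrt 2 |xi| by (sqrt 2 + 1) |xi| / 10, which leaves only xi = 0. *)
assert (Key : RtoC (sqrt 2) * xi * Groot t = t).
{ pose proof (two_phi z rho ltac:(lra) ltac:(intros w Hw; apply HrhoU; lra) H3) as T2.
  fold t in T2; rewrite Ephi in T2.
  pose proof (root_squared t Ht12) as R2.
  set (y := RtoC (sqrt 2) * xi * Groot t) in *.
  assert (Fac : (y - t) * (y + t) = 0).
  { transitivity (RtoC (sqrt 2) * RtoC (sqrt 2) * (xi * xi) * (Groot t * Groot t) - t * t);
      [unfold y; ring|].
    rewrite sqrt2_sq, T2.
    transitivity (t * t * (Sphase t * (Groot t * Groot t)) - t * t); [ring|rewrite R2; ring]. }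
  destruct (Ceq_dec (y - t) 0) as [E|N]; [now apply Ceq_minus|].
  assert (E : y + t = 0).
  { replace (y + t) with (/ (y - t) * ((y - t) * (y + t))) by (field; auto); rewrite Fac; ring. }
  assert (E2 : 2 * (RtoC (sqrt 2) * xi)
    = - (RtoC (sqrt 2) * xi * (Groot t - 1)) - (t - RtoC (sqrt 2) * xi)).
  { transitivity (y + t - RtoC (sqrt 2) * xi * (Groot t - 1) - (t - RtoC (sqrt 2) * xi));
      [unfold y; ring|rewrite E; ring]. }
  apply (f_equal Cmod) in E2.
  pose proof (Cmod_triangle (- (RtoC (sqrt 2) * xi * (Groot t - 1))) (- (t - RtoC (sqrt 2) * xi))) as Tr.
  fold (Cminus (- (RtoC (sqrt 2) * xi * (Groot t - 1))) (t - RtoC (sqrt 2) * xi)) in Tr.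
  rewrite <- E2, !Cmod_opp, !Cmod_mult, !Cmod_R, !Rabs_pos_eq in Tr by lra.
  assert (P : (sqrt 2 * Cmod xi * Cmod (Groot t - 1) <= sqrt 2 * Cmod xi * (1 / 10))%R)
    by (apply Rmult_le_compat_l; [apply Rmult_le_pos; lra|lra]).
  assert (Z : Cmod xi = 0%R) by nra.
  apply Cmod_eq_0 in Z; subst xi; exfalso; apply N.
  unfold y, t, z; rewrite Hl0; ring. }
split; [easy|]; split; [lra|]; split; [lra|]; split; [lra|]; split; [exact Key|].
assert (HG : Groot t <> 0).
{ intros E; rewrite E in H2; replace (0 - 1) with (- (1)) in H2 by ring.
  rewrite Cmod_opp, Cmod_1 in H2; lra. }
(* Differentiating phi (lam xi) = xi^2 determines lam' except at the critical point, where the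
   normalization of the coordinate supplies it. *)
destruct (Ceq_dec xi 0) as [E0|N0].
- assert (Ez : z = 1) by (unfold z; now rewrite E0).
  assert (Et : t = 0) by (unfold t; rewrite Ez; ring).
  rewrite Et, G0, Ez, E0.
  eapply der_eq; [|exact Hl']; field.
- assert (Hex : exists l : C, der Cid lam xi l)
    by (destruct (B3 xi Hdisk) as [l Hl]; exists l; now apply Cder_of_is_derive).
  destruct Hex as [l Hl].
  pose proof (proj1 (B1 xi Hdisk)) as HUz; fold z in HUz.
  assert (Hz0 : z <> 0) by now apply slit_plane_neq_0, Hslit.
  pose proof (der_comp Cid phi lam xi l (1 - / z) (der_phi z HUz) Hl) as D1.
  assert (D2 : der Cid (fun x => phi (lam x)) xi (2 * xi)).
  { apply (der_ext_loc Cid (fun x => x * x)).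
    - exists (delta0 - Cmod xi)%R; split; [lra|]; intros w Hw.
      rewrite Hphi; [simpl; ring|]; unfold disk; replace (w - 0) with w by ring.
      pose proof (Cmod_le_sub w xi); lra.
    - eapply der_eq; [|apply der_mult; apply der_id]; cbv beta; ring. }
  pose proof (der_unique _ _ _ _ D1 D2) as E.
  apply (der_eq Cid lam xi l); [|exact Hl].
  assert (Ht : t <> 0).
  { intros Et; rewrite Et in Key.
    apply N0; replace xi with (/ (RtoC (sqrt 2) * Groot t) * (RtoC (sqrt 2) * xi * Groot t)).
    - rewrite Et, Key; ring.
    - field; split; [easy|]; intros C; apply RtoC_inj in C; lra. }
  assert (Elt : t * l = 2 * xi * z).
  { transitivity (z * ((1 - / z) * l)); [unfold t; field; auto|rewrite E; ring]. }
  assert (Hs2 : RtoC (sqrt 2) <> 0) by (intros C; apply RtoC_inj in C; lra).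
  assert (Elt' : RtoC (sqrt 2) * xi * Groot t * l = 2 * xi * z) by (rewrite Key; exact Elt).
  assert (E5 : l = 2 * z / (RtoC (sqrt 2) * Groot t)).
  { replace l with (/ (RtoC (sqrt 2) * xi * Groot t) * (RtoC (sqrt 2) * xi * Groot t * l)) by (field; auto).
    rewrite Elt'; field; auto. }
  rewrite E5, <- sqrt2_sq; field; auto.
Qed.

End Local.

(** * The remainder *)

Lemma mean_value_lower (g g' : R -> R) (u v L : R) : (u <= v)%R ->
  (forall x, (u <= x <= v)%R -> is_derive g x (g' x)) ->
  (forall x, (u <= x <= v)%R -> (L <= g' x)%R) -> (L * (v - u) <= g v - g u)%R.
Proof.
intros Huv Hd HL.
destruct (MVT_gen g u v g') as (c & Hc & E).
- rewrite Rmin_left, Rmax_right by lra; intros; apply Hd; lra.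
- rewrite Rmin_left, Rmax_right by lra; intros x Hx.
  apply continuity_pt_filterlim, (ex_derive_continuous g); exists (g' x); now apply Hd.
- rewrite Rmin_left, Rmax_right in Hc by lra; rewrite E.
  apply Rmult_le_compat_r; [lra|now apply HL].
Qed.

(** One term of degree k + 1 of the exponential series. The factor n on the left is there to absorb
    sqrt(2 pi n) and the power of n lost in the bound on the Stirling defect. *)
Lemma exp_decay (c : R) (k : nat) : (0 < c)%R ->
  exists K, (0 <= K)%R /\ forall n, (1 <= n)%nat ->
    (INR n * exp (- (INR n * c)) <= K / INR n ^ k)%R.
Proof.
intros Hc; exists (INR (fact (S k)) / c ^ S k)%R.
assert (Hck : (0 < c ^ S k)%R) by now apply pow_lt.
pose proof (INR_fact_lt_0 (S k)) as Hf.
split; [apply Rlt_le, Rdiv_lt_0_compat; easy|]; intros n Hn.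
assert (Hn1 : (1 <= INR n)%R) by (apply (le_INR 1); lia).
set (x := (INR n * c)%R); assert (Hx : (0 < x)%R) by (apply Rmult_lt_0_compat; lra).
assert (He : (x ^ S k / INR (fact (S k)) <= exp x)%R).
{ pose proof (exp_sum_R_le (S (S k)) x ltac:(lra)) as H.
  change (exp_sum (S (S k)) x) with (exp_sum (S k) x + RtoC x ^ S k / RtoC (INR (fact (S k)))) in H.
  rewrite <- RtoC_pow, <- RtoC_div in H by lra.
  replace (Re (exp_sum (S k) x + RtoC (x ^ S k / INR (fact (S k)))))
    with (Re (exp_sum (S k) x) + x ^ S k / INR (fact (S k)))%R in H by reflexivity.
  pose proof (exp_sum_R_nonneg (S k) x ltac:(lra)); lra. }
assert (Hnk : (0 < INR n ^ k)%R) by (apply pow_lt; lra).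
apply Rmult_le_reg_r with (INR n ^ k * exp x)%R; [apply Rmult_lt_0_compat; [easy|apply exp_pos]|].
rewrite exp_Ropp.
replace (INR n * / exp x * (INR n ^ k * exp x))%R with (INR n ^ S k)%R
  by (simpl; field; apply Rgt_not_eq, exp_pos).
replace (INR (fact (S k)) / c ^ S k / INR n ^ k * (INR n ^ k * exp x))%R
  with (INR (fact (S k)) / c ^ S k * exp x)%R by (field; split; lra).
apply Rle_trans with (INR (fact (S k)) / c ^ S k * (x ^ S k / INR (fact (S k))))%R.
- right; unfold x; rewrite Rpow_mult_distr; field; split; lra.
- apply Rmult_le_compat_l; [|easy]; apply Rlt_le, Rdiv_lt_0_compat; easy.
Qed.

Lemma Re_sq (xi : C) : Re (xi * xi) = (Re xi * Re xi - Im xi * Im xi)%R.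
Proof. reflexivity. Qed.

(* The winding number of an admissible curve about the points lam (x, y). *)
Definition side (x : R) : C := if Rlt_dec x 0 then RtoC 1 else RtoC 0.

Section Remainder.
Variables (lam : C -> C) (b : R).
Hypothesis Hb : (0 < b <= 1 / 2)%R.
Hypothesis Hloc : forall xi, (Cmod xi <= 2 * b)%R ->
    (Cmod (lam xi - 1) < 1 / 4)%R /\
    (Cmod (lam xi - 1 - RtoC (sqrt 2) * xi) <= Cmod xi / 10)%R /\
    (Cmod (Groot (lam xi - 1) - 1) <= 1 / 10)%R /\
    RtoC (sqrt 2) * xi * Groot (lam xi - 1) = lam xi - 1 /\
    der Cid lam xi (lam xi * (RtoC (sqrt 2) / Groot (lam xi - 1))).
Hypothesis Hphi : forall xi, (Cmod xi <= 2 * b)%R -> phi (lam xi) = xi * xi.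

(** The logarithmic derivative of [lam]. Its closeness to sqrt 2 gives a real part at least 1, which
    later fixes the sign of the slope along the real axis. *)
Let ell (xi : C) : C := RtoC (sqrt 2) / Groot (lam xi - 1).

Lemma Cmod_pair (x y : R) : (Cmod (x, y) <= Rabs x + Rabs y)%R.
Proof.
replace (x, y) with (RtoC x + Ci * RtoC y) by (apply injective_projections; simpl; ring).
eapply Rle_trans; [apply Cmod_triangle|]; rewrite Cmod_mult, Cmod_Ci, !Cmod_R; lra.
Qed.

Lemma box_small (x y : R) : (Rabs x <= b)%R -> (Rabs y <= b / 2)%R -> (Cmod (x, y) <= 2 * b)%R.
Proof. intros; pose proof (Cmod_pair x y); lra. Qed.

Lemma lam_neq_0 xi : (Cmod xi <= 2 * b)%R -> lam xi <> 0.
Proof.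
intros H E; destruct (Hloc xi H) as (H1 & _); rewrite E in H1.
replace (0 - 1) with (- (1)) in H1 by ring; rewrite Cmod_opp, Cmod_1 in H1; lra.
Qed.

Lemma lam_Cmod xi : (Cmod xi <= 2 * b)%R -> (Cmod (lam xi) <= 5 / 4)%R.
Proof.
intros H; destruct (Hloc xi H) as (H1 & _).
pose proof (Cmod_le_sub (lam xi) 1) as T; rewrite Cmod_1 in T; lra.
Qed.

Lemma Groot_neq_0 xi : (Cmod xi <= 2 * b)%R -> Groot (lam xi - 1) <> 0.
Proof.
intros H E; destruct (Hloc xi H) as (_ & _ & H1 & _); rewrite E in H1.
replace (0 - 1) with (- (1)) in H1 by ring; rewrite Cmod_opp, Cmod_1 in H1; lra.
Qed.

Lemma ell_bounds xi : (Cmod xi <= 2 * b)%R -> (Cmod (ell xi) <= 2)%R /\ (1 <= Re (ell xi))%R.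
Proof.
intros H; destruct (Hloc xi H) as (_ & _ & H1 & _); pose proof (Groot_neq_0 xi H) as HG.
unfold ell; set (G := Groot (lam xi - 1)) in *; pose proof sqrt2_bounds.
assert (HGm : (9 / 10 <= Cmod G)%R).
{ pose proof (Cmod_le_sub 1 G) as T; rewrite Cmod_1, Cmod_sym in T; lra. }
assert (Hi : (/ Cmod G <= 10 / 9)%R).
{ replace (10 / 9)%R with (/ (9 / 10))%R by field; apply Rinv_le_contravar; lra. }
assert (Hi0 : (0 < / Cmod G)%R) by (apply Rinv_0_lt_compat; lra).
split.
- rewrite Cmod_div, Cmod_R, Rabs_pos_eq by (try easy; lra); unfold Rdiv; nra.
- assert (D : (Cmod (RtoC (sqrt 2) / G - RtoC (sqrt 2)) <= 2 / 10)%R).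
  { replace (RtoC (sqrt 2) / G - RtoC (sqrt 2)) with (- (RtoC (sqrt 2) * ((G - 1) * / G))) by (field; auto).
    rewrite Cmod_opp, !Cmod_mult, Cmod_inv, Cmod_R, Rabs_pos_eq by (try easy; lra).
    assert (Cmod (G - 1) * / Cmod G <= 1 / 10 * (10 / 9))%R
      by (apply Rmult_le_compat; try apply Cmod_ge_0; lra).
    assert (0 <= Cmod (G - 1) * / Cmod G)%R by (apply Rmult_le_pos; [apply Cmod_ge_0|lra]).
    nra. }
  pose proof (Re_le_Cmod (- (RtoC (sqrt 2) / G - RtoC (sqrt 2)))) as R1; rewrite Cmod_opp in R1.
  replace (Re (- (RtoC (sqrt 2) / G - RtoC (sqrt 2)))) with (sqrt 2 - Re (RtoC (sqrt 2) / G))%R in R1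
    by (unfold Re; simpl; ring).
  lra.
Qed.

Lemma lam_right y : (Rabs y <= b / 2)%R -> (1 < Re (lam (b, y)))%R.
Proof.
intros Hy.
assert (Hx : (Cmod (b, y) <= 2 * b)%R) by (apply box_small; [rewrite Rabs_pos_eq; lra|easy]).
destruct (Hloc _ Hx) as (_ & H1 & _); pose proof sqrt2_bounds.
pose proof (Re_le_Cmod (- (lam (b, y) - 1 - RtoC (sqrt 2) * (b, y)))) as R1; rewrite Cmod_opp in R1.
replace (Re (- (lam (b, y) - 1 - RtoC (sqrt 2) * (b, y)))) with (1 + sqrt 2 * b - Re (lam (b, y)))%R in R1
  by (unfold Re; simpl; ring).
nra.
Qed.

(** The linear part has modulus at most 1 - b, by |y| <= b / 2 and b <= 1 / 2, and the error |xi| /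
    10 is less than b. *)
Lemma lam_left y : (Rabs y <= b / 2)%R -> (Cmod (lam ((- b)%R, y)) < 1)%R.
Proof.
intros Hy.
assert (Hx : (Cmod ((- b)%R, y) <= 2 * b)%R) by (apply box_small; [rewrite Rabs_Ropp, Rabs_pos_eq; lra|easy]).
destruct (Hloc _ Hx) as (_ & H1 & _); pose proof sqrt2_bounds as S2.
set (w := 1 + RtoC (sqrt 2) * ((- b)%R, y)).
assert (Hw : (Cmod w <= 1 - b)%R).
{ apply Rsqr_incr_0; [|apply Cmod_ge_0|lra].
  unfold Rsqr; replace (Cmod w * Cmod w)%R with (Cmod w ^ 2)%R by ring; rewrite Cmod2_alt.
  replace (Re w) with (1 - sqrt 2 * b)%R by (unfold w, Re; simpl; ring).
  replace (Im w) with (sqrt 2 * y)%R by (unfold w, Im; simpl; ring).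
  pose proof (sqrt_sqrt 2 ltac:(lra)) as S.
  assert (y * y <= b / 2 * (b / 2))%R.
  { rewrite <- (Rabs_mult_self y) || idtac.
    pose proof (Rsqr_abs y) as A; unfold Rsqr in A; rewrite A; pose proof (Rabs_pos y); nra. }
  replace ((1 - sqrt 2 * b) ^ 2 + (sqrt 2 * y) ^ 2)%R
    with (1 - 2 * sqrt 2 * b + (sqrt 2 * sqrt 2) * (b * b) + (sqrt 2 * sqrt 2) * (y * y))%R by ring.
  rewrite S; nra. }
pose proof (Cmod_triangle w (lam ((- b)%R, y) - 1 - RtoC (sqrt 2) * ((- b)%R, y))) as T.
replace (w + (lam ((- b)%R, y) - 1 - RtoC (sqrt 2) * ((- b)%R, y))) with (lam ((- b)%R, y)) in T
  by (unfold w; ring).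
lra.
Qed.

(* Where Re phi is not too negative, z escapes from the curve along the horizontal line in
   the local coordinate and then along a ray, on which Re phi stays positive. *)
Lemma winding_dichotomy (gam : R -> C) (Hadm : admissible gam) : exists mu K, (0 < mu)%R /\ (0 <= K)%R /\
  forall x y, (0 < Rabs x <= b / 2)%R -> (Rabs y <= b / 2)%R -> ~ on_curve gam (lam (x, y)) ->
    winding_number gam (lam (x, y)) = side x \/
    ((x * x - y * y <= - mu)%R /\ (Cmod (winding_number gam (lam (x, y))) <= K)%R).
Proof.
pose proof (admissible_closed gam Hadm) as Hcl.
destruct (admissible_sign gam Hadm) as (Hsign & rho & Hrho & Hnear).
destruct (admissible_gap gam Hadm rho Hrho) as (mu & Hmu & Hgap).
destruct (winding_bounded gam Hcl) as [K HK]; [apply Hadm|].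
exists mu, (Rabs K); split; [easy|split; [apply Rabs_pos|]].
intros x y Hx Hy Hz.
destruct (Rle_dec (x * x - y * y) (- mu)) as [L|L].
{ right; split; [easy|]; eapply Rle_trans; [now apply HK|apply Rle_abs]. }
left.
(* A curve point on this segment would have Re phi > - mu, hence lie near 1 and on the descent path.
   Then Im phi = 2 u y = 0 with u nonzero forces y = 0, and Re phi = u^2 > 0 is a contradiction. *)
assert (Hpath : forall x', (0 < x <= x')%R \/ (x' <= x < 0)%R -> (Rabs x' <= b)%R ->
  winding_number gam (lam (x', y)) = winding_number gam (lam (x, y))).
{ intros x' Hxx Hx'.
  apply (zero_derivative_segment (fun xi => winding_number gam (lam xi))); intros s Hs.
  replace ((x, y) + s * ((x', y) - (x, y))) with ((x + s * (x' - x))%R, y)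
    by (apply injective_projections; simpl; ring).
  set (u := (x + s * (x' - x))%R).
  assert (Hu : (x * x <= u * u)%R /\ u <> 0%R /\ (Rabs u <= b)%R).
  { destruct Hxx as [H|H].
    - assert (0 <= s * (x' - x))%R by (apply Rmult_le_pos; lra).
      assert (s * (x' - x) <= 1 * (x' - x))%R by (apply Rmult_le_compat_r; lra).
      rewrite Rabs_pos_eq in Hx' by lra; unfold u; split; [apply Rmult_le_compat; lra|].
      split; [lra|rewrite Rabs_pos_eq; lra].
    - assert (0 <= s * (x - x'))%R by (apply Rmult_le_pos; lra).
      assert (s * (x - x') <= 1 * (x - x'))%R by (apply Rmult_le_compat_r; lra).
      rewrite Rabs_left in Hx' by lra; split; [|split; [unfold u; lra|unfold u; rewrite Rabs_left; lra]].
      replace (x * x)%R with (- x * - x)%R by ring; replace (u * u)%R with (- u * - u)%R by ring.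
      unfold u; apply Rmult_le_compat; lra. }
  destruct Hu as (Hu1 & Hu2 & Hu3).
  assert (Hxi : (Cmod (u, y) <= 2 * b)%R) by (apply box_small; lra).
  destruct (Hloc _ Hxi) as (_ & _ & _ & _ & Hd).
  eapply der_eq; [apply Cmult_0_l|].
  apply (der_comp Cid (winding_number gam)); [|exact Hd].
  apply winding_zero_derivative; [exact Hcl|].
  intros [t Et].
  assert (Ephi : phi (gam t) = (u, y) * (u, y)) by (rewrite Et; now apply Hphi).
  destruct (Hnear t) as (_ & Ha & Hle).
  { apply Rnot_le_lt; intros Hfar; specialize (Hgap t Hfar).
    rewrite Ephi, Re_sq in Hgap; simpl in Hgap; lra. }
  pose proof (Im_phi (gam t)) as Hi; rewrite Ephi in Hi, Hle.
  rewrite Re_sq in Hle; simpl in Hle.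
  replace (Im ((u, y) * (u, y))) with (2 * u * y)%R in Hi by (unfold Im; simpl; ring).
  assert (Huy : (u * y = 0)%R) by lra.
  destruct (Rmult_integral _ _ Huy); [easy|subst y; nra]. }
assert (Hyy : (y * y <= b / 2 * (b / 2))%R).
{ pose proof (Rsqr_abs y) as A; unfold Rsqr in A; rewrite A; pose proof (Rabs_pos y); nra. }
unfold side; destruct (Rlt_dec x 0) as [Hneg|Hpos].
- rewrite Rabs_left in Hx by lra.
  rewrite <- (Hpath (- b)%R) by (try rewrite Rabs_Ropp, Rabs_pos_eq; lra).
  assert (Hxi : (Cmod ((- b)%R, y) <= 2 * b)%R)
    by (apply box_small; [rewrite Rabs_Ropp, Rabs_pos_eq; lra|lra]).
  apply winding_inside; [exact Hadm|now apply lam_neq_0|now apply lam_left|].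
  rewrite (Hphi _ Hxi), Re_sq; simpl; nra.
- rewrite Rabs_pos_eq in Hx by lra.
  rewrite <- (Hpath b) by (try rewrite Rabs_pos_eq; lra).
  assert (Hxi : (Cmod (b, y) <= 2 * b)%R) by (apply box_small; [rewrite Rabs_pos_eq; lra|lra]).
  apply winding_outside; [exact Hadm| |].
  + pose proof (lam_right y Hy); pose proof (Re_le_Cmod (lam (b, y))); lra.
  + rewrite (Hphi _ Hxi), Re_sq; simpl; nra.
Qed.

Variables (n m : nat).
Hypothesis Hn : (1 <= n)%nat.

Let sn : R := sqrt (2 * PI * INR n).
Let nC : C := RtoC (INR n).

Definition gsum (k : nat) (z : C) : C := Csum (fun j => gfun j z / RtoC (INR n) ^ j) k.

(* [n] times the error of the [m]-term Stirling series. *)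
Definition stirling_defect : R :=
  (INR n * (sqrt (2 * PI * INR n) * stirling_ratio n - 1)
   - Re (Csum (fun j => RtoC (gcoefR j 1 / INR n ^ j)) m))%R.

(** The integrating factor e^{-n xi^2} removes the homogeneous term of the differential equation, so
    that the derivative is an explicit function. *)
Definition remainder (xi : C) : C :=
  (F_out n (lam xi) - h (- Ci * RtoC (sqrt (INR n)) * xi) - / RtoC (sqrt (2 * PI * INR n)) * gsum (S m) (lam xi))
  * Cexp (- (RtoC (INR n) * (xi * xi))).

Definition remainder_slope (xi : C) : C :=
  / RtoC (sqrt (2 * PI * INR n)) *
  (RtoC (sqrt 2) / Groot (lam xi - 1) *
    (RtoC stirling_defect - lam xi * gfun' m (lam xi) / RtoC (INR n) ^ m))
  * Cexp (- (RtoC (INR n) * (xi * xi))).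

Lemma INR_n_ge_1 : (1 <= INR n)%R.
Proof. apply (le_INR 1); lia. Qed.

Lemma nC_neq_0 : nC <> 0.
Proof. now apply INR_C_neq_0. Qed.

Lemma sn_eq : sn = (sqrt 2 * sqrt PI * sqrt (INR n))%R.
Proof.
pose proof PI_RGT_0; pose proof INR_n_ge_1.
unfold sn; rewrite !sqrt_mult by (first [lra|apply Rmult_le_pos; lra]); easy.
Qed.

Lemma sn_ge_1 : (1 <= sn)%R.
Proof.
rewrite <- sqrt_1; apply sqrt_le_1_alt; pose proof PI2_3_2; pose proof INR_n_ge_1; nra.
Qed.

Lemma sn_C_neq_0 : RtoC sn <> 0.
Proof. intros E; apply RtoC_inj in E; pose proof sn_ge_1; lra. Qed.

(** The sum telescopes: by [gfun_rec] the term n (z - 1) g_{j+1} / n^{j+1} cancels z g_j' / n^j up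
    to the constant g_j'(1) / n^j. The first term, the last derivative and the constants are left
    over. *)
Lemma gsum_ode (z : C) : (Cmod (z - 1) < 1 / 2)%R ->
  nC * (z - 1) * gsum (S m) z - z * Csum (fun j => gfun' j z / nC ^ j) (S m)
  = nC * (z - 1) * gfun 0 z - z * gfun' m z / nC ^ m - Csum (fun j => RtoC (gcoefR j 1) / nC ^ j) m.
Proof.
intros Hz; pose proof nC_neq_0 as Hn0; unfold gsum; fold nC.
clear sn; induction m as [|k IH].
- simpl; field.
- change (Csum (fun j => gfun j z / nC ^ j) (S (S k)))
    with (Csum (fun j => gfun j z / nC ^ j) (S k) + gfun (S k) z / nC ^ S k).
  change (Csum (fun j => gfun' j z / nC ^ j) (S (S k)))
    with (Csum (fun j => gfun' j z / nC ^ j) (S k) + gfun' (S k) z / nC ^ S k).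
  change (Csum (fun j => RtoC (gcoefR j 1) / nC ^ j) (S k))
    with (Csum (fun j => RtoC (gcoefR j 1) / nC ^ j) k + RtoC (gcoefR k 1) / nC ^ k).
  pose proof (Cpow_nz nC k Hn0) as Hk.
  transitivity (nC * (z - 1) * Csum (fun j => gfun j z / nC ^ j) (S k) -
     z * Csum (fun j => gfun' j z / nC ^ j) (S k)
     + ((z - 1) * gfun (S k) z) / nC ^ k - z * (gfun' (S k) z / nC ^ S k)).
  { rewrite Cpow_S; field; auto. }
  rewrite IH, (gfun_rec k z Hz), Cpow_S; field; auto.
Qed.

Lemma der_remainder xi : (Cmod xi <= 2 * b)%R -> Re xi <> 0%R ->
  der Cid remainder xi (remainder_slope xi).
Proof.
intros Hxi Hre.
destruct (Hloc xi Hxi) as (H1 & _ & _ & Hkey & Hder).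
pose proof (Groot_neq_0 xi Hxi) as HG; pose proof (lam_neq_0 xi Hxi) as Hz0.
pose proof nC_neq_0 as Hn0; pose proof sn_C_neq_0 as Hsn.
pose proof INR_n_ge_1 as Hn1.
set (z := lam xi) in *; set (G := Groot (z - 1)) in *.
set (zeta := - Ci * RtoC (sqrt (INR n)) * xi).
assert (Hsq : (0 < sqrt (INR n))%R) by (apply sqrt_lt_R0; lra).
assert (HIm : Im zeta <> 0%R).
{ replace (Im zeta) with (- (sqrt (INR n) * Re xi))%R by (unfold zeta, Im, Re; simpl; ring).
  apply Ropp_neq_0_compat, Rmult_integral_contrapositive; split; lra. }
assert (D1 : der Cid (fun xi => F_out n (lam xi)) xi
  ((INR n * (z - 1) * F_out n z + INR n * stirling_ratio n) / z * (z * (RtoC (sqrt 2) / G)))).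
{ apply (der_comp Cid (F_out n)); [now apply der_F_out|exact Hder]. }
assert (D2 : der Cid (fun xi => h (- Ci * RtoC (sqrt (INR n)) * xi)) xi
  ((- (2 * zeta) * h zeta + Ci / RtoC (sqrt PI)) * (- Ci * RtoC (sqrt (INR n))))).
{ apply (der_comp Cid h (fun xi => - Ci * RtoC (sqrt (INR n)) * xi)); [now apply der_h|].
  eapply der_eq; [|apply der_scal, der_id]; ring. }
assert (D3 : der Cid (fun xi => gsum (S m) (lam xi)) xi
  (Csum (fun j => gfun' j z / nC ^ j) (S m) * (z * (RtoC (sqrt 2) / G)))).
{ apply (der_comp Cid (gsum (S m))); [|exact Hder].
  apply (der_Csum Cid (fun j z => gfun j z / nC ^ j)); intros j _.
  eapply der_eq; [|apply (der_mult Cid (gfun j) (fun _ => / nC ^ j)); [apply der_gfun; fold z; lra|apply der_const]].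
  unfold z, Cdiv; ring. }
assert (D4 : der Cid (fun xi => Cexp (- (RtoC (INR n) * (xi * xi)))) xi
   (Cexp (- (RtoC (INR n) * (xi * xi))) * - (RtoC (INR n) * (1 * xi + xi * 1)))).
{ apply (der_Cexp Cid (fun xi => - (RtoC (INR n) * (xi * xi)))).
  apply (der_opp Cid (fun xi => RtoC (INR n) * (xi * xi))), (der_scal Cid _ (fun xi => xi * xi)).
  apply (der_mult Cid Cid Cid); apply der_id. }
unfold remainder.
eapply der_eq; [|apply der_mult; [apply der_minus; [apply der_minus; [exact D1|exact D2]|apply der_scal, D3]|exact D4]].
cbv beta; fold z zeta; unfold remainder_slope; fold z; fold G; fold nC.
set (E := Cexp (- (nC * (xi * xi)))).
assert (Hz2 : (Cmod (z - 1) < 1 / 2)%R) by lra.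
pose proof (gsum_ode z Hz2) as Ode.
(* This is g_0 = 1 / y - 1 / t in terms of G = t / y. *)
assert (EG : G = 1 + (z - 1) * gfun 0 z).
{ unfold G, gfun; rewrite (CPSeries_decr root_coef (1 / 4) (z - 1)) by (try apply root_radius_lt; lra).
  rewrite root_coef_0; f_equal; f_equal; now apply CPSeries_ext. }
assert (Hs2 : RtoC (sqrt 2) <> 0) by (intros C; apply RtoC_inj in C; pose proof sqrt2_bounds; lra).
assert (HsP : RtoC (sqrt PI) <> 0) by (intros C; apply RtoC_inj in C; pose proof (sqrt_lt_R0 PI PI_RGT_0); lra).
assert (Hss : RtoC (sqrt (INR n)) * RtoC (sqrt (INR n)) = nC).
{ rewrite <- RtoC_mult, sqrt_sqrt by lra; easy. }
assert (Hi2 : Ci * Ci = -1) by (apply injective_projections; simpl; ring).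
assert (Esd : RtoC stirling_defect = nC * (RtoC sn * stirling_ratio n - 1)
   - Csum (fun j => RtoC (gcoefR j 1) / nC ^ j) m).
{ unfold stirling_defect; fold sn; rewrite RtoC_minus, RtoC_mult, RtoC_minus, RtoC_mult, <- Csum_RtoC.
  f_equal; apply Csum_ext; intros j _.
  rewrite RtoC_div, RtoC_pow by (apply pow_nonzero; lra); easy. }
assert (Ezz : (- (2 * zeta) * h zeta + Ci / RtoC (sqrt PI)) * (- Ci * RtoC (sqrt (INR n)))
  = 2 * nC * xi * h zeta + RtoC (sqrt (INR n)) / RtoC (sqrt PI)).
{ rewrite <- Hss.
  transitivity (- (2 * (Ci * Ci) * (RtoC (sqrt (INR n)) * RtoC (sqrt (INR n))) * xi * h zeta)
    - (Ci * Ci) * RtoC (sqrt (INR n)) / RtoC (sqrt PI)); [unfold zeta; field; auto|].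
  rewrite Hi2; field; auto. }
rewrite Ezz, Esd.
set (X := gsum (S m) z) in *; set (Y := Csum (fun j => gfun' j z / nC ^ j) (S m)) in *.
set (W := Csum (fun j => RtoC (gcoefR j 1) / nC ^ j) m) in *.
set (H0 := h zeta); set (Fo := F_out n z).
fold sn.
(* In the coordinate xi the homogeneous coefficients for [F_out] and for h agree, so both functions
   drop out. *)
assert (Exi : 2 * xi = (z - 1) * (RtoC (sqrt 2) / G)).
{ rewrite <- Hkey at 1; rewrite <- sqrt2_sq; field; auto. }
(* The inhomogeneous term of h, scaled by sqrt(2 pi n), is sqrt 2 n; it meets the leading term of
   the Stirling ratio. *)
assert (Esn : RtoC sn * (RtoC (sqrt (INR n)) / RtoC (sqrt PI)) = RtoC (sqrt 2) * nC).
{ rewrite sn_eq, !RtoC_mult, <- Hss; field; auto. }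
assert (Etz : (z - 1) * gfun 0 z = G - 1) by (rewrite EG; ring).
transitivity (/ RtoC sn * (RtoC (sqrt 2) / G * (nC * RtoC sn * stirling_ratio n
    + (nC * (z - 1) * X - z * Y)) - RtoC sn * (RtoC (sqrt (INR n)) / RtoC (sqrt PI))) * E).
- transitivity (((nC * (2 * xi) * Fo + nC * stirling_ratio n * (RtoC (sqrt 2) / G))
    - (nC * (2 * xi) * H0 + RtoC (sqrt (INR n)) / RtoC (sqrt PI)) - / RtoC sn * (Y * (z * (RtoC (sqrt 2) / G)))) * E
    - (Fo - H0 - / RtoC sn * X) * (E * (nC * (2 * xi)))).
  + rewrite Exi at 1; unfold nC; field; auto.
  + rewrite Exi; field; auto.
- rewrite Esn, Ode.
  replace (nC * (z - 1) * gfun 0 z) with (nC * ((z - 1) * gfun 0 z)) by ring; rewrite Etz.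
  pose proof (Cpow_nz nC m Hn0); field; auto.
Qed.

Lemma Cmod_gaussian (xi : C) :
  Cmod (Cexp (- (RtoC (INR n) * (xi * xi)))) = exp (- (INR n * Re (xi * xi))).
Proof. rewrite Cmod_Cexp; f_equal; unfold Re; simpl; ring. Qed.

(** * Bounds on the remainder and on the Stirling defect *)

Section Bounds.
Variables (Mg Ms : R).
Hypothesis HMg0 : (0 <= Mg)%R.
Hypothesis HMs0 : (0 <= Ms)%R.
Hypothesis HMg : forall z, (Cmod (z - 1) <= 1 / 4)%R -> (Cmod (gfun' m z) <= Mg)%R.
Hypothesis HMs : forall z, (Cmod (z - 1) <= 1 / 4)%R -> (Cmod (gsum (S m) z) <= Ms)%R.

(** The crude bound at Re xi = b and Re xi = - b: 1 for F, 1 / b for h, Ms for the truncated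
    expansion. *)
Let B0 : R := (1 + / b + Ms)%R.
(** The amplitude of the slope. It also bounds what a horizontal segment adds, as the segments used
    have length at most 1. *)
Let q : R := (/ sn * (2 * (Rabs stirling_defect + 2 * Mg / INR n ^ m)))%R.

Lemma pow_n_pos : (0 < INR n ^ m)%R.
Proof. apply pow_lt; pose proof INR_n_ge_1; lra. Qed.

Lemma inv_sn_bounds : (0 < / sn <= 1)%R.
Proof.
pose proof sn_ge_1; split; [apply Rinv_0_lt_compat; lra|].
rewrite <- Rinv_1; apply Rinv_le_contravar; lra.
Qed.

Lemma q_nonneg : (0 <= q)%R.
Proof.
unfold q; pose proof inv_sn_bounds; pose proof pow_n_pos; pose proof (Rabs_pos stirling_defect).
assert (0 <= 2 * Mg / INR n ^ m)%R by (apply Rmult_le_pos; [lra|left; now apply Rinv_0_lt_compat]).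
apply Rmult_le_pos; lra.
Qed.

Lemma B0_nonneg : (0 <= B0)%R.
Proof. unfold B0; assert (0 < / b)%R by (apply Rinv_0_lt_compat; lra); lra. Qed.

Lemma slope_term_bound xi : (Cmod xi <= 2 * b)%R ->
  (Cmod (ell xi * (lam xi * gfun' m (lam xi) / RtoC (INR n) ^ m)) <= 4 * Mg / INR n ^ m)%R.
Proof.
intros Hxi; destruct (ell_bounds xi Hxi) as [H1 _]; pose proof (lam_Cmod xi Hxi) as H2.
destruct (Hloc xi Hxi) as (H3 & _).
pose proof pow_n_pos as Hp; pose proof INR_n_ge_1.
pose proof (HMg (lam xi) ltac:(lra)) as H4.
rewrite Cmod_mult, Cmod_div, Cmod_mult, Cmod_pow, Cmod_R, Rabs_pos_eq
  by (try (apply Cpow_nz, nC_neq_0); lra).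
unfold Rdiv; rewrite <- Rmult_assoc; apply Rmult_le_compat_r; [left; now apply Rinv_0_lt_compat|].
pose proof (Cmod_ge_0 (gfun' m (lam xi))); pose proof (Cmod_ge_0 (lam xi)); pose proof (Cmod_ge_0 (ell xi)).
assert (Cmod (lam xi) * Cmod (gfun' m (lam xi)) <= 5 / 4 * Mg)%R by (apply Rmult_le_compat; lra).
apply Rle_trans with (2 * (5 / 4 * Mg))%R; [|lra].
apply Rmult_le_compat; try lra; now apply Rmult_le_pos.
Qed.

Lemma slope_bound xi : (Cmod xi <= 2 * b)%R ->
  (Cmod (remainder_slope xi) <= q * exp (- (INR n * Re (xi * xi))))%R.
Proof.
intros Hxi; destruct (ell_bounds xi Hxi) as [H1 _].
pose proof (slope_term_bound xi Hxi) as H2; pose proof sn_ge_1.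
unfold remainder_slope; rewrite Cmod_mult, Cmod_gaussian.
apply Rmult_le_compat_r; [left; apply exp_pos|].
unfold q; fold sn; rewrite Cmod_mult, Cmod_inv, Cmod_R, Rabs_pos_eq by (try apply sn_C_neq_0; lra).
apply Rmult_le_compat_l; [left; apply inv_sn_bounds|].
fold (ell xi).
replace (ell xi * (RtoC stirling_defect - lam xi * gfun' m (lam xi) / RtoC (INR n) ^ m))
  with (ell xi * RtoC stirling_defect + - (ell xi * (lam xi * gfun' m (lam xi) / RtoC (INR n) ^ m))) by ring.
eapply Rle_trans; [apply Cmod_triangle|]; rewrite Cmod_opp, Cmod_mult, Cmod_R.
pose proof (Rabs_pos stirling_defect); pose proof (Cmod_ge_0 (ell xi)); unfold Rdiv in *; nra.
Qed.

Lemma h_term_bound xi : Re xi = b \/ Re xi = (- b)%R ->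
  (Cmod (h (- Ci * RtoC (sqrt (INR n)) * xi)) <= / b)%R.
Proof.
intros Hre; pose proof INR_n_ge_1.
assert (Hs : (1 <= sqrt (INR n))%R) by (rewrite <- sqrt_1; apply sqrt_le_1_alt; lra).
set (zeta := - Ci * RtoC (sqrt (INR n)) * xi).
assert (HIm : Im zeta = (- (sqrt (INR n) * Re xi))%R) by (unfold zeta, Im, Re; simpl; ring).
assert (HA : (b <= Rabs (Im zeta))%R).
{ rewrite HIm, Rabs_Ropp, Rabs_mult, (Rabs_pos_eq (sqrt (INR n))) by lra.
  destruct Hre as [-> | ->]; rewrite ?Rabs_Ropp, Rabs_pos_eq by lra; nra. }
eapply Rle_trans; [apply h_bound|apply Rinv_le_contravar; lra].
intros E; rewrite E, Rabs_R0 in HA; lra.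
Qed.

Lemma gsum_term_bound xi : (Cmod xi <= 2 * b)%R ->
  (Cmod (/ RtoC (sqrt (2 * PI * INR n)) * gsum (S m) (lam xi)) <= Ms)%R.
Proof.
intros Hxi; destruct (Hloc xi Hxi) as (H3 & _).
pose proof (HMs (lam xi) ltac:(lra)) as H4; pose proof inv_sn_bounds; pose proof sn_ge_1.
fold sn; rewrite Cmod_mult, Cmod_inv, Cmod_R, Rabs_pos_eq by (try apply sn_C_neq_0; lra).
pose proof (Cmod_ge_0 (gsum (S m) (lam xi))); nra.
Qed.

Lemma remainder_right_end y : (Rabs y <= b / 2)%R ->
  (Cmod (remainder (b, y)) <= B0 * exp (- (INR n * Re ((b, y) * (b, y)))))%R.
Proof.
intros Hy.
assert (Hx : (Cmod (b, y) <= 2 * b)%R) by (apply box_small; [rewrite Rabs_pos_eq; lra|easy]).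
unfold remainder; rewrite Cmod_mult, Cmod_gaussian.
apply Rmult_le_compat_r; [left; apply exp_pos|].
pose proof (lam_right y Hy) as H1; pose proof (Re_le_Cmod (lam (b, y))).
pose proof (F_out_bound n (lam (b, y)) ltac:(lra)) as H2.
pose proof (h_term_bound (b, y) (or_introl eq_refl)) as H3.
pose proof (gsum_term_bound (b, y) Hx) as H4.
unfold Cminus; eapply Rle_trans; [apply Cmod_triangle|]; rewrite Cmod_opp.
eapply Rle_trans; [apply Rplus_le_compat_r, Cmod_triangle|]; rewrite Cmod_opp; unfold B0; lra.
Qed.

(** The summand 1 is e^{n phi} times the integrating factor: to the left of the path F has winding
    number 1, and [F_in_bound] applies. *)
Lemma remainder_left_end y : (Rabs y <= b / 2)%R ->
  (Cmod (remainder ((- b)%R, y) + 1) <= B0 * exp (- (INR n * Re (((- b)%R, y) * ((- b)%R, y)))))%R.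
Proof.
intros Hy.
set (xi := ((- b)%R, y) : C).
assert (Hx : (Cmod xi <= 2 * b)%R) by (apply box_small; [rewrite Rabs_Ropp, Rabs_pos_eq; lra|easy]).
assert (E : remainder xi + 1 = (Cexp (RtoC (INR n) * phi (lam xi)) + F_out n (lam xi)
   - h (- Ci * RtoC (sqrt (INR n)) * xi) - / RtoC (sqrt (2 * PI * INR n)) * gsum (S m) (lam xi))
  * Cexp (- (RtoC (INR n) * (xi * xi)))).
{ rewrite (Hphi xi Hx); unfold remainder; rewrite Cexp_opp.
  pose proof (Cexp_neq_0 (RtoC (INR n) * (xi * xi))).
  pose proof sn_C_neq_0 as Hs; unfold sn in Hs; field; auto. }
rewrite E, Cmod_mult, Cmod_gaussian.
apply Rmult_le_compat_r; [left; apply exp_pos|].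
pose proof (lam_left y Hy) as H1; fold xi in H1.
pose proof (F_in_bound n (lam xi) (lam_neq_0 xi Hx) ltac:(lra)) as H2.
pose proof (h_term_bound xi (or_intror eq_refl)) as H3.
pose proof (gsum_term_bound xi Hx) as H4.
unfold Cminus; eapply Rle_trans; [apply Cmod_triangle|]; rewrite Cmod_opp.
eapply Rle_trans; [apply Rplus_le_compat_r, Cmod_triangle|]; rewrite Cmod_opp; unfold B0; lra.
Qed.

(* Moving away from the line [Re xi = 0] along a horizontal segment only decreases |exp (- n xi^2)|. *)
Lemma remainder_transport (c : C) (x x' y : R) :
  (0 < x <= x')%R \/ (x' <= x < 0)%R -> (Rabs x' <= b)%R -> (Rabs y <= b / 2)%R ->
  (Cmod ((remainder (x', y) + c) - (remainder (x, y) + c))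
    <= q * exp (- (INR n * (x * x - y * y))))%R.
Proof.
intros Hx Hx' Hy.
assert (Hxx : (Rabs (x' - x) <= 1)%R).
{ apply Rabs_le; destruct Hx; [rewrite Rabs_pos_eq in Hx' by lra|rewrite Rabs_left in Hx' by lra]; lra. }
set (M := (q * exp (- (INR n * (x * x - y * y))))%R).
assert (HM : (0 <= M)%R) by (apply Rmult_le_pos; [apply q_nonneg|left; apply exp_pos]).
apply Rle_trans with (M * Cmod ((x', y) - (x, y)))%R.
2:{ replace ((x', y) - (x, y)) with (RtoC (x' - x)) by (apply injective_projections; simpl; ring).
    rewrite Cmod_R; nra. }
apply (mean_value_segment (fun xi => remainder xi + c)
  (fun t => remainder_slope ((x, y) + RtoC t * ((x', y) - (x, y))))).
- intros t Ht.
  replace ((x, y) + t * ((x', y) - (x, y))) with ((x + t * (x' - x))%R, y)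
    by (apply injective_projections; simpl; ring).
  eapply der_eq; [|apply der_plus; [apply der_remainder|apply der_const]].
  + ring.
  + apply box_small; [|easy]; apply Rabs_le.
    destruct Hx; [rewrite Rabs_pos_eq in Hx' by lra|rewrite Rabs_left in Hx' by lra]; nra.
  + simpl; destruct Hx; nra.
- intros t Ht.
  replace ((x, y) + t * ((x', y) - (x, y))) with ((x + t * (x' - x))%R, y)
    by (apply injective_projections; simpl; ring).
  eapply Rle_trans; [apply slope_bound|].
  + apply box_small; [|easy]; apply Rabs_le.
    destruct Hx; [rewrite Rabs_pos_eq in Hx' by lra|rewrite Rabs_left in Hx' by lra]; nra.
  + unfold M; apply Rmult_le_compat_l; [apply q_nonneg|].
    rewrite Re_sq; simpl Re; simpl Im.
    set (u := (x + t * (x' - x))%R).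
    assert (Hu : (x * x <= u * u)%R).
    { destruct Hx as [Hx | Hx].
      - assert (0 <= t * (x' - x))%R by (apply Rmult_le_pos; lra).
        unfold u; apply Rmult_le_compat; lra.
      - assert (0 <= t * (x - x'))%R by (apply Rmult_le_pos; lra).
        replace (x * x)%R with (- x * - x)%R by ring; replace (u * u)%R with (- u * - u)%R by ring.
        unfold u; apply Rmult_le_compat; lra. }
    pose proof INR_n_ge_1.
    assert (Hle : (- (INR n * (u * u - y * y)) <= - (INR n * (x * x - y * y)))%R) by nra.
    destruct (Rle_lt_or_eq_dec _ _ Hle) as [L|E]; [left; now apply exp_increasing|rewrite E; lra].
Qed.

(** x^2 <= b^2 / 4 leaves a surplus of 3/4 b^2 in the exponent. *)
Lemma end_decay (x y : R) : (Rabs x <= b / 2)%R ->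
  (exp (- (INR n * (b * b - y * y)))
    <= exp (- (INR n * (x * x - y * y))) * exp (- (INR n * (3 / 4 * (b * b)))))%R.
Proof.
intros Hx; rewrite <- exp_plus; pose proof INR_n_ge_1.
assert (Hxx : (x * x <= b / 2 * (b / 2))%R).
{ pose proof (Rsqr_abs x) as A; unfold Rsqr in A; rewrite A; pose proof (Rabs_pos x); nra. }
assert (Hle : (- (INR n * (b * b - y * y)) <= - (INR n * (x * x - y * y)) + - (INR n * (3 / 4 * (b * b))))%R) by nra.
destruct (Rle_lt_or_eq_dec _ _ Hle) as [L|E]; [left; now apply exp_increasing|rewrite E; lra].
Qed.

(** The comparison is with the end on the same side of Re xi = 0, so the line on which h jumps is
    never crossed. *)
Lemma remainder_bound (x y : R) : (0 < Rabs x <= b / 2)%R -> (Rabs y <= b / 2)%R ->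
  (Cmod (remainder (x, y) + side x)
    <= exp (- (INR n * (x * x - y * y))) * (B0 * exp (- (INR n * (3 / 4 * (b * b)))) + q))%R.
Proof.
intros Hx Hy; pose proof (end_decay x y ltac:(lra)) as Hd; pose proof B0_nonneg as HB.
assert (Hfin : forall x' c, (0 < x <= x')%R \/ (x' <= x < 0)%R -> (Rabs x' <= b)%R -> (x' * x' = b * b)%R ->
  (Cmod (remainder (x', y) + c) <= B0 * exp (- (INR n * Re ((x', y) * (x', y)))))%R ->
  (Cmod (remainder (x, y) + c)
    <= exp (- (INR n * (x * x - y * y))) * (B0 * exp (- (INR n * (3 / 4 * (b * b)))) + q))%R).
{ intros x' c H1 H2 H3 H4.
  rewrite Re_sq in H4; simpl Re in H4; simpl Im in H4; rewrite H3 in H4.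
  pose proof (remainder_transport c x x' y H1 H2 Hy) as H5.
  pose proof (Cmod_le_sub (remainder (x, y) + c) (remainder (x', y) + c)) as T; rewrite Cmod_sym in T.
  assert (B0 * exp (- (INR n * (b * b - y * y)))
    <= B0 * (exp (- (INR n * (x * x - y * y))) * exp (- (INR n * (3 / 4 * (b * b))))))%R
    by now apply Rmult_le_compat_l.
  lra. }
unfold side; destruct (Rlt_dec x 0) as [L|L].
- rewrite Rabs_left in Hx by lra.
  apply (Hfin (- b)%R); [right; lra|rewrite Rabs_Ropp, Rabs_pos_eq; lra|ring|].
  now apply remainder_left_end.
- rewrite Rabs_pos_eq in Hx by lra.
  apply (Hfin b); [left; lra|rewrite Rabs_pos_eq; lra|ring|].
  rewrite Cplus_0_r; now apply remainder_right_end.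
Qed.

(** [F_out], the expansion and the Gaussian factor are continuous at 0; the whole jump comes from h
    and equals 1. Symmetric points are compared because h carries no boundary value on the line
    itself. *)
Lemma remainder_jump e : (0 < e)%R -> exists eta0, (0 < eta0)%R /\
  forall eta, (0 < eta < eta0)%R ->
    (Cmod (remainder (RtoC eta) - remainder (RtoC (- eta)) - 1) <= e)%R.
Proof.
intros He.
assert (H0 : (Cmod (RtoC 0) <= 2 * b)%R) by (rewrite Cmod_0; lra).
destruct (Hloc 0 H0) as (L1 & _ & _ & _ & L5).
set (A := fun xi => F_out n (lam xi) - / RtoC (sqrt (2 * PI * INR n)) * gsum (S m) (lam xi)).
assert (CA : cont Cid A 0).
{ assert (Cl : cont Cid lam 0) by (eapply der_cont; exact L5).
  apply cont_minus.
  - apply (cont_comp Cid (F_out n)); [|exact Cl].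
    eapply der_cont, der_F_out; [exact Hn|now apply lam_neq_0].
  - apply cont_mult; [apply cont_const|].
    apply (cont_Csum Cid (fun j xi => gfun j (lam xi) / RtoC (INR n) ^ j)); intros j _.
    apply cont_mult; [|apply cont_const].
    apply (cont_comp Cid (gfun j)); [|exact Cl].
    eapply der_cont, der_gfun; lra. }
set (E := fun xi : C => Cexp (- (RtoC (INR n) * (xi * xi)))).
assert (E0 : E 0 = 1).
{ unfold E; rewrite <- Cexp_0; f_equal; ring. }
assert (CE : cont Cid E 0).
{ apply cont_Cexp, cont_opp, cont_mult; [apply cont_const|apply cont_mult; apply cont_id]. }
destruct (nb_and _ _ _ _ (CA (e / 8)%R ltac:(lra)) (CE (e / 4)%R ltac:(lra))) as (d & Hd & H).
set (s := sqrt (INR n)).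
assert (Hs : (0 < s)%R) by (apply sqrt_lt_R0; pose proof INR_n_ge_1; lra).
exists (Rmin d (e / (32 * s))); split.
{ apply Rmin_pos; [easy|apply Rdiv_lt_0_compat; lra]. }
intros eta Heta.
assert (Hed : (eta < d)%R) by (eapply Rlt_le_trans; [apply Heta|apply Rmin_l]).
assert (Hes : (eta * (32 * s) < e)%R).
{ apply Rlt_le_trans with (e / (32 * s) * (32 * s))%R; [|right; field; lra].
  apply Rmult_lt_compat_r; [lra|]; eapply Rlt_le_trans; [apply Heta|apply Rmin_r]. }
destruct (H (RtoC eta)) as [A1 B1]; [rewrite Cmod_RtoC_sub, Rminus_0_r, Rabs_pos_eq; lra|].
destruct (H (RtoC (- eta))) as [A2 _]; [rewrite Cmod_RtoC_sub, Rminus_0_r, Rabs_left; lra|].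
rewrite E0 in B1.
pose proof (h_jump (s * eta) ltac:(nra)) as J.
set (k := h (Ci * RtoC (s * eta)) - h (- Ci * RtoC (s * eta))) in *.
assert (Er : remainder (RtoC eta) - remainder (RtoC (- eta)) - 1
  = ((A (RtoC eta) - A 0) + - (A (RtoC (- eta)) - A 0)) * E (RtoC eta) + (k - 1) * E (RtoC eta) + (E (RtoC eta) - 1)).
{ unfold remainder; fold s.
  replace (Cexp (- (RtoC (INR n) * (RtoC (- eta) * RtoC (- eta))))) with (E (RtoC eta))
    by (unfold E; rewrite RtoC_opp; f_equal; ring).
  replace (- Ci * RtoC s * RtoC (- eta)) with (Ci * RtoC (s * eta)) by (rewrite RtoC_opp, RtoC_mult; ring).
  replace (- Ci * RtoC s * RtoC eta) with (- Ci * RtoC (s * eta)) by (rewrite RtoC_mult; ring).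
  fold (E (RtoC eta)); unfold A, k; ring. }
assert (HE1 : (Cmod (E (RtoC eta)) <= 1)%R).
{ unfold E; rewrite Cmod_gaussian, <- exp_0.
  pose proof INR_n_ge_1; rewrite Re_sq; simpl; left; apply exp_increasing; nra. }
rewrite Er.
eapply Rle_trans; [apply Cmod_triangle|].
eapply Rle_trans; [apply Rplus_le_compat_r, Cmod_triangle|]; rewrite !Cmod_mult.
pose proof (Cmod_triangle (A (RtoC eta) - A 0) (- (A (RtoC (- eta)) - A 0))) as T; rewrite Cmod_opp in T.
pose proof (Cmod_ge_0 (A (RtoC eta) - A 0 + - (A (RtoC (- eta)) - A 0))).
pose proof (Cmod_ge_0 (k - 1)); pose proof (Cmod_ge_0 (E (RtoC eta))).
assert (Q1 : (Cmod (A (RtoC eta) - A 0 + - (A (RtoC (- eta)) - A 0)) * Cmod (E (RtoC eta)) <= e / 4 * 1)%R)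
  by (apply Rmult_le_compat; lra).
assert (Q2 : (Cmod (k - 1) * Cmod (E (RtoC eta)) <= e / 4 * 1)%R) by (apply Rmult_le_compat; lra).
lra.
Qed.

(** Along the real axis from - b to b the remainder starts near -1, jumps by 1 and ends near 0, so
    its slope has an exponentially small integral. Up to the term with [Mg] the slope is the defect
    times a positive Gaussian weight. *)
Lemma stirling_defect_bound :
  (Rabs stirling_defect * b
    <= 24 * B0 * (INR n * exp (- (INR n * (b * b)))) + 16 * Mg * (INR n / INR n ^ m))%R.
Proof.
set (delta := stirling_defect).
pose proof INR_n_ge_1 as Hn1; pose proof sn_ge_1 as Hsn; pose proof pow_n_pos as Hp.
pose proof inv_sn_bounds as His.
set (s := sqrt (INR n)).
assert (Hs1 : (1 <= s)%R) by (unfold s; rewrite <- sqrt_1; apply sqrt_le_1_alt; lra).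
assert (Hss : (s * s = INR n)%R) by (apply sqrt_sqrt; lra).
set (w := (4 * Mg / INR n ^ m)%R).
assert (Hw : (0 <= w)%R) by (apply Rmult_le_pos; [lra|left; now apply Rinv_0_lt_compat]).
assert (Hsg : exists sg, (sg = 1 \/ sg = -1)%R /\ (sg * delta = Rabs delta)%R).
{ destruct (Rle_dec 0 delta).
  - exists 1%R; rewrite Rabs_pos_eq by easy; split; [now left|ring].
  - exists (-1)%R; rewrite Rabs_left by lra; split; [now right|ring]. }
destruct Hsg as (sg & Hsg & Hsd).
(* The sign makes the contribution of the defect to the slope nonnegative. *)
set (g := fun x : R => (sg * Re (remainder (RtoC x)))%R).
set (g' := fun x : R => (sg * Re (remainder_slope (RtoC x)))%R).
assert (Hin : forall x, (Rabs x <= b)%R -> (Cmod (RtoC x) <= 2 * b)%R) by (intros; rewrite Cmod_R; lra).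
assert (Dg : forall x, x <> 0%R -> (Rabs x <= b)%R -> is_derive g x (g' x)).
{ intros x Hx Hxb; apply is_derive_scal.
  apply (der_Re_Im (fun x => remainder (RtoC x))).
  eapply der_eq; [|apply (der_comp RtoC remainder RtoC); [apply der_remainder; [now apply Hin|exact Hx]|apply der_id]].
  ring. }
assert (Lg : forall x c, (Rabs x <= b)%R -> (0 <= c)%R -> (c <= exp (- (INR n * (x * x))))%R ->
  (/ sn * (c * Rabs delta - w) <= g' x)%R).
{ intros x c Hx Hc0 Hc; unfold g', remainder_slope; fold sn.
  destruct (ell_bounds (RtoC x) (Hin x Hx)) as [_ E1].
  pose proof (slope_term_bound (RtoC x) (Hin x Hx)) as E2; fold w in E2.
  fold (ell (RtoC x)).
  set (l := ell (RtoC x)) in *; set (v := lam (RtoC x) * gfun' m (lam (RtoC x)) / RtoC (INR n) ^ m) in *.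
  set (ex := exp (- (INR n * (x * x)))) in *.
  assert (Eex : Cexp (- (RtoC (INR n) * (RtoC x * RtoC x))) = RtoC ex).
  { rewrite <- !RtoC_mult, <- RtoC_opp, Cexp_RtoC; easy. }
  rewrite Eex, <- RtoC_inv by lra.
  replace (Re (RtoC (/ sn) * (l * (RtoC stirling_defect - v)) * RtoC ex))
    with (/ sn * ex * (Re l * delta - Re (l * v)))%R by (unfold delta, Re; simpl; ring).
  pose proof (re_le_Cmod (l * v)) as R1.
  assert (R2 : (sg * Re (l * v) <= w)%R).
  { pose proof (Rle_abs (Re (l * v))); pose proof (Rle_abs (- Re (l * v))) as R3; rewrite Rabs_Ropp in R3.
    destruct Hsg as [-> | ->]; lra. }
  assert (Hex1 : (ex <= 1)%R).
  { unfold ex; rewrite <- exp_0.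
    destruct (Req_dec x 0) as [->|N]; [right; f_equal; ring|left; apply exp_increasing].
    assert (0 < x * x)%R by nra; nra. }
  replace (sg * (/ sn * ex * (Re l * delta - Re (l * v))))%R
    with (/ sn * (ex * (Re l * (sg * delta) - sg * Re (l * v))))%R by ring.
  rewrite Hsd; apply Rmult_le_compat_l; [lra|].
  pose proof (Rabs_pos delta).
  assert (K1 : (Rabs delta <= Re l * Rabs delta)%R) by nra.
  assert (K2 : (c * Rabs delta <= ex * Rabs delta)%R) by (apply Rmult_le_compat_r; lra).
  assert (K3 : (ex * (Rabs delta - w) <= ex * (Re l * Rabs delta - sg * Re (l * v)))%R)
    by (apply Rmult_le_compat_l; lra).
  nra. }
(* The width of the Gaussian: for |x| <= a the exponent n x^2 is at most b^2 <= 1/4, and the weight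
   exceeds 1/4. *)
set (a := (b / s)%R).
assert (Has : (a * s = b)%R) by (unfold a; field; lra).
assert (Ha0 : (0 < a)%R) by (apply Rdiv_lt_0_compat; lra).
assert (Hab : (a <= b)%R) by nra.
assert (He4 : forall x, (Rabs x <= a)%R -> (1 / 4 <= exp (- (INR n * (x * x))))%R).
{ intros x Hx.
  assert (Hxx : (x * x <= a * a)%R).
  { pose proof (Rsqr_abs x) as A; unfold Rsqr in A; rewrite A; pose proof (Rabs_pos x); nra. }
  assert (Hnx : (INR n * (x * x) <= 1 / 4)%R).
  { apply Rle_trans with (INR n * (a * a))%R; [apply Rmult_le_compat_l; lra|].
    rewrite <- Hss; replace (s * s * (a * a))%R with ((a * s) * (a * s))%R by ring; rewrite Has; nra. }
  pose proof (exp_ineq1_le (- (INR n * (x * x)))); lra. }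
assert (He0 : forall x, (0 <= exp (- (INR n * (x * x))))%R) by (intros; left; apply exp_pos).
(* Lower bounds for the slope: [L1] on the window |x| <= a, [L2] outside it, where the weight is
   merely nonnegative. *)
set (L1 := (/ sn * (1 / 4 * Rabs delta - w))%R); set (L2 := (/ sn * (0 * Rabs delta - w))%R).
set (T := (2 * (B0 * exp (- (INR n * (b * b)))))%R).
assert (Main : (/ sn * (Rabs delta * a / 4 - 2 * w * b) <= T)%R).
{ apply Rnot_lt_le; intros Hlt.
  set (e := (/ sn * (Rabs delta * a / 4 - 2 * w * b) - T)%R) in *.
  destruct (remainder_jump (e / 2)) as (eta0 & Heta0 & Hj); [unfold e; lra|].
  set (eta := (Rmin (a / 2) (eta0 / 2))%R).
  assert (Heta : (0 < eta)%R) by (apply Rmin_pos; lra).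
  assert (Heta1 : (eta <= a / 2)%R) by apply Rmin_l.
  assert (Heta2 : (eta <= eta0 / 2)%R) by apply Rmin_r.
  specialize (Hj eta ltac:(lra)).
  assert (S1 : (L1 * (a - eta) <= g a - g eta)%R).
  { apply (mean_value_lower g g'); [lra| |].
    - intros x Hx; apply Dg; [lra|rewrite Rabs_pos_eq; lra].
    - intros x Hx; apply Lg; [rewrite Rabs_pos_eq; lra|lra|apply He4; rewrite Rabs_pos_eq; lra]. }
  assert (S2 : (L2 * (b - a) <= g b - g a)%R).
  { apply (mean_value_lower g g'); [lra| |].
    - intros x Hx; apply Dg; [lra|rewrite Rabs_pos_eq; lra].
    - intros x Hx; apply Lg; [rewrite Rabs_pos_eq; lra|lra|apply He0]. }
  assert (S3 : (L1 * (- eta - - a) <= g (- eta) - g (- a))%R).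
  { apply (mean_value_lower g g'); [lra| |].
    - intros x Hx; apply Dg; [lra|rewrite Rabs_left; lra].
    - intros x Hx; apply Lg; [rewrite Rabs_left; lra|lra|apply He4; rewrite Rabs_left; lra]. }
  assert (S4 : (L2 * (- a - - b) <= g (- a) - g (- b))%R).
  { apply (mean_value_lower g g'); [lra| |].
    - intros x Hx; apply Dg; [lra|rewrite Rabs_left; lra].
    - intros x Hx; apply Lg; [rewrite Rabs_left; lra|lra|apply He0]. }
  assert (S5 : (g b <= B0 * exp (- (INR n * (b * b))))%R).
  { pose proof (remainder_right_end 0 ltac:(rewrite Rabs_R0; lra)) as R.
    rewrite Re_sq in R; simpl Re in R; simpl Im in R.
    replace (b * b - 0 * 0)%R with (b * b)%R in R by ring.
    change (b, 0%R) with (RtoC b) in R.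
    pose proof (re_le_Cmod (remainder (RtoC b))) as R1.
    pose proof (Rle_abs (Re (remainder (RtoC b)))); pose proof (Rle_abs (- Re (remainder (RtoC b)))) as R2.
    rewrite Rabs_Ropp in R2; unfold g; destruct Hsg as [-> | ->]; lra. }
  assert (S6 : (- (g (- b) + sg) <= B0 * exp (- (INR n * (b * b))))%R).
  { pose proof (remainder_left_end 0 ltac:(rewrite Rabs_R0; lra)) as R.
    rewrite Re_sq in R; simpl Re in R; simpl Im in R.
    replace (- b * - b - 0 * 0)%R with (b * b)%R in R by ring.
    change ((- b)%R, 0%R) with (RtoC (- b)) in R.
    pose proof (re_le_Cmod (remainder (RtoC (- b)) + 1)) as R1.
    replace (Re (remainder (RtoC (- b)) + 1)) with (Re (remainder (RtoC (- b))) + 1)%R in R1 by (unfold Re; simpl; ring).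
    pose proof (Rle_abs (Re (remainder (RtoC (- b))) + 1)); pose proof (Rle_abs (- (Re (remainder (RtoC (- b))) + 1))) as R2.
    rewrite Rabs_Ropp in R2; unfold g; destruct Hsg as [-> | ->]; lra. }
  assert (S7 : (g eta - g (- eta) - sg >= - (e / 2))%R).
  { pose proof (re_le_Cmod (remainder (RtoC eta) - remainder (RtoC (- eta)) - 1)) as R1.
    replace (Re (remainder (RtoC eta) - remainder (RtoC (- eta)) - 1))
      with (Re (remainder (RtoC eta)) - Re (remainder (RtoC (- eta))) - 1)%R in R1 by (unfold Re; simpl; ring).
    set (u := (Re (remainder (RtoC eta)) - Re (remainder (RtoC (- eta))) - 1)%R) in *.
    pose proof (Rle_abs u); pose proof (Rle_abs (- u)) as R2; rewrite Rabs_Ropp in R2.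
    unfold g; unfold u in *; destruct Hsg as [-> | ->]; lra. }
  assert (S8 : (2 * (L1 * (a - eta)) + 2 * (L2 * (b - a)) <= T + e / 2)%R).
  { unfold T; replace (- eta - - a)%R with (a - eta)%R in S3 by ring.
    replace (- a - - b)%R with (b - a)%R in S4 by ring; lra. }
  assert (S9 : (/ sn * (Rabs delta * a / 4 - 2 * w * b) <= 2 * (L1 * (a - eta)) + 2 * (L2 * (b - a)))%R).
  { replace (2 * (L1 * (a - eta)) + 2 * (L2 * (b - a)))%R
      with (/ sn * (Rabs delta * (a - eta) / 2 - 2 * w * (b - eta)))%R by (unfold L1, L2; field; lra).
    apply Rmult_le_compat_l; [lra|]; pose proof (Rabs_pos delta).
    assert (Rabs delta * (a / 2) <= Rabs delta * (a - eta))%R by (apply Rmult_le_compat_l; lra).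
    assert (w * (b - eta) <= w * b)%R by (apply Rmult_le_compat_l; lra).
    lra. }
  unfold e in *; lra. }
(* sqrt(2 pi) <= 3. One factor s = sqrt n comes from this normalization, another from the window of
   width b / s: together the lost factor n. *)
assert (Hsn3 : (sn <= 3 * s)%R).
{ rewrite sn_eq; fold s.
  assert (sqrt 2 * sqrt PI <= 3)%R; [|pose proof Hs1; nra].
  rewrite <- sqrt_mult by (try lra; left; apply PI_RGT_0).
  rewrite <- (sqrt_square 3) by lra; apply sqrt_le_1_alt; pose proof PI_4; lra. }
assert (M2 : (Rabs delta * a / 4 - 2 * w * b <= sn * T)%R).
{ apply Rmult_le_reg_l with (/ sn)%R; [lra|]; rewrite <- Rmult_assoc, Rinv_l, Rmult_1_l by lra; exact Main. }
assert (HT : (0 <= T)%R) by (unfold T; pose proof B0_nonneg; pose proof (exp_pos (- (INR n * (b * b)))); nra).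
assert (M3 : (sn * T <= 3 * s * T)%R) by (apply Rmult_le_compat_r; lra).
assert (M4 : (Rabs delta * a <= 12 * s * T + 8 * w * b)%R) by lra.
assert (M5 : (Rabs delta * b <= s * (12 * s * T + 8 * w * b))%R).
{ replace (Rabs delta * b)%R with (s * (Rabs delta * a))%R by (rewrite <- Has at 1; ring).
  apply Rmult_le_compat_l; lra. }
assert (M6 : (s * (8 * w * b) <= INR n * (4 * w))%R).
{ assert (Hsn1 : (s <= INR n)%R) by nra.
  assert (Hwb : (w * (8 * b) <= w * 4)%R) by (apply Rmult_le_compat_l; lra).
  assert (0 <= 8 * w * b)%R by (apply Rmult_le_pos; [apply Rmult_le_pos|]; lra).
  apply Rmult_le_compat; lra. }
replace (s * (12 * s * T + 8 * w * b))%R with (12 * (s * s) * T + s * (8 * w * b))%R in M5 by ring.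
rewrite Hss in M5.
replace (24 * B0 * (INR n * exp (- (INR n * (b * b)))))%R with (12 * INR n * T)%R by (unfold T; ring).
replace (16 * Mg * (INR n / INR n ^ m))%R with (INR n * (4 * w))%R by (unfold w; field; lra).
lra.
Qed.

End Bounds.

End Remainder.

(** * Assembly of the expansion *)

Lemma gsum_bound k : exists Ms, (0 <= Ms)%R /\ forall n z, (1 <= n)%nat -> (Cmod (z - 1) <= 1 / 4)%R ->
  (Cmod (gsum n k z) <= Ms)%R.
Proof.
induction k as [|k [Ms [H0 H]]].
- exists 0%R; split; [lra|]; intros; unfold gsum; simpl; rewrite Cmod_0; lra.
- destruct (gfun_bound k) as (M & HM0 & HM); exists (Ms + M)%R; split; [lra|]; intros n z Hn Hz.
  change (gsum n (S k) z) with (gsum n k z + gfun k z / RtoC (INR n) ^ k).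
  eapply Rle_trans; [apply Cmod_triangle|]; apply Rplus_le_compat; [now apply H|].
  assert (Hn1 : (1 <= INR n)%R) by (apply (le_INR 1); lia).
  assert (Hp : (1 <= INR n ^ k)%R) by now apply pow_R1_Rle.
  rewrite Cmod_div, Cmod_pow, Cmod_R, Rabs_pos_eq by (try (apply Cpow_nz, INR_C_neq_0; lia); lra).
  destruct (HM z Hz) as [H1 _]; pose proof (Cmod_ge_0 (gfun k z)).
  apply Rmult_le_reg_r with (INR n ^ k)%R; [lra|].
  unfold Rdiv; rewrite Rmult_assoc, Rinv_l, Rmult_1_r by lra.
  rewrite <- (Rmult_1_r (Cmod (gfun k z))); apply Rmult_le_compat; lra.
Qed.

Lemma gterm_bound k n (z : C) r M : (1 <= n)%nat -> (r <= k)%nat -> (Cmod (gfun k z) <= M)%R ->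
  (Cmod (gfun k z / RtoC (INR n) ^ k) <= M / INR n ^ r)%R.
Proof.
intros Hn Hk HM.
assert (Hn1 : (1 <= INR n)%R) by (apply (le_INR 1); lia).
assert (Hp : (0 < INR n ^ r)%R) by (apply pow_lt; lra).
assert (Hpk : (INR n ^ r <= INR n ^ k)%R) by now apply Rle_pow.
rewrite Cmod_div, Cmod_pow, Cmod_R, Rabs_pos_eq by (try (apply Cpow_nz, INR_C_neq_0; lia); lra).
pose proof (Cmod_ge_0 (gfun k z)).
apply Rmult_le_compat; [easy|left; apply Rinv_0_lt_compat; lra|easy|now apply Rinv_le_contravar].
Qed.

Theorem theorem3p3
    (delta0 : R) (U0 : C -> Prop) (lam laminv : C -> C)
    (hlam : local_coordinate delta0 U0 lam laminv) :
  exists (eps : R) (g : nat -> C -> C),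
    (0 < eps)%R /\
    (forall z, disk 1 eps z -> U0 z) /\
    (forall j : nat, holomorphic_on (disk 1 eps) (g j)) /\
    (forall gam : R -> C, admissible gam ->
      forall r : nat,
      exists (K : R) (N : nat),
        forall (n : nat) (z : C),
          (1 <= n)%nat -> (N <= n)%nat ->
          disk 1 eps z -> ~ on_curve gam z -> ~ descent_path z ->
          exists E : C,
            F gam n z =
              P laminv n z +
              / sqrt (2 * PI * INR n) *
              (Csum (fun j => g j z / INR n ^ j) r + E) /\
            (Cmod E <= K / INR n ^ r)%R) /\
    (forall j : nat,
      taylor_coefficients (g j) 1 (fun k => RtoC (Q2R (gcoef j k)))) /\
    (exists M rho : R,
      (0 < rho)%R /\
      forall z, disk 1 rho z ->
        (Cmod (g 0%nat z - (1 / 3 - 1 / 12 * (z - 1)))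
           <= M * Cmod (z - 1) ^ 2)%R).
Proof.
destruct (local_facts delta0 U0 lam laminv hlam) as (b & Hb & Hfacts).
destruct hlam as (Hd0 & HU & HU1 & Hslit & (B1 & B2 & B3 & B4) & Hphi0 & Hl0 & _).
assert (Hloc := fun xi H => proj2 (Hfacts xi H)); cbv beta in Hloc.
assert (Hphi : forall xi, (Cmod xi <= 2 * b)%R -> phi (lam xi) = xi * xi).
{ intros xi Hxi; rewrite Hphi0; [simpl; ring|].
  unfold disk; replace (xi - 0) with xi by ring; now apply Hfacts. }
assert (Hli1 : laminv 1 = 0).
{ rewrite <- Hl0; apply B1; unfold disk; replace (0 - 0) with (RtoC 0) by ring; now rewrite Cmod_0. }
assert (Hcont : cont Cid laminv 1).
{ destruct (B4 1 HU1) as [l Hl]; apply Cder_of_is_derive in Hl; eapply der_cont, Hl. }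
destruct (Hcont (b / 2)%R ltac:(lra)) as (e1 & He1 & Hsmall).
destruct (open_disk U0 1 HU HU1) as (e2 & He2 & HdU).
(* e1 puts the coordinate of z within b / 2, e2 keeps z in U_0, and 1/4 lies inside the common disc
   of convergence. No curve has been introduced yet, so eps and the g_j are independent of gamma. *)
set (eps := Rmin (Rmin e1 e2) (1 / 4)).
assert (Heps : (0 < eps)%R) by (repeat apply Rmin_pos; lra).
assert (Heps1 : (eps <= Rmin e1 e2)%R) by apply Rmin_l.
pose proof (Rmin_l e1 e2); pose proof (Rmin_r e1 e2).
assert (Heps2 : (eps <= 1 / 4)%R) by apply Rmin_r.
exists eps, gfun; split; [easy|].
assert (HepsU : forall z, disk 1 eps z -> U0 z) by (intros z Hz; apply HdU; unfold disk in Hz; lra).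
split; [easy|].
split; [|split; [|split; [exact taylor_gfun|exact gfun_0_bound]]].
{ intros j z Hz; unfold disk in Hz; exists (gfun' j z); apply is_derive_of_Cder, der_gfun; lra. }
intros gam Hadm r.
pose proof (admissible_closed gam Hadm) as Hcl.
destruct (winding_dichotomy lam b Hb Hloc Hphi gam Hadm) as (mu & KW & Hmu & HKW & Hdich).
(* One order more than asked, because the bound on the defect loses a factor n. The surplus terms j
   = r and j = r + 1 go into the error. *)
set (m := S r).
destruct (gfun_bound m) as (Mm & HMm0 & HMm).
destruct (gfun_bound r) as (Mr & HMr0 & HMr).
destruct (gsum_bound (S m)) as (Ms & HMs0 & HMs).
destruct (exp_decay mu r Hmu) as (K1 & HK1 & D1).
destruct (exp_decay (3 / 4 * (b * b)) r) as (K2 & HK2 & D2); [nra|].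
destruct (exp_decay (b * b) r) as (K3 & HK3 & D3); [nra|].
set (B0 := (1 + / b + Ms)%R).
assert (HB0 : (0 <= B0)%R) by (unfold B0; assert (0 < / b)%R by (apply Rinv_0_lt_compat; lra); lra).
(* The summands bound in turn the wrong winding number, the values at the ends, the slope with its
   defect, and the surplus terms. *)
exists (3 * (KW + 1) * K1 + 3 * B0 * K2 + (2 / b * (24 * B0 * K3 + 16 * Mm) + 4 * Mm) + (Mr + Mm))%R, 1%nat.
intros n z Hn _ Hz Hzg Hzd.
unfold disk in Hz.
assert (Hn1 : (1 <= INR n)%R) by (apply (le_INR 1); lia).
assert (Hnr : (0 < INR n ^ r)%R) by (apply pow_lt; lra).
assert (Hinr : (0 < / INR n ^ r)%R) by now apply Rinv_0_lt_compat.
assert (HUz : U0 z) by now apply HepsU.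
destruct (laminv z) as [x y] eqn:Exi.
destruct (B2 z HUz) as [_ Elam]; rewrite Exi in Elam.
assert (Hxi : (Cmod (x, y) < b / 2)%R).
{ rewrite <- Exi; pose proof (Hsmall z) as S; rewrite Hli1 in S.
  replace (laminv z - 0) with (laminv z) in S by ring; apply S; lra. }
assert (Hxi2 : (Cmod (x, y) <= 2 * b)%R) by lra.
assert (Hx : (Rabs x <= b / 2)%R) by (pose proof (re_le_Cmod (x, y)) as A; simpl in A; lra).
assert (Hy : (Rabs y <= b / 2)%R) by (pose proof (im_le_Cmod (x, y)) as A; simpl in A; lra).
assert (Ephi : phi z = (x, y) * (x, y)) by (rewrite <- Elam; now apply Hphi).
(* Re xi = 0 makes phi real and nonpositive, which is the descent path. *)
assert (Hx0 : x <> 0%R).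
{ intros ->; apply Hzd; split; [now apply Hslit|split].
  - pose proof (Im_phi z) as A; rewrite Ephi in A; unfold Im at 1 in A; simpl in A; lra.
  - rewrite Ephi, Re_sq; simpl; nra. }
assert (Hxp : (0 < Rabs x <= b / 2)%R) by (split; [now apply Rabs_pos_lt|easy]).
set (chi := side x).
set (w := winding_number gam z).
set (sn := sqrt (2 * PI * INR n)).
assert (Hsn1 : (1 <= sn)%R) by (apply sn_ge_1; exact Hn).
assert (Hsn0 : RtoC sn <> 0) by (intros A; apply RtoC_inj in A; lra).
(* Crude in n, but it is used only against exponentially small factors, where [exp_decay] has a
   factor n to spare. *)
assert (Hsn3 : (sn <= 3 * INR n)%R).
{ unfold sn; rewrite <- (sqrt_square (3 * INR n)) by lra.
  apply sqrt_le_1_alt; pose proof PI_4; nra. }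
(* [R1] is the deviation of the winding number from its local value, [R2] the remainder with the
   integrating factor undone. *)
set (R1 := (w - chi) * Cexp (INR n * phi z)).
set (R2 := (remainder lam n m (x, y) + chi) * Cexp (INR n * phi z)).
set (T := gfun r z / RtoC (INR n) ^ r + gfun m z / RtoC (INR n) ^ m).
exists (RtoC sn * (R1 + R2) + T); split.
- rewrite (F_residues gam Hcl) by (try apply Hadm; try easy; apply slit_plane_neq_0, Hslit, HUz).
  fold w; unfold P; rewrite Exi; fold sn.
  unfold R1, R2, remainder; rewrite Elam; fold sn.
  change (gsum n (S m) z) with (Csum (fun j => gfun j z / RtoC (INR n) ^ j) r
    + gfun r z / RtoC (INR n) ^ r + gfun m z / RtoC (INR n) ^ m).
  rewrite Cexp_opp, <- Ephi; unfold T.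
  pose proof (Cexp_neq_0 (RtoC (INR n) * phi z)).
  pose proof (INR_C_neq_0 n Hn).
  pose proof (Cpow_nz (RtoC (INR n)) r ltac:(easy)); pose proof (Cpow_nz (RtoC (INR n)) m ltac:(easy)).
  field; auto.
- assert (Hexp : Cmod (Cexp (INR n * phi z)) = exp (INR n * (x * x - y * y))).
  { rewrite Cmod_Cexp, Ephi; f_equal; unfold Re; simpl; ring. }
  assert (Hchi : (Cmod chi <= 1)%R).
  { unfold chi, side; destruct (Rlt_dec x 0); [rewrite Cmod_1|rewrite Cmod_0]; lra. }
  assert (BR1 : (Cmod R1 * sn <= 3 * (KW + 1) * K1 / INR n ^ r)%R).
  { destruct (Hdich x y Hxp Hy) as [E|[Hre Hw]]; [now rewrite Elam
      |rewrite Elam in E; fold w in E|rewrite Elam in Hw; fold w in Hw].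
    - unfold R1; rewrite E; fold chi; replace (chi - chi) with (RtoC 0) by ring.
      rewrite Cmult_0_l, Cmod_0, Rmult_0_l.
      apply Rmult_le_pos; [repeat apply Rmult_le_pos; lra|lra].
    - unfold R1; rewrite Cmod_mult, Hexp.
      assert (H1 : (Cmod (w - chi) <= KW + 1)%R).
      { unfold Cminus; eapply Rle_trans; [apply Cmod_triangle|]; rewrite Cmod_opp; lra. }
      assert (H2 : (exp (INR n * (x * x - y * y)) <= exp (- (INR n * mu)))%R).
      { assert (Hle : (INR n * (x * x - y * y) <= - (INR n * mu))%R) by nra.
        destruct (Rle_lt_or_eq_dec _ _ Hle) as [A|A]; [left; now apply exp_increasing|rewrite A; lra]. }
      pose proof (exp_pos (INR n * (x * x - y * y))); pose proof (Cmod_ge_0 (w - chi)).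
      specialize (D1 n Hn).
      apply Rle_trans with ((KW + 1) * exp (- (INR n * mu)) * (3 * INR n))%R.
      + apply Rmult_le_compat; try lra; [apply Rmult_le_pos; lra|apply Rmult_le_compat; lra].
      + replace ((KW + 1) * exp (- (INR n * mu)) * (3 * INR n))%R
          with (3 * (KW + 1) * (INR n * exp (- (INR n * mu))))%R by ring.
        replace (3 * (KW + 1) * K1 / INR n ^ r)%R with (3 * (KW + 1) * (K1 / INR n ^ r))%R by (field; lra).
        apply Rmult_le_compat_l; lra. }
  assert (HMg : forall z, (Cmod (z - 1) <= 1 / 4)%R -> (Cmod (gfun' m z) <= Mm)%R) by (intros; now apply HMm).
  assert (HMs' : forall z, (Cmod (z - 1) <= 1 / 4)%R -> (Cmod (gsum n (S m) z) <= Ms)%R) by (intros; now apply HMs).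
  pose proof (remainder_bound lam b Hb Hloc Hphi n m Hn Mm Ms HMm0 HMs0 HMg HMs' x y Hxp Hy) as Hrem.
  pose proof (stirling_defect_bound lam b Hb Hloc Hphi n m Hn Mm Ms HMm0 HMs0 HMg HMs') as Hdef.
  fold B0 sn chi in Hrem; fold B0 in Hdef.
  set (delta := Rabs (stirling_defect n m)) in *.
  assert (Hdelta : (0 <= delta)%R) by apply Rabs_pos.
  assert (BR2 : (Cmod R2 <= B0 * exp (- (INR n * (3 / 4 * (b * b)))) + / sn * (2 * (delta + 2 * Mm / INR n ^ m)))%R).
  { unfold R2; rewrite Cmod_mult, Hexp.
    apply Rmult_le_reg_r with (exp (- (INR n * (x * x - y * y)))); [apply exp_pos|].
    rewrite Rmult_assoc, <- exp_plus, Rplus_opp_r, exp_0, Rmult_1_r.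
    rewrite Rmult_comm; exact Hrem. }
  assert (Hnm : (INR n / INR n ^ m = / INR n ^ r)%R) by (unfold m; simpl; field; lra).
  assert (Him : (/ INR n ^ m <= / INR n ^ r)%R).
  { apply Rinv_le_contravar; [easy|apply Rle_pow; [easy|unfold m; lia]]. }
  assert (Hdel : (delta <= / b * (24 * B0 * K3 + 16 * Mm) * / INR n ^ r)%R).
  { apply Rmult_le_reg_r with b; [lra|].
    replace (/ b * (24 * B0 * K3 + 16 * Mm) * / INR n ^ r * b)%R
      with (24 * B0 * (K3 / INR n ^ r) + 16 * Mm * / INR n ^ r)%R by (field; lra).
    rewrite Hnm in Hdef; eapply Rle_trans; [exact Hdef|].
    apply Rplus_le_compat_r, Rmult_le_compat_l; [lra|]; now apply D3. }
  assert (BR2' : (Cmod R2 * sn <= (3 * B0 * K2 + (2 / b * (24 * B0 * K3 + 16 * Mm) + 4 * Mm)) / INR n ^ r)%R).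
  { apply Rle_trans with ((B0 * exp (- (INR n * (3 / 4 * (b * b)))) + / sn * (2 * (delta + 2 * Mm / INR n ^ m))) * sn)%R;
      [apply Rmult_le_compat_r; lra|].
    replace ((B0 * exp (- (INR n * (3 / 4 * (b * b)))) + / sn * (2 * (delta + 2 * Mm / INR n ^ m))) * sn)%R
      with (B0 * exp (- (INR n * (3 / 4 * (b * b)))) * sn + 2 * delta + 4 * (Mm * / INR n ^ m))%R
      by (field; split; [apply pow_nonzero; lra|lra]).
    replace ((3 * B0 * K2 + (2 / b * (24 * B0 * K3 + 16 * Mm) + 4 * Mm)) / INR n ^ r)%R
      with (3 * B0 * (K2 / INR n ^ r) + 2 * (/ b * (24 * B0 * K3 + 16 * Mm) * / INR n ^ r) + 4 * (Mm * / INR n ^ r))%R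
      by (field; lra).
    apply Rplus_le_compat; [apply Rplus_le_compat; [|lra]|].
    - apply Rle_trans with (3 * B0 * (INR n * exp (- (INR n * (3 / 4 * (b * b))))))%R.
      + replace (3 * B0 * (INR n * exp (- (INR n * (3 / 4 * (b * b))))))%R
          with (B0 * exp (- (INR n * (3 / 4 * (b * b)))) * (3 * INR n))%R by ring.
        apply Rmult_le_compat_l; [|easy]; apply Rmult_le_pos; [easy|left; apply exp_pos].
      + apply Rmult_le_compat_l; [lra|now apply D2].
    - apply Rmult_le_compat_l; [lra|now apply Rmult_le_compat_l]. }
  assert (BT : (Cmod T <= (Mr + Mm) / INR n ^ r)%R).
  { unfold T; eapply Rle_trans; [apply Cmod_triangle|].
    rewrite Rdiv_plus_distr; apply Rplus_le_compat.
    - exact (gterm_bound r n z r Mr Hn (Nat.le_refl r) (proj1 (HMr z ltac:(lra)))).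
    - exact (gterm_bound m n z r Mm Hn (Nat.le_succ_diag_r r) (proj1 (HMm z ltac:(lra)))). }
  eapply Rle_trans; [apply Cmod_triangle|].
  rewrite Cmod_mult, Cmod_R, Rabs_pos_eq by lra.
  pose proof (Cmod_triangle R1 R2) as Tr.
  assert (sn * Cmod (R1 + R2) <= Cmod R1 * sn + Cmod R2 * sn)%R.
  { rewrite <- Rmult_plus_distr_r, Rmult_comm; apply Rmult_le_compat_r; lra. }
  replace ((3 * (KW + 1) * K1 + 3 * B0 * K2 + (2 / b * (24 * B0 * K3 + 16 * Mm) + 4 * Mm) + (Mr + Mm)) / INR n ^ r)%R
    with (3 * (KW + 1) * K1 / INR n ^ r + (3 * B0 * K2 + (2 / b * (24 * B0 * K3 + 16 * Mm) + 4 * Mm)) / INR n ^ r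
      + (Mr + Mm) / INR n ^ r)%R by (field; lra).
  lra.
Qed.
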